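(* Let $P$ be the Ornstein–Uhlenbeck semigroup on $L^2(\rho_\infty)$ associated to $(Q,B)$, where $Q$ is a real $d\times d$ positive semi-definite matrix and $B$ is a real $d\times d$ matrix such that $\mathrm{Ker}(Q)$ does not contain any nontrivial invariant subspace of $B^*$. Suppose that $\sigma(B)\subseteq(0,\infty)$ and that $B$ is diagonalizable with similarity matrix $V$, i.e. $V$ is an invertible real matrix such that $VBV^{-1}$ is diagonal. Let $\gamma_1$ denote the spectral gap of $\mathbf{A}$, where $-\mathbf{A}$ is the generator of $P$ in $L^2(\rho_\infty)$; that is, $\gamma_1$ is the smallest eigenvalue of $B$. Then there exist a non-degenerate, hypoelliptic Ornstein–Uhlenbeck semigroup $\widetilde{P}$ (i.e. associated to a pair $(\widetilde{Q},\widetilde{B})$ with $\widetilde{Q}$ invertible), self-adjoint on $L^2(\widetilde{\rho}_\infty)$ where $\widetilde{\rho}_\infty$ is its invariant density, and quasi-affinities $\Lambda:L^2(\widetilde{\rho}_\infty)\to L^2(\rho_\infty)$ and $\widetilde{\Lambda}:L^2(\rho_\infty)\to L^2(\widetilde{\rho}_\infty)$ such that, for all $t\ge0$, $P_t\Lambda=\Lambda\widetilde{P}_t$ and $\widetilde{P}_t\widetilde{\Lambda}=\widetilde{\Lambda}P_t$, and furthermore, setting $\mathbf{t}=\frac{1}{\gamma_1}\log\kappa(VQ_\infty V^* )$, $$\widetilde{\Lambda}\Lambda=\widetilde{P}_{\mathbf{t}}.$$ Consequently, for any $f\in L^2(\rho_\infty)$ and $t\ge0$, $$\left\|P_tf-\int_{\mathbb{R}^d}f(x)\rho_\infty(x)dx\right\|_{L^2(\rho_\infty)}\le\kappa(VQ_\infty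 V^* )\,e^{-\gamma_1t}\left\|f-\int_{\mathbb{R}^d}f(x)\rho_\infty(x)dx\right\|_{L^2(\rho_\infty)}.$$
   Context: Let $d\ge1$. For a real matrix $B$ with $\sigma(B)\subseteq\{\mathrm{Re}(z)>0\}$ and a real positive semi-definite $Q$, put $Q_t=\int_0^te^{-sB}Qe^{-sB^*}ds$ and $Q_\infty=\int_0^\infty e^{-sB}Qe^{-sB^*}ds$. The condition that $\mathrm{Ker}(Q)$ contains no nontrivial $B^*$-invariant subspace is equivalent to $\det Q_t>0$ for all $t>0$ (hypoellipticity). Under it, the (hypoelliptic) Ornstein–Uhlenbeck semigroup associated to $(Q,B)$ is $$P_tf(x)=\frac{1}{(2\pi)^{d/2}(\det Q_t)^{1/2}}\int_{\mathbb{R}^d}f(e^{-tB}x-y)e^{-\langle Q_t^{-1}y,y\rangle/2}dy$$ for $t>0$ and bounded measurable $f$ (with $P_0=I$), which extends to a strongly continuous contraction semigroup on $L^2(\rho_\infty)=L^2(\mathbb{R}^d,\rho_\infty(x)dx)$, where $\rho_\infty(x)=(2\pi)^{-d/2}(\det Q_\infty)^{-1/2}e^{-\langle Q_\infty^{-1}x,x\rangle/2}$ is its unique invariant density. It is called non-degenerate if $Q$ is invertible. The spectrum of $\mathbf{A}$ in $L^2(\rho_\infty)$ is $\{\sum_ik_i\lambda_i:k_i\in\mathbb{N}\}$, where $\mathbb{N}=\{0,1,2,\dots\}$ and $\lambda_i$ are the distinct eigenvalues of $B$. A quasi-affinity is a bounded linear operator that is injective and has dense range. $\kappa(M)=\|M\|\,\|M^{-1}\|$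 is the condition number; for positive-definite $M$ it is the ratio of the largest to the smallest eigenvalue. *)

(* Defs.v *)
From HB Require Import structures.
From mathcomp Require Import all_boot all_order all_algebra.
From mathcomp Require Import all_classical all_reals all_analysis.
From mathcomp Require Import measurable_realfun.
From mathcomp.real_closed Require Import complex.

Set Implicit Arguments.
Unset Strict Implicit.
Unset Printing Implicit Defensive.

Import Order.TTheory GRing.Theory Num.Theory.
Import numFieldNormedType.Exports.

Local Open Scope classical_set_scope.
Local Open Scope ring_scope.

(* The sigma-algebra on matrices generated by the entries; on column vectors
   this is the Borel (product) sigma-algebra of R^n. *)
Section measurable_matrix.
Context {R : realType} (m n : nat).

Definition mx_cylinder : set (set 'M[R]_(m, n)) :=
  [set C | exists i j, exists2 A : set R, measurable A &
    C = [set M : 'M[R]_(m, n) | A (M i j)]].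

Let mx_set0 : <<s mx_cylinder >> set0.
Proof. exact: sigma_algebra0. Qed.

Let mx_setC A : <<s mx_cylinder >> A -> <<s mx_cylinder >> (~` A).
Proof. exact: sigma_algebraC. Qed.

Let mx_bigcup (F : (set 'M[R]_(m, n))^nat) :
  (forall i, <<s mx_cylinder >> (F i)) -> <<s mx_cylinder >> (\bigcup_i F i).
Proof. exact: sigma_algebra_bigcup. Qed.

HB.instance Definition _ := @isMeasurable.Build default_measure_display
  'M[R]_(m, n) <<s mx_cylinder >> mx_set0 mx_setC mx_bigcup.

Lemma measurable_mx_entry (i : 'I_m) (j : 'I_n) :
  measurable_fun setT (fun M : 'M[R]_(m, n) => M i j).
Proof.
move=> _ A mA; rewrite setTI; apply: sub_sigma_algebra.
by exists i, j, A.
Qed.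

Lemma measurable_fun_mx d (T : measurableType d) (f : T -> 'M[R]_(m, n)) :
  (forall i j, measurable_fun setT (fun x => f x i j)) ->
  measurable_fun setT f.
Proof.
move=> mf; apply: (@measurability _ _ _ _ _ f mx_cylinder) => //.
move=> _ [_ [i [j [A mA ->]]] <-].
exact: (mf i j measurableT A mA).
Qed.

End measurable_matrix.

Section lebesgue_cV.
Context {R : realType}.

Definition cons_cV n (p : measurableTypeR R * 'cV[R]_n) : 'cV[R]_n.+1 :=
  \col_i (if unlift ord0 i is Some j then p.2 j 0 else p.1).

Definition uncons_cV n (v : 'cV[R]_n.+1) : measurableTypeR R * 'cV[R]_n :=
  (v ord0 0, \col_j v (lift ord0 j) 0).

Lemma cons_cVK n : cancel (@cons_cV n) (@uncons_cV n).
Proof.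
move=> [a v]; rewrite /uncons_cV mxE unlift_none; congr pair.
by apply/colP => j; rewrite !mxE liftK.
Qed.

Lemma measurable_cons_cV n : measurable_fun setT (@cons_cV n).
Proof.
apply: measurable_fun_mx => i j.
rewrite (_ : (fun x => _) = fun p : measurableTypeR R * 'cV[R]_n =>
  if unlift ord0 i is Some j then p.2 j 0 else p.1); last first.
  by apply/funext => p; rewrite mxE.
case: unliftP => [k _|_]; last exact: measurable_fst.
apply: (measurableT_comp (f := fun M : 'cV[R]_n => M k 0)) => //.
exact: measurable_mx_entry.
Qed.

Lemma measurable_uncons_cV n : measurable_fun setT (@uncons_cV n).
Proof.
apply/measurable_fun_pairP; split; first exact: measurable_mx_entry.
apply: measurable_fun_mx => i j.
rewrite (_ : (fun x => _) = fun v : 'cV[R]_n.+1 => v (lift ord0 i) 0).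
  exact: measurable_mx_entry.
by apply/funext => v; rewrite /= mxE.
Qed.

Section lebesgue_cV_step.
Context n (mu : {sigma_finite_measure set 'cV[R]_n -> \bar R}).

Definition lebesgue_cV_step : set 'cV[R]_n.+1 -> \bar R :=
  pushforward (lebesgue_measure \x mu)%E (@cons_cV n).

HB.instance Definition _ := Measure.copy lebesgue_cV_step
  (measure_function_pushforward__canonical__measure_function_Measure
     (lebesgue_measure \x mu)%E (@measurable_cons_cV n)).

Let step_sigma_finite : sigma_finite setT lebesgue_cV_step.
Proof.
have /sigma_finiteP[F [FT ndF mF]] := sigma_finiteT (@lebesgue_measure R).
have /sigma_finiteP[G [GT ndG mG]] := sigma_finiteT mu.
exists (fun k => @uncons_cV n @^-1` (F k `*` G k)).
  rewrite -preimage_bigcup; apply/seteqP; split=> // v _ /=.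
  have : [set: measurableTypeR R] (v ord0 0) by [].
  rewrite FT => -[a _ Fa].
  have : [set: 'cV[R]_n] (uncons_cV v).2 by [].
  rewrite GT => -[b _ Gb].
  exists (maxn a b) => //; split => /=.
    by move: Fa; apply/subsetPset/ndF/leq_maxl.
  by move: Gb; apply/subsetPset/ndG/leq_maxr.
move=> k; have [mFk Fk] := mF k; have [mGk Gk] := mG k; split.
  rewrite -[X in measurable X]setTI.
  by apply: measurable_uncons_cV => //; exact: measurableX.
rewrite /lebesgue_cV_step /pushforward -comp_preimage.
rewrite (_ : _ \o _ = id); last by apply/funext => p /=; rewrite cons_cVK.
by rewrite preimage_id product_measure1E// lte_mul_pinfty// ge0_fin_numE.
Qed.

HB.instance Definition _ := Measure_isSigmaFinite.Build _ _ _
  lebesgue_cV_step step_sigma_finite.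

End lebesgue_cV_step.

(* Lebesgue measure on R^n: on R^0 the unit mass at the only point, on R^n.+1
   the product of the Lebesgue measures on R and R^n. *)
Fixpoint lebesgue_cV n : {sigma_finite_measure set 'cV[R]_n -> \bar R} :=
  if n is n'.+1 then lebesgue_cV_step (lebesgue_cV n')
  else dirac (0 : 'cV[R]_0).

End lebesgue_cV.

Lemma lebesgue_cVE {R : realType} n (A : 'I_n -> set R) :
  (forall i, measurable (A i)) ->
  lebesgue_cV n [set v : 'cV[R]_n | forall i, A i (v i 0)] =
  (\prod_(i < n) (lebesgue_measure : set R -> \bar R) (A i))%E.
Proof.
elim: n A => [|n IH] A mA.
  rewrite big_ord0 /= diracE mem_set//.
  by move=> [].
rewrite big_ord_recl /= /lebesgue_cV_step /pushforward.
rewrite -IH; last by move=> i; exact: mA.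
have mB : measurable [set v : 'cV[R]_n | forall i, A (lift ord0 i) (v i 0)].
  rewrite (_ : mkset _ = \bigcap_(i in [set: 'I_n])
     ((fun v : 'cV[R]_n => v i 0) @^-1` (A (lift ord0 i)))); last first.
    by apply/seteqP; split=> [v h i _|v h i]; [exact: h|exact: (h i I)].
  apply: fin_bigcap_measurable; first exact: finite_finset.
  move=> i _.
  by rewrite -[X in measurable X]setTI; apply: measurable_mx_entry.
rewrite (_ : _ @^-1` _ = A ord0 `*`
  [set v : 'cV[R]_n | forall i, A (lift ord0 i) (v i 0)]).
  by rewrite product_measure1E; [|exact: mA|exact: mB].
apply/seteqP; split=> [[a v] /= h|[a v] /= [ha hv] i].
  split=> [|i]; first by have := h ord0; rewrite mxE unlift_none.
  by have := h (lift ord0 i); rewrite mxE liftK.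
by rewrite mxE; case: unliftP => [j ->|->].
Qed.

Section gaussian.
Context {R : realType} (n : nat).
Implicit Types S : 'M[R]_n.

Definition qform S (x : 'cV[R]_n) : R := (x^T *m S *m x) 0 0.

(* Centered Gaussian density with covariance matrix S. *)
Definition gauss_pdf S (x : 'cV[R]_n) : R :=
  ((2 * pi) `^ (n%:R / 2))^-1 * (Num.sqrt (\det S))^-1 *
  expR (- (qform (invmx S) x / 2)).

Lemma gauss_pdf_ge0 S x : 0 <= gauss_pdf S x.
Proof.
by rewrite !mulr_ge0 ?expR_ge0// invr_ge0 ?powR_ge0// sqrtr_ge0.
Qed.

Lemma measurable_qform S : measurable_fun setT (qform S).
Proof.
have -> : qform S = fun x => \sum_i (\sum_j x j 0 * S j i) * x i 0.
  apply/funext => x; rewrite /qform mxE; apply: eq_bigr => i _.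
  by rewrite mxE; congr (_ * _); apply: eq_bigr => j _; rewrite mxE.
apply: measurable_sum => i; apply: measurable_funM; last first.
  exact: measurable_mx_entry.
apply: measurable_sum => j; apply: measurable_funM => //.
exact: measurable_mx_entry.
Qed.

Lemma measurable_gauss_pdf S : measurable_fun setT (gauss_pdf S).
Proof.
apply: measurable_funM => //; apply: measurableT_comp => //.
apply: measurableT_comp => //; apply: measurable_funM => //.
exact: measurable_qform.
Qed.

Definition gauss_measure S (A : set 'cV[R]_n) : \bar R :=
  (\int[lebesgue_cV n]_(x in A) (gauss_pdf S x)%:E)%E.

Section gauss_measure_is_measure.
Variable S : 'M[R]_n.

Let gauss_measure0 : gauss_measure S set0 = 0%E.
Proof. by rewrite /gauss_measure integral_set0. Qed.

Let gauss_measure_ge0 A : (0 <= gauss_measure S A)%E.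
Proof. by apply: integral_ge0 => x _; rewrite lee_fin gauss_pdf_ge0. Qed.

Let gauss_measure_sigma_additive : semi_sigma_additive (gauss_measure S).
Proof.
move=> A mA tA mUA; rewrite /gauss_measure ge0_integral_bigcup//=; first last.
- by move=> x _; rewrite lee_fin gauss_pdf_ge0.
- by apply/measurable_EFinP/measurable_funTS; exact: measurable_gauss_pdf.
apply: is_cvg_ereal_nneg_natsum_cond => k _ _.
by apply: integral_ge0 => x _; rewrite lee_fin gauss_pdf_ge0.
Qed.

HB.instance Definition _ := isMeasure.Build _ _ _ (gauss_measure S)
  gauss_measure0 gauss_measure_ge0 gauss_measure_sigma_additive.

End gauss_measure_is_measure.

End gaussian.

Section matrices.
Context {R : realType} {n : nat}.
Implicit Types (A B Q M : 'M[R]_n) (x : 'cV[R]_n).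

Definition expmx A : 'M[R]_n :=
  limn (series (fun k : nat => (k`!%:R : R)^-1 *: A ^+ k)).

Definition positive_semidefinite Q : Prop :=
  Q^T = Q /\ forall x, 0 <= qform Q x.

(* Ker Q contains no nontrivial subspace invariant under the adjoint of B. *)
Definition hypoelliptic Q B : Prop :=
  forall W : {vspace 'cV[R]_n},
    (forall x, x \in W -> Q *m x = 0) ->
    (forall x, x \in W -> B^T *m x \in W) ->
    W = 0%VS.

Definition spectrum B : set R[i] :=
  [set z | eigenvalue (map_mx (real_complex R) B) z].

Definition enorm x : R := Num.sqrt (\sum_i x i 0 ^+ 2).

Definition opnorm M : R := sup [set enorm (M *m x) | x in [set x | enorm x <= 1]].

Definition condition_number M : R := opnorm M * opnorm (invmx M).

Definition cov_mx_integrand Q B (s : R) : 'M[R]_n :=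
  expmx ((- s) *: B) *m Q *m expmx ((- s) *: B^T).

Definition cov_mx Q B (t : R) : 'M[R]_n :=
  \matrix_(i, j) \int[lebesgue_measure]_(s in `[0, t])
    cov_mx_integrand Q B s i j.

Definition cov_mx_oo Q B : 'M[R]_n :=
  \matrix_(i, j) \int[lebesgue_measure]_(s in `[0, +oo[)
    cov_mx_integrand Q B s i j.

End matrices.

(* Elements of L^2 are represented by square-integrable measurable functions;
   every notion below is invariant under a.e. modification. *)
Definition L2 d (T : measurableType d) (R : realType)
  (mu : {measure set T -> \bar R}) := LfunType mu (lee1n 2).

Section L2_operators.
Context d d' (T : measurableType d) (T' : measurableType d') (R : realType).
Variables (mu : {measure set T -> \bar R}) (nu : {measure set T' -> \bar R}).

Local Notation "''N2[' m ]_ f" := ('N[m]_2[EFin \o f])%E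
  (at level 10, m at level 0, f at level 8).

Definition bounded_linear (L : L2 mu -> L2 nu) : Prop :=
  (forall (a : R) (f g : L2 mu),
     L (a *: f + g) = a *: L f + L g %[ae nu]) /\
  exists C : R, forall f : L2 mu, ('N2[nu]_(L f) <= C%:E * 'N2[mu]_f)%E.

Definition quasi_affinity (L : L2 mu -> L2 nu) : Prop :=
  [/\ bounded_linear L,
      forall f : L2 mu, L f = 0 %[ae nu] -> f = 0 %[ae mu] &
      forall (g : L2 nu) (e : R), 0 < e ->
        exists f : L2 mu, ('N2[nu]_(L f - g)%R < e%:E)%E].

Definition self_adjoint (L : L2 mu -> L2 mu) : Prop :=
  forall f g : L2 mu, \int[mu]_x (L f x * g x) = \int[mu]_x (f x * L g x).

Definition contraction_semigroup (P : R -> L2 mu -> L2 mu) : Prop :=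
  [/\ forall t, 0 <= t -> forall (a : R) (f g : L2 mu),
        P t (a *: f + g) = a *: P t f + P t g %[ae mu],
      forall t, 0 <= t -> forall f : L2 mu, ('N2[mu]_(P t f) <= 'N2[mu]_f)%E,
      forall f : L2 mu, P 0 f = f %[ae mu],
      forall s t, 0 <= s -> 0 <= t -> forall f : L2 mu,
        P (s + t) f = P s (P t f) %[ae mu] &
      forall f : L2 mu, 'N2[mu]_(P t f - f)%R @[t --> 0^'+] --> 0%E].

End L2_operators.

Section OrnsteinUhlenbeck.
Context {R : realType} {n : nat}.
Implicit Types Q B : 'M[R]_n.

Definition invariant_measure Q B : {measure set 'cV[R]_n -> \bar R} :=
  gauss_measure (cov_mx_oo Q B).

(* Standing assumptions under which the Ornstein-Uhlenbeck semigroup is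
   defined. *)
Definition OU_pair Q B : Prop :=
  [/\ positive_semidefinite Q, hypoelliptic Q B &
      spectrum B `<=` [set z | 0 < complex.Re z]].

Definition OU_formula Q B (t : R) (f : 'cV[R]_n -> R) (x : 'cV[R]_n) : R :=
  \int[lebesgue_cV n]_y
    (f (expmx ((- t) *: B) *m x - y) * gauss_pdf (cov_mx Q B t) y).

(* P is the extension of the formula to L^2: bounded functions being dense,
   the last clause determines P t up to a.e. equality. *)
Definition OU_semigroup Q B
    (P : R -> L2 (invariant_measure Q B) -> L2 (invariant_measure Q B)) : Prop :=
  contraction_semigroup P /\
  forall t, 0 < t -> forall f : L2 (invariant_measure Q B),
    (exists M : R, forall x, `|f x| <= M) ->
    (P t f : 'cV[R]_n -> R) = OU_formula Q B t f %[ae invariant_measure Q B].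

End OrnsteinUhlenbeck.

(* Main.v *)
From HB Require Import structures.
Require Import Defs.
From mathcomp Require Import all_boot all_order all_algebra.
From mathcomp Require Import all_classical all_reals all_analysis.
From mathcomp Require Import measurable_realfun.
From mathcomp.real_closed Require Import complex.
From mathcomp Require Import ring lra.

(** Everything is a Gaussian transition.  For positive definite [S1] and [S2]
and a matrix [M] with [S1 - M *m S2 *m M^T] positive definite, let [X] be a
centered Gaussian vector of covariance [S2] and [N] an independent one such that
[M X + N] has covariance [S1].  The Mehler operator of [M] maps a function [f],
square integrable for the Gaussian law of covariance [S1], to the conditional
expectation of [f (M X + N)] given [X], square integrable for the law of
covariance [S2].  It is a contraction, being a conditional expectation
([mehler_contract]); transitions compose by multiplying their matrices
([mehler_comp]); when [S1] and [S2] are equal and [M] is self-adjoint for them,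
the operator is symmetric ([mehler_sym]); when [M] is invertible the operator is
injective with dense range ([mehler_injective], [mehler_dense]).

The given semigroup consists of the Mehler operators of the flow
[expmx (- t B)] on the law of its stationary covariance [S], because the noise
accumulated up to time [t] has covariance [S] minus the flow of [S]
([cov_mx_flow], [OU_semigroup_mehler]); hypoellipticity makes these covariances
positive definite ([posdef_cov_of]).  The self-adjoint semigroup is the one with
the same drift and a stationary covariance [S'] that is a multiple [c] of the
identity in the eigenbasis of [B].  Intertwining is then automatic: a Mehler
operator between the two laws whose matrix is a function of [B] commutes with
the flow.  There are such operators with matrix [1] from the law of [S'] to that
of [S], and with matrix the flow at time [t] the other way, as soon as [S']
dominates [S] and [S] dominates the flow of [S'].  With [U := V *m S *m V^T],
these conditions read [opnorm U < c] and
[c * opnorm (invmx U) < expR (2 gamma1 t)]; at the time prescribed by the theorem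
they leave room for [c] exactly when the condition number exceeds one
([intertwined_condition_number_gt1]).  When it is one, [S] is already a multiple
of the identity in the eigenbasis ([intertwined_condition_number1]).

For the convergence estimate, the transition of the flow is split at an
isotropic law into three transitions, the middle one being the number semigroup
of that law, the Mehler operators of the scalar matrices [expR (- s)]
([flow_gap]).  That semigroup contracts functions of mean zero by [expR (- s)]
([numsg_gap]): its Hilbert-Schmidt norm, a trace that can be computed, has this
rate up to a constant, and log-convexity of [dot f (N t f)] along a symmetric
semigroup removes the constant ([sgr_decay]).

The same log-convexity yields injectivity and dense range for symmetric
semigroups continuous at the origin ([sgr_injective], [sgr_dense]), hence for
the number semigroup, hence for the Mehler operators of invertible matrices,
which are factors of it.  Continuity of the number semigroup is proved on
half-spaces by a Gaussian tail bound and extended by observing that the sets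
seldom left in a short time form a sigma-algebra ([small_exit_measurable]); the
self-adjoint semigroup inherits it because its form dominates that of a number
semigroup run faster ([iso_flow_form_ge]). *)

Set Implicit Arguments.
Unset Strict Implicit.
Unset Printing Implicit Defensive.

Import Order.TTheory GRing.Theory Num.Theory.
Import numFieldNormedType.Exports.

Local Open Scope classical_set_scope.
Local Open Scope ring_scope.

(** * The inner product of L^2 *)

Section dot.
Context d (T : measurableType d) (R : realType).
Variable mu : {measure set T -> \bar R}.
Implicit Types f g h : L2 mu.

Lemma L2_integrable_mul f g : mu.-integrable setT (EFin \o (fun x => f x * g x)).
Proof.
by apply/(@Lfun1_integrable _ _ _ mu (f \* g))/Lfun2_mul_Lfun1; exact: LfunP.
Qed.

Definition dot f g : R := \int[mu]_x (f x * g x).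

Lemma dotC f g : dot f g = dot g f.
Proof. by apply: eq_Rintegral => x _; rewrite mulrC. Qed.

Lemma dotDl f g h : dot (f + g) h = dot f h + dot g h.
Proof.
rewrite /dot -RintegralD//; [|exact: L2_integrable_mul|exact: L2_integrable_mul].
by apply: eq_Rintegral => x _; rewrite mulrDl.
Qed.

Lemma dotZl a f g : dot (a *: f) g = a * dot f g.
Proof.
rewrite /dot -RintegralZl//; last exact: L2_integrable_mul.
by apply: eq_Rintegral => x _; rewrite -mulrA.
Qed.

Lemma dotDr f g h : dot h (f + g) = dot h f + dot h g.
Proof. by rewrite dotC dotDl !(dotC h). Qed.

Lemma dotZr a f g : dot g (a *: f) = a * dot g f.
Proof. by rewrite dotC dotZl dotC. Qed.

Lemma dotNl f g : dot (- f) g = - dot f g.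
Proof. by rewrite -scaleN1r dotZl mulN1r. Qed.

Lemma dotNr f g : dot g (- f) = - dot g f.
Proof. by rewrite dotC dotNl dotC. Qed.

Lemma dotBl f g h : dot (f - g) h = dot f h - dot g h.
Proof. by rewrite dotDl dotNl. Qed.

Lemma dotBr f g h : dot h (f - g) = dot h f - dot h g.
Proof. by rewrite dotDr dotNr. Qed.

Definition dotE := (dotDl, dotDr, dotNl, dotNr, dotZl, dotZr).

Lemma dot_ge0 f : 0 <= dot f f.
Proof. by apply: Rintegral_ge0 => x _; rewrite -expr2 sqr_ge0. Qed.

Lemma dot_cauchy_schwarz f g : dot f g ^+ 2 <= dot f f * dot g g.
Proof.
have [g0|g0] := eqVneq (dot g g) 0.
  have [->|fg0] := eqVneq (dot f g) 0; first by rewrite g0 mulr0 expr0n.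
  pose a := - (dot f f + 1) / (2 * dot f g).
  have := dot_ge0 (f + a *: g).
  rewrite !dotE g0 (dotC g f).
  rewrite (_ : _ + _ = - 1); last by rewrite /a; field.
  by rewrite ler0N1.
have gp : 0 < dot g g by rewrite lt_neqAle eq_sym g0 dot_ge0.
have := dot_ge0 (f - (dot f g / dot g g) *: g).
rewrite !dotE (dotC g f).
set a := dot f f; set b := dot f g; set c := dot g g in g0 gp *.
rewrite (_ : _ + _ = (a * c - b ^+ 2) / c); last by field.
by rewrite pmulr_lge0 ?invr_gt0// subr_ge0.
Qed.

Lemma L2_normE f : ('N[mu]_2[EFin \o f])%E = (Num.sqrt (dot f f))%:E.
Proof.
rewrite unlock /Lnorm /dot /Rintegral.
have -> : (\int[mu]_x `|(EFin \o f) x| `^ 2 = \int[mu]_x (f x * f x)%:E)%E.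
  apply: eq_integral => x _ /=; congr EFin.
  by rewrite -[2]/(2%:R) powR_mulrn// real_normK ?num_real// expr2.
rewrite -[in LHS](@fineK _ (\int[mu]_x (f x * f x)%:E)%E).
  by rewrite poweR_EFin -powR12_sqrt// fine_ge0// integral_ge0// => x _;
    rewrite lee_fin -expr2 sqr_ge0.
exact: integrable_fin_num (L2_integrable_mul f f).
Qed.

Lemma dot_eq0 f : dot f f = 0 -> f = 0 %[ae mu].
Proof. by move=> f0; apply: fine_Lnormr_eq0; rewrite L2_normE/= f0 sqrtr0. Qed.

Lemma dot_ae f g h : f = g %[ae mu] -> dot f h = dot g h.
Proof.
move=> fg; congr fine; apply: ae_eq_integral => //.
- exact: measurable_int (L2_integrable_mul f h).
- exact: measurable_int (L2_integrable_mul g h).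
- by apply: filterS fg => x /= fg _; rewrite fg.
Qed.

Lemma dot_aer f g h : f = g %[ae mu] -> dot h f = dot h g.
Proof. by move=> /(dot_ae h) fg; rewrite dotC fg dotC. Qed.

Lemma dot_ae0 f : f = 0 %[ae mu] -> dot f f = 0.
Proof. by move=> f0; rewrite (@dot_ae f 0 f f0) -(scale0r f) dotZl mul0r. Qed.

Lemma ae_dot f g : f = g %[ae mu] <-> dot (f - g) (f - g) = 0.
Proof.
split=> [fg|/dot_eq0].
  apply: dot_ae0; apply: filterS fg => x /(_ I) fg _.
  by rewrite -[LHS]/(f x - g x) fg subrr.
apply: filterS => x /(_ I); rewrite -[X in X = _]/(f x - g x) => /eqP.
by rewrite -[0 x]/(0 : R) subr_eq0 => /eqP fg _.
Qed.

Lemma ae_dotP f g : (forall h, dot f h = dot g h) -> f = g %[ae mu].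
Proof. by move=> fg; apply/ae_dot; rewrite dotBl fg subrr. Qed.

Definition nrm f : R := Num.sqrt (dot f f).

Lemma nrm_ge0 f : 0 <= nrm f. Proof. exact: sqrtr_ge0. Qed.

Lemma sqr_nrm f : nrm f ^+ 2 = dot f f.
Proof. by rewrite sqr_sqrtr// dot_ge0. Qed.

Lemma dot_le_nrm f g : dot f g <= nrm f * nrm g.
Proof.
rewrite -sqrtrM ?dot_ge0// (le_trans (ler_norm _))//.
by rewrite -sqrtr_sqr ler_wsqrtr// dot_cauchy_schwarz.
Qed.

Lemma nrmD f g : nrm (f + g) <= nrm f + nrm g.
Proof.
rewrite -(@ler_pXn2r _ 2)// ?nnegrE ?addr_ge0 ?nrm_ge0//.
rewrite sqr_nrm sqrrD !sqr_nrm !dotE (dotC g f).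
by have := dot_le_nrm f g; lra.
Qed.

Lemma nrmZ a f : nrm (a *: f) = `|a| * nrm f.
Proof.
by rewrite /nrm !dotE mulrA -expr2 sqrtrM ?sqr_ge0// sqrtr_sqr.
Qed.

Lemma nrmN f : nrm (- f) = nrm f.
Proof. by rewrite -scaleN1r nrmZ normrN1 mul1r. Qed.

Lemma nrm_ae f g : f = g %[ae mu] -> nrm f = nrm g.
Proof.
by move=> fg; rewrite /nrm (dot_ae f fg) dotC (dot_ae g fg).
Qed.

Lemma nrm_le f (a : R) : 0 <= a -> (nrm f <= a) = (dot f f <= a ^+ 2).
Proof.
by move=> a0; rewrite -sqr_nrm ler_pXn2r// nnegrE ?nrm_ge0.
Qed.

End dot.

(** * Symmetric contraction semigroups *)

Section dyadic_scales.
Context (R : realType).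

Lemma natr_le_exp2 (x : R) : exists k, x <= (2 ^ k)%:R.
Proof.
exists `|Num.ceil x|%N; apply: (@le_trans _ _ `|Num.ceil x|%N%:R).
  by rewrite natr_absz (le_trans (ceil_ge _))// ler_int ler_norm.
by rewrite ler_nat ltnW// ltn_expl.
Qed.

Lemma bernoulli_ineq m (y : R) : 1 <= y -> m%:R * (y - 1) + 1 <= y ^+ m.
Proof.
move=> y1; elim: m => [|m IH]; first by rewrite mul0r add0r expr0.
rewrite exprS -natr1.
have y0 : 0 <= y by lra.
apply: le_trans (ler_wpM2l y0 IH).
rewrite -subr_ge0 (_ : _ - _ = m%:R * (y - 1) ^+ 2); last by ring.
by rewrite mulr_ge0 ?sqr_ge0.
Qed.

Lemma dyadic_small (a b : R) : 0 < b -> exists k, a / 2 ^+ k <= b.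
Proof.
move=> b0; have [k kP] := natr_le_exp2 (a / b); exists k.
by rewrite ler_pdivrMr ?exprn_gt0// mulrC -ler_pdivrMr// -natrX.
Qed.

Lemma halfK (a : R) k : (a / 2 ^+ k.+1) *+ 2 = a / 2 ^+ k.
Proof. by rewrite exprS invfM mulrCA -mulr_natl mulVKf. Qed.

End dyadic_scales.

Section symmetric_semigroup.
Context d (T : measurableType d) (R : realType).
Variable mu : {measure set T -> \bar R}.
Variable N : R -> L2 mu -> L2 mu.
Implicit Types (f g h : L2 mu) (s t : R).

Hypothesis dotNN : forall s t f g, 0 < s -> 0 < t ->
  dot (N s f) (N t g) = dot f (N (s + t) g).
Hypothesis N_contract : forall t f, 0 < t -> dot (N t f) (N t f) <= dot f f.

Lemma sgr_sym t f g : 0 < t -> dot (N t f) g = dot f (N t g).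
Proof.
move=> t0; have t20 : 0 < t / 2 by rewrite divr_gt0.
by rewrite dotC [t]splitr -!dotNN// dotC.
Qed.

Lemma sgr_half t f g : 0 < t -> dot f (N t g) = dot (N (t / 2) f) (N (t / 2) g).
Proof. by move=> t0; rewrite dotNN ?divr_gt0// -splitr. Qed.

Lemma sgrD s t f : 0 < s -> 0 < t -> N (s + t) f = N s (N t f) %[ae mu].
Proof.
move=> s0 t0; apply: ae_dotP => h.
by rewrite dotC -dotNN// sgr_sym// dotC.
Qed.

Lemma sgr_comm s t f g : 0 < s -> 0 < t ->
  dot f (N s (N t g)) = dot f (N t (N s g)).
Proof. by move=> s0 t0; rewrite -(sgr_sym f _ s0) -(sgr_sym f _ t0) !dotNN// addrC. Qed.

Lemma sgr_dotDl t f g h : 0 < t ->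
  dot (N t (f + g)) h = dot (N t f) h + dot (N t g) h.
Proof. by move=> t0; rewrite !sgr_sym// dotDl. Qed.

Lemma sgr_form_ge0 t f : 0 < t -> 0 <= dot f (N t f).
Proof. by move=> t0; rewrite sgr_half// dot_ge0. Qed.

Lemma sgr_form_le t f : 0 < t -> dot f (N t f) <= dot f f.
Proof. by move=> t0; rewrite sgr_half// N_contract ?divr_gt0. Qed.

Lemma sgr_form_mono s t f : 0 < s -> s <= t -> dot f (N t f) <= dot f (N s f).
Proof.
move=> s0; rewrite le_eqVlt => /orP[/eqP -> //|st].
have s20 : 0 < s / 2 by rewrite divr_gt0.
have st0 : 0 < (t - s) / 2 by rewrite divr_gt0// subr_gt0.
rewrite [leLHS]sgr_half ?(lt_trans s0)// [leRHS]sgr_half//.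
rewrite (_ : t / 2 = (t - s) / 2 + s / 2); last by field.
rewrite (dot_ae _ (sgrD f st0 s20)) dotC (dot_ae _ (sgrD f st0 s20)).
exact: N_contract.
Qed.

(** Cauchy-Schwarz between [f] and [N (t *+ 2) f]: the form is log-convex in
  time.  Every passage below from asymptotic or approximate information to an
  exact statement rests on it. *)
Lemma sgr_form_dbl t f : 0 < t ->
  dot f (N t f) ^+ 2 <= dot f f * dot f (N (t *+ 2) f).
Proof. by move=> t0; rewrite mulr2n -dotNN//; exact: dot_cauchy_schwarz. Qed.

Lemma sgr_form_dbl_exp t f k : 0 < t ->
  dot f (N t f) ^+ (2 ^ k) * dot f f
    <= dot f f ^+ (2 ^ k) * dot f (N (t *+ 2 ^ k) f).
Proof.
move=> t0; elim: k => [|k IH]; first by rewrite !expr1 mulr1n mulrC.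
have [f0|f0] := eqVneq (dot f f) 0.
  by rewrite f0 mulr0 expr0n expn_eq0/= mul0r.
have {}f0 : 0 < dot f f by rewrite lt_neqAle eq_sym f0 dot_ge0.
rewrite -(ler_pM2r f0) expnS mulnC !exprM.
set x := _ ^+ (2 ^ k) in IH *; set D := dot f f in IH f0 *.
have x0 : 0 <= x by rewrite exprn_ge0// sgr_form_ge0.
have tk : 0 < t *+ 2 ^ k by rewrite pmulrn_lgt0// expn_gt0.
have := sgr_form_dbl f tk; rewrite -mulrnA mulnC -expnS -/D => le2.
rewrite -mulrA -expr2 -exprMn.
have le1 : (x * D) ^+ 2 <= (D ^+ (2 ^ k) * dot f (N (t *+ 2 ^ k) f)) ^+ 2.
  rewrite ler_pXn2r// nnegrE ?mulr_ge0 ?(ltW f0)// ?exprn_ge0 ?(ltW f0)//.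
  exact: sgr_form_ge0.
apply: (le_trans le1); rewrite exprMn -!mulrA ler_pM2l ?exprn_gt0//.
by rewrite ler_pM2l ?exprn_gt0// [leRHS]mulrC.
Qed.

(** A decay rate that holds asymptotically, with any constant, holds at all
  times with constant one: log-convexity leaves no room for a transient. *)
Lemma sgr_decay f (C t0 : R) :
  (forall t, t0 <= t -> dot f (N t f) <= C * expR (- t)) ->
  forall t, 0 < t -> dot (N t f) (N t f) <= expR (- t) ^+ 2 * dot f f.
Proof.
move=> decay; suff form t : 0 < t -> dot f (N t f) <= expR (- t) * dot f f.
  move=> t tp; rewrite dotNN// -expRM_natl mulr_natl.
  rewrite mulr2n (_ : - t + - t = - (t + t)) ?form ?addr_gt0//.
  by rewrite opprD.
move=> tp; have [f0|f0] := eqVneq (dot f f) 0.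
  by rewrite (le_trans (sgr_form_le f tp))// f0 mulr0.
have {}f0 : 0 < dot f f by rewrite lt_neqAle eq_sym f0 dot_ge0.
rewrite leNgt; apply/negP => gtf.
set p := dot f (N t f) in gtf; set D := dot f f in f0 gtf.
pose y := p / (expR (- t) * D).
have eD0 : 0 < expR (- t) * D by rewrite mulr_gt0 ?expR_gt0.
have y1 : 1 < y by rewrite /y ltr_pdivlMr// mul1r.
have yle k : t0 <= t *+ 2 ^ k -> y ^+ (2 ^ k) <= C / D.
  move=> /decay dec.
  have := sgr_form_dbl_exp f k tp; rewrite -/p -/D => dbl.
  have eE : expR (- (t *+ 2 ^ k)) = expR (- t) ^+ (2 ^ k).
    by rewrite -expRM_natl mulrN mulr_natl.
  rewrite eE in dec.
  rewrite /y expr_div_n ler_pdivrMr ?exprn_gt0// -(ler_pM2r f0).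
  apply: (le_trans dbl); rewrite exprMn.
  rewrite (_ : C / D * _ * D =  D ^+ (2 ^ k) * (C * expR (- t) ^+ (2 ^ k))).
    by rewrite ler_wpM2l// exprn_ge0// ltW.
  by move: (_ ^+ _) (_ ^+ _) => E Dk; field; rewrite gt_eqF.
have [k kP] := natr_le_exp2 (Num.max (t0 / t) (C / D / (y - 1))).
move: kP; rewrite ge_max => /andP[k1 k2].
have := yle k; rewrite -[t *+ _]mulr_natl -ler_pdivrMr// => /(_ k1).
apply/negP; rewrite -ltNge; rewrite ler_pdivrMr ?subr_gt0// in k2.
apply: (le_lt_trans k2); apply: lt_le_trans (bernoulli_ineq _ (ltW y1)).
by rewrite ltrDl.
Qed.

(** Weak continuity at the origin; as the form decreases in time, one time
  close to the origin controls all the earlier ones. *)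
Hypothesis form_cvg0 : forall f (e : R), 0 < e ->
  exists2 t, 0 < t & dot f f - e <= dot f (N t f).

Lemma sgr_strong_cvg0 f (e : R) : 0 < e -> exists2 t0, 0 < t0 &
  forall t, 0 < t -> t <= t0 -> dot (N t f - f) (N t f - f) <= e.
Proof.
move=> e0; have [t0 t00 le] := form_cvg0 f e0; exists t0 => // t tp tt0.
have := sgr_form_mono f tp tt0.
have : dot f (N (t + t) f) <= dot f (N t f).
  by apply: sgr_form_mono; rewrite // lerDl ltW.
rewrite !dotE dotNN// (sgr_sym f f tp).
by lra.
Qed.

(** If the form vanishes at time [t], log-convexity makes it vanish at every
  [t / 2 ^+ k], and its limit at the origin is the squared norm. *)
Lemma sgr_injective t f : 0 < t -> N t f = 0 %[ae mu] -> f = 0 %[ae mu].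
Proof.
move=> t0 Nf0; apply: dot_eq0.
have f0 k : dot f (N (t / 2 ^+ k) f) = 0.
  elim: k => [|k IH].
    rewrite expr0 divr1 dotC (@dot_ae _ _ _ _ _ 0 f Nf0).
    by rewrite -(scale0r f) dotZl mul0r.
  have tk : 0 < t / 2 ^+ k.+1 by rewrite divr_gt0// exprn_gt0.
  have := sgr_form_dbl f tk.
  rewrite halfK.
  by rewrite IH mulr0 => ?; apply/eqP; rewrite -sqrf_eq0 eq_le sqr_ge0 andbT.
apply/eqP; rewrite eq_le dot_ge0 andbT; apply/ler_addgt0Pl => e e0.
have [s s0 le] := form_cvg0 f e0.
have [k tk] := dyadic_small t s0.
have := sgr_form_mono f _ tk; rewrite f0 divr_gt0 ?exprn_gt0//.
by move=> /(_ isT) => ?; lra.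
Qed.

Lemma sgr_contract_compl t h : 0 < t ->
  dot (h - N t h) (h - N t h) <= dot h h - dot h (N t h).
Proof.
move=> t0; rewrite !dotE dotNN// (sgr_sym h h t0).
have : dot h (N (t + t) h) <= dot h (N t h).
  by apply: sgr_form_mono; rewrite // lerDl ltW.
lra.
Qed.

(** Smallness of the form goes back from [t] to [t / 2 ^+ m], uniformly on a
  ball, by [m] applications of log-convexity. *)
Lemma sgr_form_dyadic (D t : R) m (e : R) : 0 <= D -> 0 < t -> 0 < e ->
  exists2 r : R, 0 < r & forall h, dot h h <= D -> dot h (N t h) <= r ->
    dot h (N (t / 2 ^+ m) h) <= e.
Proof.
move=> D0 t0; elim: m e => [|m IH] e e0.
  by exists e => // h _; rewrite expr0 divr1.
have D1 : 0 < D + 1 by lra.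
have [|r r0 H] := IH (e ^+ 2 / (D + 1)); first by rewrite divr_gt0// exprn_gt0.
exists r => // h hD /(H h hD) le.
have tm : 0 < t / 2 ^+ m.+1 by rewrite divr_gt0// exprn_gt0.
have := sgr_form_dbl h tm.
rewrite halfK.
have p0 : 0 <= dot h (N (t / 2 ^+ m) h).
  by rewrite sgr_form_ge0// divr_gt0// exprn_gt0.
move=> dbl; rewrite -(@ler_pXn2r _ 2)// ?nnegrE ?(ltW e0)//; last first.
  exact: sgr_form_ge0.
apply: (le_trans dbl).
rewrite ler_pdivlMr// in le; apply: le_trans le.
have : dot h h * dot h (N (t / 2 ^+ m) h) <= D * dot h (N (t / 2 ^+ m) h).
  by rewrite ler_wpM2r.
lra.
Qed.

(** The range of a symmetric contraction [N t] is dense as soon as the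
  semigroup is continuous: the Richardson iterates of the equation [N t f = g]
  have residuals [h] with [dot h (N t h)] arbitrarily small; by log-convexity
  so is [dot h (N s h)] at smaller times [s], and continuity at the origin,
  uniform along the iteration, then makes [h] itself small. *)
Lemma sgr_dense t g (e : R) : 0 < t -> 0 < e ->
  exists f, dot (N t f - g) (N t f - g) <= e.
Proof.
move=> t0 e0.
pose F := fix F k := if k is k'.+1 then F k' + (g - N t (F k')) else 0 : L2 mu.
pose H k := g - N t (F k).
have HS k h : dot (H k.+1) h = dot (H k - N t (H k)) h.
  rewrite /H /= !dotBl sgr_dotDl// -/(H k).
  by rewrite opprD addrA.
have H0 h : dot (H 0%N) h = dot g h.
  rewrite /H /= dotBl sgr_sym// -[X in dot X (N t h)](scale0r g) dotZl mul0r.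
  by rewrite subr0.
have HE k : H k = g - N t (F k) by [].
clearbody H.
have HSn k : dot (H k.+1) (H k.+1) <= dot (H k) (H k) - dot (H k) (N t (H k)).
  by rewrite HS dotC HS; exact: sgr_contract_compl.
have Hle k : dot (H k) (H k) <= dot g g.
  elim: k => [|k IH]; first by rewrite H0 dotC H0.
  apply: (le_trans (HSn k)); have := sgr_form_ge0 (H k) t0; lra.
pose D := dot g g.
have D0 : 0 <= D := dot_ge0 g.
have Dp : 0 < D + 1 by lra.
have e20 : 0 < e / 2 by rewrite divr_gt0.
have e1p : 0 < (e / 2) ^+ 2 / (D + 1) by rewrite divr_gt0 ?exprn_gt0.
have [s0 s00 cvg] := sgr_strong_cvg0 g e1p.
have [m sm] := dyadic_small t s00.
have [r r0 small] := sgr_form_dyadic m D0 t0 e20.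
set s := t / 2 ^+ m in sm small.
have sp : 0 < s by rewrite divr_gt0// exprn_gt0.
have [k Hk] : exists k, dot (H k) (N t (H k)) <= r.
  apply: contrapT => /forallNP noHk.
  have lin k : dot (H k) (H k) <= D - k%:R * r.
    elim: k => [|k IH]; first by rewrite mul0r subr0 Hle.
    have /negP := noHk k; rewrite -ltNge => rlt.
    by have := HSn k; rewrite -natr1; lra.
  pose k := (`|Num.ceil (D / r)|.+1)%N.
  have := le_trans (dot_ge0 (H k)) (lin k); apply/negP; rewrite -ltNge.
  rewrite subr_lt0 -ltr_pdivrMr// /k -natr1 natr_absz ltr_pwDr//.
  by rewrite (le_trans (ceil_ge _))// ler_int ler_norm.
exists (F k).
have -> : dot (N t (F k) - g) (N t (F k) - g) = dot (H k) (H k).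
  by rewrite -[N t (F k) - g]opprB -HE dotNl dotNr opprK.
have U j : dot (N s (H j) - H j) (N s (H j) - H j) <= (e / 2) ^+ 2 / (D + 1).
  apply: (@le_trans _ _ (dot (N s g - g) (N s g - g))); last exact: cvg.
  elim: j => [|j IH].
    have E0 h : dot (N s (H 0%N) - H 0%N) h = dot (N s g - g) h.
      by rewrite !dotBl H0 !sgr_sym// H0.
    by rewrite E0 dotC E0.
  apply: le_trans IH; set u := N s (H j) - H j.
  have ES h : dot (N s (H j.+1) - H j.+1) h = dot (u - N t u) h.
    rewrite !dotBl sgr_sym// !HS !dotBl !(sgr_sym _ _ t0).
    by rewrite !dotBl !(sgr_sym _ _ sp) (sgr_comm _ _ t0 sp); ring.
  rewrite ES dotC ES; apply: (le_trans (sgr_contract_compl _ t0)).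
  by have := sgr_form_ge0 u t0; lra.
have := small _ (Hle k) Hk.
set h := H k in Hk *; have hD : dot h h <= D := Hle k.
have /= := dot_cauchy_schwarz h (N s h - h).
rewrite dotBr; set a := dot h (N s h); set b := dot h h in hD *.
have b0 : 0 <= b := dot_ge0 h; move=> cs ae.
have {}cs := le_trans cs (ler_pM b0 (dot_ge0 _) hD (U k)).
rewrite leNgt; apply/negP => eb.
have ba : e / 2 < b - a by lra.
have : (e / 2) ^+ 2 < (a - b) ^+ 2.
  by rewrite -[a - b]opprB sqrrN ltr_pXn2r// nnegrE ?ltW// (lt_trans e20).
apply/negP; rewrite -leNgt; apply: (le_trans cs).
by rewrite mulrCA ger_pMr ?exprn_gt0// ler_pdivrMr// mul1r; lra.
Qed.

End symmetric_semigroup.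

(** * Operators given by the density of a coupling *)

Section mkL2.
Context d (T : measurableType d) (R : realType).
Variable mu : {measure set T -> \bar R}.
Implicit Types f : T -> R.

Lemma Lfun2P f : measurable_fun setT f ->
  (\int[mu]_x (f x ^+ 2)%:E < +oo)%E -> f \in Lfun mu 2.
Proof.
move=> mf fin; rewrite inE; apply/andP; split; rewrite inE//=.
rewrite /finite_norm unlock /Lnorm poweR_lty//.
rewrite (_ : integral _ _ _ = \int[mu]_x (f x ^+ 2)%:E)%E//.
apply: eq_integral => x _ /=; congr EFin.
by rewrite -[2]/(2%:R) powR_mulrn// real_normK ?num_real.
Qed.

(** Total, so that an operator can be written down before it is known to
  preserve square integrability. *)
Definition mkL2 f : L2 mu := insubd (0 : L2 mu) f.

Lemma mkL2E f : f \in Lfun mu 2 -> mkL2 f = f :> (T -> R).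
Proof. by move=> fL; rewrite /mkL2 /insubd insubT/=. Qed.

Lemma L2_measurable (f : L2 mu) : measurable_fun setT f.
Proof. by []. Qed.

Lemma EFin_dot (f g : L2 mu) : (dot f g)%:E = (\int[mu]_x (f x * g x)%:E)%E.
Proof.
by rewrite /dot /Rintegral fineK//; exact: integrable_fin_num (L2_integrable_mul f g).
Qed.

Lemma mkL2_dot f (g : L2 mu) : measurable_fun setT f ->
  (\int[mu]_x (f x ^+ 2)%:E <= (dot g g)%:E)%E -> f \in Lfun mu 2.
Proof. by move=> mf fg; rewrite Lfun2P// (le_lt_trans fg)// ltry. Qed.

End mkL2.

Section bistochastic.
Context d1 d2 (X : measurableType d1) (Y : measurableType d2) (R : realType).
Variables (mu : probability X R) (nu : probability Y R).

(** Joint densities, with respect to a product of probability measures, of the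
  couplings of the two factors. *)
Definition bistochastic (m : X -> Y -> R) :=
  [/\ measurable_fun setT (fun p : X * Y => m p.1 p.2),
      forall x y, 0 <= m x y,
      forall x, (\int[nu]_y (m x y)%:E = 1)%E &
      forall y, (\int[mu]_x (m x y)%:E = 1)%E].

Definition kop (m : X -> Y -> R) (f : L2 nu) : L2 mu :=
  mkL2 mu (fun x => \int[nu]_y (f y * m x y)).

End bistochastic.

Lemma bistochastic_swap d1 d2 (X : measurableType d1) (Y : measurableType d2)
    (R : realType) (mu : probability X R) (nu : probability Y R)
    (m : X -> Y -> R) : bistochastic mu nu m ->
  bistochastic nu mu (fun y x => m x y).
Proof.
move=> [mm m0 m1 m2]; split => //.
exact: (measurableT_comp mm (measurable_swap (T1 := Y) (T2 := X))).
Qed.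

Section kernel_operator.
Context d1 d2 (X : measurableType d1) (Y : measurableType d2) (R : realType).
Variables (mu : probability X R) (nu : probability Y R).
Variables (m : X -> Y -> R) (bm : bistochastic mu nu m).
Implicit Types (f : L2 nu) (g : L2 mu).

Let mm : measurable_fun setT (fun p : X * Y => m p.1 p.2).
Proof. by case: bm. Qed.

Let m0 x y : 0 <= m x y.
Proof. by case: bm. Qed.

Let mm1 x : measurable_fun setT (m x).
Proof. exact: (measurableT_comp mm (measurable_pair1 x)). Qed.

Let mm2 y : measurable_fun setT (m^~ y).
Proof. exact: (measurableT_comp mm (measurable_pair2 y)). Qed.

Lemma kernel_integral2 (h : Y -> R) : measurable_fun setT h ->
  (forall y, 0 <= h y) ->
  (\int[mu]_x \int[nu]_y (h y * m x y)%:E = \int[nu]_y (h y)%:E)%E.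
Proof.
move=> mh h0.
rewrite (fubini_tonelli (fun p : X * Y => (h p.2 * m p.1 p.2)%:E))/=.
- apply: eq_integral => y _.
  under eq_integral do rewrite EFinM.
  rewrite ge0_integralZl//.
  + by case: bm => _ _ _ ->; rewrite mule1.
  + exact/measurable_EFinP.
  + by move=> x _; rewrite lee_fin.
  + by rewrite lee_fin.
- apply/measurable_EFinP/measurable_funM => //.
  exact: (measurableT_comp mh).
- by move=> p; rewrite lee_fin mulr_ge0.
Qed.

Lemma kernel_integrable2 (h : Y -> R) : nu.-integrable setT (EFin \o h) ->
  (mu \x nu)%E.-integrable setT (fun p : X * Y => (h p.2 * m p.1 p.2)%:E).
Proof.
move=> /integrableP[/measurable_EFinP mh hoo]; apply/integrable12ltyP.
  by apply/measurable_EFinP/measurable_funM => //; exact: (measurableT_comp mh).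
have mnh : measurable_fun setT (fun y => `|h y|) by exact: measurableT_comp.
move: hoo; rewrite -(kernel_integral2 mnh (fun y => normr_ge0 (h y)))/=.
by under [in X in _ -> X]eq_integral do
  under eq_integral do rewrite normrM (ger0_norm (m0 _ _)).
Qed.

Lemma kernel_integrable1 (h : X -> R) : mu.-integrable setT (EFin \o h) ->
  (mu \x nu)%E.-integrable setT (fun p : X * Y => (h p.1 * m p.1 p.2)%:E).
Proof.
move=> /integrableP[/measurable_EFinP mh hoo]; apply/integrable12ltyP.
  by apply/measurable_EFinP/measurable_funM => //; exact: (measurableT_comp mh).
rewrite (_ : integral _ _ _ = \int[mu]_x `|(EFin \o h) x|)%E//.
apply: eq_integral => x _ /=.
under eq_integral do rewrite normrM (ger0_norm (m0 _ _)) EFinM.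
rewrite ge0_integralZl//.
  by case: bm => _ _ -> _; rewrite mule1.
  by apply/measurable_EFinP; exact: mm1.
by move=> y _; rewrite lee_fin.
Qed.

Lemma L2_integrable f : nu.-integrable setT (EFin \o f).
Proof.
apply/Lfun1_integrable/Lfun_subset12; last exact: LfunP.
exact: fin_num_measure.
Qed.

Lemma L2_integrable_sqr f : nu.-integrable setT (EFin \o (fun y => f y ^+ 2)).
Proof. by apply: Lfun2_integrable_sqr; exact: LfunP. Qed.

Lemma kernel_ae_integrable f :
  {ae mu, forall x, nu.-integrable setT (fun y => (f y * m x y)%:E)}.
Proof. exact: ae_integrable1 (kernel_integrable2 (L2_integrable f)). Qed.

Lemma measurable_kop_fun f :
  measurable_fun setT (fun x => \int[nu]_y (f y * m x y)).
Proof.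
apply: (measurableT_comp (@fine_measurable _ setT measurableT)).
exact: measurable_fubini_F (kernel_integrable2 (L2_integrable f)).
Qed.

(** Jensen's inequality for the probability density [m x]: the variance of [f]
  under it is nonnegative. *)
Lemma jensen_kop f : {ae mu, forall x,
  ((\int[nu]_y (f y * m x y)) ^+ 2)%:E <= \int[nu]_y (f y ^+ 2 * m x y)%:E}%E.
Proof.
have := ae_integrable1 (kernel_integrable2 (L2_integrable_sqr f)).
apply: filterS2 (kernel_ae_integrable f) => x /= i1 i2.
have i0 : nu.-integrable setT (fun y => (m x y)%:E).
  apply/integrableP; split; first exact/measurable_EFinP.
  under eq_integral do rewrite /= (ger0_norm (m0 _ _)).
  by case: bm => _ _ -> _; rewrite ltry.
rewrite -[leRHS]fineK ?integrable_fin_num// lee_fin -[fine _]/(Rintegral _ _ _).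
set c := Rintegral _ _ _.
have : 0 <= \int[nu]_y ((f y - c) ^+ 2 * m x y).
  by apply: Rintegral_ge0 => y _; rewrite mulr_ge0// sqr_ge0.
have i1c : nu.-integrable setT (EFin \o (fun y => (- 2 * c) * (f y * m x y))).
  exact: (integrableZl _ _ i1).
have i0c : nu.-integrable setT (EFin \o (fun y => c ^+ 2 * m x y)).
  exact: (integrableZl _ _ i0).
rewrite (_ : (fun y => _) = (fun y => f y ^+ 2 * m x y +
  ((- 2 * c) * (f y * m x y) + c ^+ 2 * m x y))); last first.
  by apply/funext => y; ring.
rewrite RintegralD//; last exact: (integrableD measurableT i1c i0c).
rewrite RintegralD// !RintegralZl// -/c.
have -> : \int[nu]_y m x y = 1 by rewrite /Rintegral; case: bm => _ _ -> _.
by move=> H; rewrite -subr_ge0; apply: (le_trans H); lra.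
Qed.

Lemma kop_fun_le f : (\int[mu]_x ((\int[nu]_y (f y * m x y)) ^+ 2)%:E <=
  (dot f f)%:E)%E.
Proof.
rewrite EFin_dot -kernel_integral2//=; last 2 first.
- exact: measurable_funM.
- by move=> y; rewrite -expr2 sqr_ge0.
have sqr0 (r : R) : 0 <= r * r by rewrite -expr2 sqr_ge0.
apply: ae_ge0_le_integral => //.
- by move=> x _; rewrite lee_fin sqr_ge0.
- by apply/measurable_EFinP; apply: measurable_funX; exact: measurable_kop_fun.
- by move=> x _; apply: integral_ge0 => y _; rewrite lee_fin mulr_ge0.
- apply: (measurable_fun_fubini_tonelli_F
    (fun p : X * Y => (f p.2 * f p.2 * m p.1 p.2)%:E)).
    apply/measurable_EFinP; apply: measurable_funM => //.
    by apply: measurable_funM; exact: (measurableT_comp (L2_measurable f)).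
  by move=> p; rewrite lee_fin mulr_ge0.
- by apply: filterS (jensen_kop f) => x /= + _.
Qed.

Lemma kopE f : kop mu m f = (fun x => \int[nu]_y (f y * m x y)) :> (X -> R).
Proof.
by apply: mkL2E; apply: Lfun2P;
  [exact: measurable_kop_fun|exact: le_lt_trans (kop_fun_le f) (ltry _)].
Qed.

Lemma kop_contract f : dot (kop mu m f) (kop mu m f) <= dot f f.
Proof. by rewrite -lee_fin (EFin_dot (kop mu m f)) kopE kop_fun_le. Qed.

Lemma kernel_integrable_dot f g : (mu \x nu)%E.-integrable setT
  (fun p : X * Y => (f p.2 * g p.1 * m p.1 p.2)%:E).
Proof.
have ig : mu.-integrable setT (EFin \o (fun x => g x ^+ 2)).
  by apply: Lfun2_integrable_sqr; exact: LfunP.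
apply: le_integrable (integrableD measurableT
  (kernel_integrable2 (L2_integrable_sqr f)) (kernel_integrable1 ig)) => //.
- apply/measurable_EFinP; apply: measurable_funM => //.
  by apply: measurable_funM; [exact: (measurableT_comp (L2_measurable f))|
    exact: (measurableT_comp (L2_measurable g))].
- move=> [x y] _ /=; rewrite lee_fin -mulrDl !normrM (ger0_norm (m0 x y)).
  rewrite ler_wpM2r// [leRHS]ger0_norm ?addr_ge0 ?sqr_ge0//.
  rewrite -[f y ^+ 2]real_normK ?num_real//.
  rewrite -[g x ^+ 2]real_normK ?num_real//; set a := `|f y|; set b := `|g x|.
  have : 0 <= (a - b) ^+ 2 by exact: sqr_ge0.
  have : 0 <= a * b by rewrite mulr_ge0 ?normr_ge0.
  by nra.
Qed.

Lemma dot_kopl f g : dot (kop mu m f) g =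
  fine (\int[mu \x nu]_p (f p.2 * g p.1 * m p.1 p.2)%:E)%E.
Proof.
rewrite -integral12_prod_meas1//; last exact: kernel_integrable_dot.
congr fine; apply: ae_eq_integral => //.
- exact: measurable_int (L2_integrable_mul _ _).
- exact: measurable_fubini_F (kernel_integrable_dot f g).
- apply: filterS (kernel_ae_integrable f) => x fi _ /=; rewrite kopE /fubini_F/=.
  under eq_integral do rewrite mulrAC EFinM.
  rewrite integralZr// EFinM; congr (_ * _)%E.
  by rewrite /Rintegral fineK// integrable_fin_num.
Qed.

End kernel_operator.

Section kernel_adjoint.
Context d1 d2 (X : measurableType d1) (Y : measurableType d2) (R : realType).
Variables (mu : probability X R) (nu : probability Y R).

Lemma kop_adjoint (m : X -> Y -> R) (f : L2 nu) (g : L2 mu) :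
  bistochastic mu nu m ->
  dot (kop mu m f) g = dot f (kop nu (fun y x => m x y) g).
Proof.
move=> bm; have bm' := bistochastic_swap bm.
rewrite [RHS]dotC (dot_kopl bm f g) (dot_kopl bm' g f).
rewrite -(integral21_prod_meas1 (kernel_integrable_dot bm f g)).
rewrite -(integral12_prod_meas1 (kernel_integrable_dot bm' g f)).
congr fine; apply: eq_integral => y _; apply: eq_integral => x _ /=.
by rewrite (mulrC (f y)).
Qed.

End kernel_adjoint.

Section kernel_composition.
Context d1 d2 d3 (X : measurableType d1) (Y : measurableType d2)
  (Z : measurableType d3) (R : realType).
Variables (mu : probability X R) (nu : probability Y R) (rho : probability Z R).
Variables (m1 : X -> Y -> R) (m2 : Y -> Z -> R) (m12 : X -> Z -> R).
Hypothesis b1 : bistochastic mu nu m1.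
Hypothesis b2 : bistochastic nu rho m2.
Hypothesis b12 : bistochastic mu rho m12.
Hypothesis comp : forall x z,
  (\int[nu]_y (m1 x y * m2 y z)%:E = (m12 x z)%:E)%E.

(** Fubini; the second kernel makes the iterated integral absolutely
  convergent, for almost every starting point. *)
Lemma kop_comp (f : L2 rho) :
  kop mu m1 (kop nu m2 f) = kop mu m12 f %[ae mu].
Proof.
have [mm1 m10 _ _] := b1; have [mm2 m20 _ _] := b2; have [mm12 m120 _ _] := b12.
apply: filterS (kernel_ae_integrable b12 f) => x fi _.
rewrite (kopE b1) (kopE b12); congr fine.
pose F (p : Y * Z) : \bar R := (f p.2 * m2 p.1 p.2 * m1 x p.1)%:E.
have mm1x : measurable_fun setT (m1 x).
  exact: (measurableT_comp mm1 (measurable_pair1 x)).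
have mm2z z : measurable_fun setT (m2^~ z).
  exact: (measurableT_comp mm2 (measurable_pair2 z)).
have mF : measurable_fun setT F.
  apply/measurable_EFinP; apply: measurable_funM; last exact: (measurableT_comp mm1x).
  by apply: measurable_funM => //; exact: (measurableT_comp (L2_measurable f)).
have iyF (c : R) z :
    (\int[nu]_y (c * m2 y z * m1 x y)%:E = (c * m12 x z)%:E)%E.
  rewrite EFinM -comp -integralZl//.
    by apply: eq_integral => y _; rewrite -EFinM; congr EFin; ring.
  apply/integrableP; split.
    by apply/measurable_EFinP; apply: measurable_funM.
  rewrite (_ : integral _ _ _ = (m12 x z)%:E) ?ltry//.
  rewrite -comp; apply: eq_integral => y _ /=.
  by rewrite ger0_norm// mulr_ge0.
have iF : (nu \x rho)%E.-integrable setT F.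
  apply/integrable21ltyP => //.
  have /integrableP[_] := fi; apply: le_lt_trans.
  rewrite le_eqVlt; apply/orP; left; apply/eqP; apply: eq_integral => z _ /=.
  under eq_integral do
    rewrite !normrM (ger0_norm (m20 _ _)) (ger0_norm (m10 _ _)).
  by rewrite iyF normrM (ger0_norm (m120 _ _)).
transitivity (\int[nu]_y \int[rho]_z F (y, z))%E.
  apply: ae_eq_integral => //.
  - by apply/measurable_EFinP; apply: measurable_funM.
  - exact: measurable_fubini_F iF.
  - apply: filterS (kernel_ae_integrable b2 f) => y i2 _ /=.
    rewrite /F/=; under [RHS]eq_integral do rewrite EFinM.
    rewrite integralZr// (kopE b2) EFinM; congr (_ * _)%E.
    by rewrite /Rintegral fineK// integrable_fin_num.
by rewrite Fubini//; apply: eq_integral => z _; exact: (iyF (f z) z).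
Qed.

End kernel_composition.

(** * Reflections of Lebesgue measure *)

Section lebesgue_integral_cV.
Context (R : realType).
Local Open Scope ereal_scope.

Lemma ge0_integral_lebesgue_cVS n (f : 'cV[R]_n.+1 -> \bar R) :
  measurable_fun setT f -> (forall v, 0 <= f v) ->
  \int[lebesgue_cV n.+1]_v f v =
  \int[lebesgue_cV n]_v \int[lebesgue_measure]_x f (cons_cV (x, v)).
Proof.
move=> mf f0.
transitivity (\int[lebesgue_measure \x lebesgue_cV n]_p (f \o @cons_cV R n) p).
  exact: (ge0_integral_pushforward (@measurable_cons_cV R n)).
rewrite fubini_tonelli2//.
  exact: (measurableT_comp mf (@measurable_cons_cV R n)).
by move=> p; exact: f0.
Qed.

Lemma lebesgue_measure_reflect (a : R) (A : set R) : measurable A ->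
  pushforward lebesgue_measure
    (fun x : measurableTypeR R => (a - x)%R : measurableTypeR R) A
  = lebesgue_measure A.
Proof.
move=> mA; apply/esym.
have mr : measurable_fun setT
    (fun x : measurableTypeR R => (a - x)%R : measurableTypeR R).
  exact: measurable_funB.
pose mu := pushforward lebesgue_measure
  (fun x : measurableTypeR R => (a - x)%R : measurableTypeR R).
pose mu' := measure_function_pushforward__canonical__measure_function_Measure
     lebesgue_measure mr.
apply: (@lebesgue_measure_unique _ mu') => //= _ [[u v]] _ <-.
rewrite /pushforward.
rewrite (_ : _ @^-1` _ = `[(a - v)%R, (a - u)%R[%classic).
  rewrite !lebesgue_measure_itv/= !lte_fin.
  rewrite ltrD2l ltrN2; case: ifP => // _.
  by rewrite -!EFinD; congr EFin; ring.
by apply/seteqP; split=> x /=; rewrite !in_itv/= => /andP[? ?]; apply/andP; split; lra.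
Qed.

Lemma measurable_cV_sub n (a : 'cV[R]_n) :
  measurable_fun setT (fun v : 'cV[R]_n => a - v)%R.
Proof.
apply: measurable_fun_mx => i j.
rewrite (_ : (fun _ => _) = (fun v : 'cV[R]_n => a i j - v i j)%R); last first.
  by apply/funext => v; rewrite !mxE.
by apply: measurable_funB => //; exact: measurable_mx_entry.
Qed.

Lemma measurable_cV_mul n p (M : 'M[R]_(p, n)) :
  measurable_fun setT (fun v : 'cV[R]_n => M *m v).
Proof.
apply: measurable_fun_mx => i j.
rewrite (_ : (fun _ => _) = (fun v : 'cV[R]_n => \sum_k M i k * v k j)%R).
  by apply: measurable_sum => k; apply: measurable_funM => //;
    exact: measurable_mx_entry.
by apply/funext => v; rewrite !mxE.
Qed.

Lemma measurable_fun_cV_sub n d (T : measurableType d) (f g : T -> 'cV[R]_n) :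
  measurable_fun setT f -> measurable_fun setT g ->
  measurable_fun setT (fun x => f x - g x)%R.
Proof.
move=> mf mg; apply: measurable_fun_mx => i j.
rewrite (_ : (fun _ => _) = (fun x => f x i j - g x i j)%R); last first.
  by apply/funext => x; rewrite !mxE.
by apply: measurable_funB;
  apply: (measurableT_comp (@measurable_mx_entry R n 1 i j)).
Qed.

(** One coordinate at a time.  Reflections stand for translations below, the
  Gaussian densities being even. *)
Lemma ge0_integral_reflect n (a : 'cV[R]_n) (f : 'cV[R]_n -> \bar R) :
  measurable_fun setT f -> (forall v, 0 <= f v) ->
  \int[lebesgue_cV n]_v f (a - v)%R = \int[lebesgue_cV n]_v f v.
Proof.
elim: n a f => [|n IH] a f mf f0.
  by apply: eq_integral => v _; congr f; apply/colP => -[].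
have mfa : measurable_fun setT (fun v : 'cV[R]_n.+1 => f (a - v)%R).
  exact: (measurableT_comp mf (measurable_cV_sub a)).
rewrite (ge0_integral_lebesgue_cVS mfa (fun v => f0 _)).
rewrite (ge0_integral_lebesgue_cVS mf f0).
pose a0 : R := a ord0 0%R; pose a' : 'cV[R]_n := (uncons_cV a).2.
have mfc : measurable_fun setT (f \o @cons_cV R n).
  exact: (measurableT_comp mf (@measurable_cons_cV R n)).
pose F v := \int[lebesgue_measure]_x f (@cons_cV R n (x, v)).
have mF : measurable_fun setT F.
  apply: (measurable_fun_fubini_tonelli_G (f \o @cons_cV R n)) => // p.
  exact: f0.
have F0 v : 0 <= F v by apply: integral_ge0.
apply: etrans (IH a' F mF F0).
apply: eq_integral => v _; rewrite /F.
have mfv : measurable_fun setT (fun x => f (@cons_cV R n (x, (a' - v)%R))).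
  exact: (measurableT_comp mfc (measurable_pair2 _)).
transitivity (\int[lebesgue_measure]_x f (cons_cV ((a0 - x)%R, (a' - v)%R))).
  apply: eq_integral => x _; congr f; apply/colP => i.
  by rewrite !mxE; case: unliftP => [j ->|->] /=; rewrite ?mxE.
have mr : measurable_fun setT
    (fun x : measurableTypeR R => (a0 - x)%R : measurableTypeR R).
  exact: measurable_funB.
rewrite -(@ge0_integral_pushforward _ _ _ _ _ _ mr lebesgue_measure setT
  (fun x => f (@cons_cV R n (x, (a' - v)%R))))//.
by apply: eq_measure_integral => //= A mA _; exact: lebesgue_measure_reflect.
Qed.

Lemma integral_reflect n (a : 'cV[R]_n) (f : 'cV[R]_n -> \bar R) :
  measurable_fun setT f ->
  \int[lebesgue_cV n]_v f (a - v)%R = \int[lebesgue_cV n]_v f v.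
Proof.
move=> mf; rewrite [RHS]integralE [LHS]integralE.
rewrite -(ge0_integral_reflect a (measurable_funepos mf))//.
rewrite -(ge0_integral_reflect a (measurable_funeneg mf))//.
congr (_ - _); apply: eq_integral => v _.
- by rewrite !funeposE.
- by rewrite !funenegE.
Qed.

End lebesgue_integral_cV.

(** * Positive definite forms and Schur complements *)

Section quadratic_forms.
Context (R : realType).

Lemma qformD n (A A' : 'M[R]_n) x : qform (A + A') x = qform A x + qform A' x.
Proof. by rewrite /qform mulmxDr mulmxDl mxE. Qed.

Lemma qformN n (A : 'M[R]_n) x : qform (- A) x = - qform A x.
Proof. by rewrite /qform mulmxN mulNmx mxE. Qed.

Lemma qformB n (A A' : 'M[R]_n) x : qform (A - A') x = qform A x - qform A' x.
Proof. by rewrite qformD qformN. Qed.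

Lemma qformZ n (a : R) (A : 'M[R]_n) x : qform (a *: A) x = a * qform A x.
Proof. by rewrite /qform -scalemxAr -scalemxAl mxE. Qed.

Lemma qform_congr n (A M : 'M[R]_n) x :
  qform (M^T *m A *m M) x = qform A (M *m x).
Proof. by rewrite /qform trmx_mul !mulmxA. Qed.

Lemma qform1 n (x : 'cV[R]_n) : qform 1%:M x = \sum_i x i 0 ^+ 2.
Proof.
by rewrite /qform mulmx1 mxE; apply: eq_bigr => i _; rewrite mxE expr2.
Qed.

Lemma qform_pairE n (A : 'M[R]_n) (x : 'cV[R]_n) :
  qform A x = \sum_p x p.1 0 * x p.2 0 * A p.1 p.2.
Proof.
rewrite /qform mxE -(pair_bigA _ (fun a b => x a 0 * x b 0 * A a b))/=.
rewrite exchange_big/=; apply: eq_bigr => b _; rewrite mxE mulr_suml.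
by apply: eq_bigr => a _; rewrite mxE; ring.
Qed.

Lemma qform0 n (A : 'M[R]_n) : qform A 0 = 0.
Proof. by rewrite /qform mulmx0 mxE. Qed.

Lemma qformZv n (a : R) (A : 'M[R]_n) x : qform A (a *: x) = a ^+ 2 * qform A x.
Proof.
rewrite /qform [(a *: x)^T]linearZ/= -scalemxAr -!scalemxAl.
by rewrite mxE [X in _ * X]mxE mulrA expr2.
Qed.

Lemma qformNv n (A : 'M[R]_n) x : qform A (- x) = qform A x.
Proof. by rewrite -scaleN1r qformZv sqrrN expr1n mul1r. Qed.

Lemma bilinear_sym n (A : 'M[R]_n) (x y : 'cV[R]_n) : A^T = A ->
  (x^T *m A *m y) 0 0 = (y^T *m A *m x) 0 0.
Proof.
move=> sA; transitivity ((y^T *m A *m x)^T 0 0); last by rewrite mxE.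
by rewrite !trmx_mul trmxK sA mulmxA.
Qed.

Lemma qformDv n (A : 'M[R]_n) x y : A^T = A ->
  qform A (x + y) = qform A x + 2 * (x^T *m A *m y) 0 0 + qform A y.
Proof.
move=> sA; rewrite /qform [(x + y)^T]linearD/= mulmxDr !mulmxDl.
rewrite mxE [X in X + _]mxE [X in _ + X]mxE.
by rewrite (bilinear_sym y x sA); ring.
Qed.

Definition posdef n (S : 'M[R]_n) := S^T = S /\ forall x, x != 0 -> 0 < qform S x.

Lemma posdef_ge0 n (S : 'M[R]_n) x : posdef S -> 0 <= qform S x.
Proof.
by move=> [_ pS]; have [->|/pS/ltW//] := eqVneq x 0; rewrite qform0.
Qed.

Lemma posdef_psd n (S : 'M[R]_n) : posdef S -> positive_semidefinite S.
Proof. by move=> pS; split=> [|x]; [case: pS|exact: posdef_ge0]. Qed.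

Lemma unitmx_cker n (A : 'M[R]_n) :
  (forall x : 'cV[R]_n, A *m x = 0 -> x = 0) -> A \in unitmx.
Proof.
move=> inj; rewrite -unitmx_tr -row_free_unit -kermx_eq0.
apply/eqP/row_matrixP => i; rewrite row0.
apply: trmx_inj; rewrite trmx0; apply: inj.
by apply: trmx_inj; rewrite trmx_mul trmxK trmx0 -row_mul mulmx_ker row0.
Qed.

Lemma unitmx_mulr_neq0 n (M : 'M[R]_n) (x : 'cV[R]_n) :
  M \in unitmx -> x != 0 -> M *m x != 0.
Proof.
move=> Mu; apply: contra_neq => Mx0.
by rewrite -[x](mulKmx Mu) Mx0 mulmx0.
Qed.

Lemma posdef_unit n (S : 'M[R]_n) : posdef S -> S \in unitmx.
Proof.
move=> [_ pS]; apply: unitmx_cker => x Sx0; apply/eqP/negPn/negP => /pS.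
by rewrite /qform -mulmxA Sx0 mulmx0 mxE ltxx.
Qed.

Lemma posdef_congr n (S M : 'M[R]_n) : posdef S -> M \in unitmx ->
  posdef (M^T *m S *m M).
Proof.
move=> [sS pS] Mu; split; first by rewrite !trmx_mul trmxK sS mulmxA.
by move=> x x0; rewrite qform_congr pS// unitmx_mulr_neq0.
Qed.

Lemma posdef_congr_tr n (S M : 'M[R]_n) : posdef S -> M \in unitmx ->
  posdef (M *m S *m M^T).
Proof.
by move=> pS Mu; rewrite -{1}(trmxK M); apply: posdef_congr; rewrite ?unitmx_tr.
Qed.

Lemma posdef_inv n (S : 'M[R]_n) : posdef S -> posdef (invmx S).
Proof.
move=> pS; have Su := posdef_unit pS.
have := posdef_congr pS (_ : invmx S \in unitmx).
rewrite unitmx_inv => /(_ Su).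
by rewrite trmx_inv pS.1 mulVmx// mul1mx.
Qed.

Lemma posdefD n (S S' : 'M[R]_n) : posdef S -> positive_semidefinite S' ->
  posdef (S + S').
Proof.
move=> [sS pS] [sS' pS']; split; first by rewrite linearD/= sS sS'.
by move=> x x0; rewrite qformD ltr_pwDl// pS.
Qed.

Lemma posdefZ n (a : R) (S : 'M[R]_n) : 0 < a -> posdef S -> posdef (a *: S).
Proof.
move=> a0 [sS pS]; split; first by rewrite linearZ/= sS.
by move=> x x0; rewrite qformZ mulr_gt0// pS.
Qed.

Lemma posdef1 n : posdef (1%:M : 'M[R]_n).
Proof.
split=> [|x x0]; first exact: trmx1.
rewrite qform1 lt_neqAle sumr_ge0 ?andbT; last by move=> i _; rewrite sqr_ge0.
apply: contra x0 => /eqP/esym/psumr_eq0P x0.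
apply/eqP/colP => i; rewrite mxE; apply/eqP; rewrite -sqrf_eq0.
by apply/eqP/x0 => // j _; rewrite sqr_ge0.
Qed.

Lemma psd_congr n (S M : 'M[R]_n) : positive_semidefinite S ->
  positive_semidefinite (M^T *m S *m M).
Proof.
move=> [sS pS]; split; first by rewrite !trmx_mul trmxK sS mulmxA.
by move=> x; rewrite qform_congr.
Qed.

Lemma cauchy_schwarz_qform n (S : 'M[R]_n) (x y : 'cV[R]_n) : posdef S ->
  ((x^T *m S *m y) 0 0) ^+ 2 <= qform S x * qform S y.
Proof.
move=> pS; have [->|y0] := eqVneq y 0.
  by rewrite mulmx0 mxE expr0n/= qform0 mulr0.
have c0 := pS.2 _ y0; set b := (_ *m _) 0 0; set c := qform S y in c0 *.
have := posdef_ge0 (x + (- (b / c)) *: y) pS.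
rewrite qformDv ?pS.1// qformZv -scalemxAr mxE -/b -/c.
set a := qform S x.
rewrite (_ : _ + _ = (a * c - b ^+ 2) / c); last by field; rewrite gt_eqF.
by rewrite pmulr_lge0 ?invr_gt0// subr_ge0.
Qed.

End quadratic_forms.

Section schur_complement.
Context (R : realType) (n : nat).
Variable K : 'M[R]_(1 + n).
Hypothesis pK : posdef K.

Definition corner : R := K 0 0.
Definition corner_col : 'cV[R]_n := dlsubmx K.
Definition schur : 'M[R]_n :=
  drsubmx K - corner^-1 *: (corner_col *m corner_col^T).

Let s := corner.
Let b := corner_col.

Lemma corner_blockE : K = block_mx s%:M b^T b (drsubmx K).
Proof.
rewrite -[LHS]submxK; congr block_mx.
  apply/matrixP => i j; rewrite !ord1 !mxE eqxx mulr1n /s /corner.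
  by congr (K _ _); apply: val_inj.
by rewrite -[in LHS](pK.1) /b /corner_col -trmx_dlsub.
Qed.

Lemma qform_block x (v : 'cV[R]_n) :
  qform K (col_mx x%:M v) =
  s * x ^+ 2 + 2 * x * (b^T *m v) 0 0 + qform (drsubmx K) v.
Proof.
rewrite {1}corner_blockE /qform tr_col_mx mul_row_block mul_row_col.
rewrite tr_scalar_mx !mulmxDl -scalar_mxM.
have -> : v^T *m b *m x%:M = x *: (b^T *m v).
  rewrite mul_mx_scalar; congr (_ *: _).
  by rewrite [LHS]mx11_scalar -[LHS]tr_scalar_mx -mx11_scalar trmx_mul trmxK.
by rewrite !mul_scalar_mx -scalemxAl !mxE eqxx !mulr1n; ring.
Qed.

Lemma qform_schurE (v : 'cV[R]_n) :
  qform schur v = qform (drsubmx K) v - s^-1 * ((b^T *m v) 0 0) ^+ 2.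
Proof.
rewrite qformB qformZ; congr (_ - _ * _).
rewrite /qform !mulmxA -(mulmxA _ b^T) mxE big_ord1 expr2; congr (_ * _).
transitivity ((b^T *m v)^T 0 0); last by rewrite mxE.
by rewrite trmx_mul trmxK.
Qed.

Lemma corner_gt0 : 0 < s.
Proof.
have := pK.2 (col_mx 1%:M 0); rewrite qform_block mulmx0 mxE mulr0 qform0.
rewrite expr1n mulr1 !addr0; apply; apply/eqP => /colP/(_ (lshift n 0)).
by rewrite col_mxEu !mxE => /eqP; rewrite oner_eq0.
Qed.

(** Completing the square in the first coordinate leaves the Schur complement
  as the form of the others: this makes induction on the dimension possible for
  determinants and for Gaussian integrals. *)
Lemma qform_complete_square x (v : 'cV[R]_n) :
  qform K (col_mx x%:M v) =
  s * (x - - ((b^T *m v) 0 0 / s)) ^+ 2 + qform schur v.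
Proof.
rewrite qform_block qform_schurE; have := corner_gt0.
by move: ((_ *m _) 0 0) (qform _ _) => be q s0; field; rewrite gt_eqF.
Qed.

Lemma posdef_schur : posdef schur.
Proof.
split.
  rewrite linearB linearZ/= trmx_mul trmxK; congr (_ - _).
  by rewrite trmx_drsub pK.1.
move=> v v0.
have := pK.2 (col_mx (- ((b^T *m v) 0 0 / s))%:M v).
rewrite qform_complete_square subrr expr0n mulr0 add0r; apply.
by apply: contra_neq v0 => /(congr1 dsubmx); rewrite col_mxKd linear0.
Qed.

Lemma det_schur : \det K = s * \det schur.
Proof.
have s0 : s != 0 by rewrite gt_eqF// corner_gt0.
rewrite {1}corner_blockE (_ : block_mx _ _ _ _ =
  block_mx 1%:M 0 (s^-1 *: b) 1%:M *m block_mx s%:M b^T 0 schur); last first.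
  rewrite mulmx_block !mul1mx !mul0mx !addr0.
  rewrite mul_mx_scalar scalerA mulfV// scale1r -scalemxAl.
  by rewrite /schur addrC subrK.
by rewrite det_mulmx det_lblock det_ublock !det1 !mul1r det_scalar1.
Qed.

End schur_complement.

Lemma det_posdef (R : realType) n (S : 'M[R]_n) : posdef S -> 0 < \det S.
Proof.
elim: n S => [|n IH] S pS; first by rewrite det_mx00.
by rewrite (det_schur pS) mulr_gt0 ?corner_gt0// IH//; exact: posdef_schur.
Qed.

(** * Gaussian integrals and convolution *)

Section gauss_integral.
Context (R : realType).
Local Notation pi := (@pi R).

Lemma ge0_integralZl_fin d (T : measurableType d) (mu : {measure set T -> \bar R})
    (k : R) (f : T -> R) :
  0 <= k -> measurable_fun setT f -> (forall x, 0 <= f x) ->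
  (\int[mu]_x (k%:E * (f x)%:E) = k%:E * \int[mu]_x (f x)%:E)%E.
Proof.
move=> k0 mf f0; rewrite ge0_integralZl//; last by move=> x _; rewrite lee_fin.
exact/measurable_EFinP.
Qed.

Lemma integral_gauss1 (s m : R) : 0 < s ->
  (\int[lebesgue_measure]_x (expR (- (s * (x - m) ^+ 2 / 2)))%:E =
   (Num.sqrt (2 * pi / s))%:E)%E.
Proof.
move=> s0; pose sg : R := (Num.sqrt s)^-1.
have sg0 : sg != 0 by rewrite invr_eq0 gt_eqF// sqrtr_gt0.
have sg2 : sg ^+ 2 = s^-1 by rewrite exprVn sqr_sqrtr// ltW.
have := integral_normal_pdf m sg.
rewrite normal_pdfE//; under eq_integral do rewrite EFinM.
have mfun1 := @measurable_normal_fun R m sg.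
rewrite ge0_integralZl_fin ?normal_peak_ge0//; last by move=> x; exact: normal_fun_ge0.
rewrite /normal_peak sg2 => H.
have pk0 : 0 < s^-1 * pi *+ 2 by rewrite pmulrn_lgt0// mulr_gt0 ?invr_gt0 ?pi_gt0.
have {}H : (\int[lebesgue_measure]_x (normal_fun m sg x)%:E =
    (Num.sqrt (s^-1 * pi *+ 2))%:E)%E.
  have pk1 : Num.sqrt (s^-1 * pi *+ 2) != 0 by rewrite gt_eqF// sqrtr_gt0.
  rewrite -[LHS]mul1e -(divff pk1).
  by rewrite EFinM -muleA [X in (_ * X)%E]H mule1.
rewrite (_ : 2 * pi / s = s^-1 * pi *+ 2); last first.
  by rewrite -mulr_natl; ring.
rewrite -H; apply: eq_integral => x _; congr (expR _)%:E.
by rewrite sg2; field; rewrite gt_eqF.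
Qed.

Lemma cons_cV_col n (x : R) (v : 'cV[R]_n) :
  cons_cV (x, v) = @col_mx R 1 n 1 x%:M v.
Proof.
apply/colP => i; rewrite mxE; case: unliftP => [j ->|->] /=.
  rewrite (_ : lift ord0 j = rshift 1 j); last exact: val_inj.
  exact: (esym (@col_mxEd R 1 n 1 x%:M v j 0)).
transitivity ((x%:M : 'M[R]_1) 0 0); first by rewrite mxE eqxx.
rewrite -(@col_mxEu R 1 n 1 x%:M v 0 0).
by congr (fun_of_matrix _ _ _); exact: val_inj.
Qed.

Lemma measurable_expR_qform n (K : 'M[R]_n) :
  measurable_fun setT (fun v => expR (- (qform K v / 2))).
Proof.
apply: measurableT_comp => //; apply: measurableT_comp => //.
by apply: measurable_funM => //; exact: measurable_qform.
Qed.

Lemma sqrtr_powR (a : R) n : 0 < a ->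
  a `^ (n.+1%:R / 2) = a `^ (n%:R / 2) * Num.sqrt a.
Proof.
move=> a0; rewrite -natr1 mulrDl powRD; last first.
  by rewrite (gt_eqF a0) implybT.
by rewrite mul1r powR12_sqrt// ltW.
Qed.

(** The variables are integrated one at a time: completing the square in the
  first one leaves the Schur complement as the form of the others. *)
Lemma integral_expR_qform n (K : 'M[R]_n) : posdef K ->
  (\int[lebesgue_cV n]_v (expR (- (qform K v / 2)))%:E =
   ((2 * pi) `^ (n%:R / 2) / Num.sqrt (\det K))%:E)%E.
Proof.
elim: n K => [|n IH] K pK.
  rewrite integral_dirac//=; last first.
    by apply/measurable_EFinP; exact: measurable_expR_qform.
  rewrite diracT mul1e det_mx00 sqrtr1 mul0r powRr0 divr1.
  by rewrite qform0 mul0r oppr0 expR0.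
have s0 := corner_gt0 pK; set s := corner K in s0.
have mq := measurable_expR_qform.
have q0 m (A : 'M[R]_m) v : 0 <= expR (- (qform A v / 2)) := expR_ge0 _.
rewrite (@ge0_integral_lebesgue_cVS R n (fun v => (expR (- (qform K v / 2)))%:E))//.
  2: by apply/measurable_EFinP; exact: mq.
transitivity (\int[lebesgue_cV n]_v
    ((Num.sqrt (2 * pi / s))%:E * (expR (- (qform (schur K) v / 2)))%:E))%E.
  apply: eq_integral => v _.
  pose m := - (((corner_col K)^T *m v) 0 0 / s).
  transitivity (\int[lebesgue_measure]_x
    ((expR (- (qform (schur K) v / 2)))%:E *
     (expR (- (s * (x - m) ^+ 2 / 2)))%:E))%E.
    apply: eq_integral => x _; rewrite cons_cV_col qform_complete_square//.
    by rewrite -EFinM -expRD -/s -/m; congr (expR _)%:E; ring.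
  rewrite ge0_integralZl_fin ?expR_ge0//.
    by rewrite integral_gauss1// muleC.
  apply: measurableT_comp => //.
  apply: measurableT_comp => //; apply: measurable_funM => //.
  apply: measurable_funM => //; apply: measurable_funX.
  exact: measurable_funB.
rewrite ge0_integralZl_fin ?sqrtr_ge0//; last exact: mq.
rewrite IH; last exact: posdef_schur.
rewrite -EFinM (det_schur pK) -/s sqrtr_powR ?mulr_gt0 ?pi_gt0//.
rewrite !sqrtrM ?mulr_ge0 ?pi_ge0 ?(ltW s0)// sqrtrV ?(ltW s0)//.
congr EFin; set p := Num.sqrt pi; set q := _ `^ _.
by rewrite invfM; ring.
Qed.

Lemma powR2pi_gt0 n : 0 < (2 * pi) `^ (n%:R / 2).
Proof. by rewrite powR_gt0// mulr_gt0 ?pi_gt0. Qed.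

Lemma integral_gauss_pdf n (S : 'M[R]_n) : posdef S ->
  (\int[lebesgue_cV n]_v (gauss_pdf S v)%:E = 1)%E.
Proof.
move=> pS; rewrite /gauss_pdf.
under eq_integral do rewrite EFinM.
rewrite ge0_integralZl_fin => [||//|v]; last exact: expR_ge0.
2: by rewrite mulr_ge0 ?invr_ge0 ?sqrtr_ge0// ltW// powR2pi_gt0.
2: exact: measurable_expR_qform.
rewrite integral_expR_qform; last exact: posdef_inv.
rewrite -EFinM det_inv; congr EFin.
have d0 := det_posdef pS.
rewrite sqrtrV ?ltW// invrK; field.
by rewrite !gt_eqF ?powR2pi_gt0// sqrtr_gt0.
Qed.

Lemma gauss_pdf_gt0 n (S : 'M[R]_n) x : posdef S -> 0 < gauss_pdf S x.
Proof.
move=> pS; rewrite /gauss_pdf !mulr_gt0 ?expR_gt0 ?invr_gt0 ?powR2pi_gt0//.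
by rewrite sqrtr_gt0 det_posdef.
Qed.

Lemma gauss_pdfN n (S : 'M[R]_n) x : gauss_pdf S (- x) = gauss_pdf S x.
Proof. by rewrite /gauss_pdf qformNv. Qed.

(** Both sides are the determinant of one block matrix, eliminated in two ways. *)
Lemma det_1addMC n (X Y : 'M[R]_n) : \det (1%:M + X *m Y) = \det (1%:M + Y *m X).
Proof.
transitivity (\det (block_mx 1%:M (- X) Y 1%:M)).
  rewrite (_ : block_mx _ _ _ _ =
    block_mx (1%:M + X *m Y) (- X) 0 1%:M *m block_mx 1%:M 0 Y 1%:M).
    by rewrite det_mulmx det_ublock det_lblock !det1 !mulr1.
  rewrite mulmx_block !mulmx1 !mul0mx !mulmx0 !add0r.
  by rewrite mul1mx mulNmx addrK.
rewrite (_ : block_mx _ _ _ _ =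
  block_mx 1%:M 0 Y 1%:M *m block_mx 1%:M (- X) 0 (1%:M + Y *m X)).
  by rewrite det_mulmx det_ublock det_lblock !det1 !mul1r.
rewrite mulmx_block !mulmx1 !mul1mx !mul0mx !addr0.
by rewrite mulmxN addrC addrK.
Qed.

Section convolution.
Variables (n : nat) (C1 C2 M : 'M[R]_n).
Hypotheses (p1 : posdef C1) (p2 : posdef C2).

Let K1 := invmx C1.
Let K2 := invmx C2.
Let W := K1 + M^T *m K2 *m M.
Let C := C2 + M *m C1 *m M^T.

Let pW : posdef W.
Proof.
apply: posdefD; first exact: posdef_inv.
by apply: psd_congr; apply: posdef_psd; exact: posdef_inv.
Qed.

Lemma posdef_convolution : posdef C.
Proof.
apply: posdefD => //; rewrite -{1}(trmxK M).
by apply: psd_congr; exact: posdef_psd.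
Qed.

(** Woodbury's identity.  [W] is the inverse covariance of the first Gaussian
  vector conditioned on the sum. *)
Let woodbury : invmx C = K2 - K2 *m M *m invmx W *m M^T *m K2.
Proof.
have Cu := posdef_unit posdef_convolution.
apply: (can_inj (mulKmx Cu)); rewrite mulmxV//.
have u1 := posdef_unit p1; have u2 := posdef_unit p2; have uW := posdef_unit pW.
rewrite mulmxBr !mulmxDl mulmxV//.
rewrite -(addrA (1%:M)) -[LHS]addr0; congr (_ + _).
rewrite !mulmxA mulmxV// mul1mx.
have -> : M *m C1 *m M^T *m K2 *m M = M *m C1 *m W - M.
  by rewrite /W mulmxDr !mulmxA mulmxK// addrAC subrr add0r.
rewrite -[X in _ = _ - (X + _)]mulmxA.
rewrite !mulmxBl mulmxK// !mulmxA.
by rewrite [X in _ - X]addrC subrK subrr.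
Qed.

Let det_convolution : \det C = \det C2 * \det C1 * \det W.
Proof.
have u1 := posdef_unit p1; have u2 := posdef_unit p2.
rewrite (_ : C = C2 *m (1%:M + (K2 *m M) *m (C1 *m M^T))); last first.
  by rewrite mulmxDr mulmx1 !mulmxA mulmxV// mul1mx.
rewrite det_mulmx det_1addMC -mulrA; congr (_ * _).
rewrite -det_mulmx; congr (\det _).
by rewrite /W mulmxDr mulmxV// !mulmxA.
Qed.

Let complete_square (p w : 'cV[R]_n) :
  qform K1 w + qform K2 (p - M *m w) =
  qform W (invmx W *m M^T *m K2 *m p - w) + qform (invmx C) p.
Proof.
have sK2 : K2^T = K2 by case: (posdef_inv p2).
have uW := posdef_unit pW.
rewrite woodbury qformB; set a := _ *m p.
rewrite !qformDv ?pW.1// !qformNv.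
have -> : (a^T *m W *m - w) 0 0 = (p^T *m K2 *m - (M *m w)) 0 0.
  congr (fun_of_matrix _ 0 0); rewrite !mulmxN; congr (- _).
  rewrite /a !trmx_mul trmxK sK2 trmx_inv pW.1 !mulmxA.
  by rewrite -(mulmxA _ (invmx W)) mulVmx// mulmx1.
have -> : qform (K2 *m M *m invmx W *m M^T *m K2) p = qform W a.
  rewrite /qform /a !trmx_mul trmxK sK2 trmx_inv pW.1 !mulmxA.
  by rewrite -(mulmxA _ (invmx W) W) mulVmx// mulmx1.
have -> : qform W w = qform K1 w + qform K2 (M *m w).
  by rewrite qformD qform_congr.
ring.
Qed.

(** The image under [M] of a Gaussian increment of covariance [C1], plus an
  independent increment of covariance [C2], is Gaussian of covariance
  [C2 + M *m C1 *m M^T]. *)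
Lemma integral_gauss_conv (u z : 'cV[R]_n) :
  (\int[lebesgue_cV n]_y (gauss_pdf C1 (u - y) * gauss_pdf C2 (M *m y - z))%:E
   = (gauss_pdf C (M *m u - z))%:E)%E.
Proof.
set p := M *m u - z.
pose f w := (gauss_pdf C1 w * gauss_pdf C2 (p - M *m w))%:E.
have mp : measurable_fun setT (fun w : 'cV[R]_n => p - M *m w).
  by apply: measurable_fun_cV_sub => //; exact: measurable_cV_mul.
have mg1 : measurable_fun setT (gauss_pdf C1) by exact: measurable_gauss_pdf.
have mg2 : measurable_fun setT (fun w => gauss_pdf C2 (p - M *m w)).
  exact: (measurableT_comp (@measurable_gauss_pdf R n C2) mp).
transitivity (\int[lebesgue_cV n]_y f (u - y)%R)%E.
  apply: eq_integral => y _; rewrite /f /p; congr (_ * gauss_pdf _ _)%:E.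
  by rewrite mulmxBr opprB [RHS]addrC addrA subrK.
rewrite ge0_integral_reflect//; first last.
- by move=> w; rewrite lee_fin mulr_ge0 ?gauss_pdf_ge0.
- exact/measurable_EFinP/measurable_funM.
pose a := invmx W *m M^T *m K2 *m p.
pose Z1 := ((2 * pi) `^ (n%:R / 2))^-1 * (Num.sqrt (\det C1))^-1.
pose Z2 := ((2 * pi) `^ (n%:R / 2))^-1 * (Num.sqrt (\det C2))^-1.
pose k := Z1 * Z2 * expR (- (qform (invmx C) p / 2)).
transitivity (\int[lebesgue_cV n]_w
  (k%:E * (expR (- (qform W (a - w)%R / 2)))%:E))%E.
  apply: eq_integral => w _; rewrite /f /gauss_pdf -EFinM; congr EFin.
  rewrite -/Z1 -/Z2 /k -[RHS]mulrA.
  rewrite (_ : expR _ * expR (- (qform W _ / 2)) =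
    expR (- (qform K1 w / 2)) * expR (- (qform K2 (p - M *m w) / 2))).
    by ring.
  by rewrite -!expRD; congr expR; have := complete_square p w; rewrite -/a; lra.
have k0 : 0 <= k.
  rewrite !mulr_ge0 ?invr_ge0 ?sqrtr_ge0 ?expR_ge0//; exact/ltW/powR2pi_gt0.
rewrite ge0_integralZl_fin//; last first.
  exact: (measurableT_comp (measurable_expR_qform W) (measurable_cV_sub a)).
rewrite (ge0_integral_reflect a (f := fun w => (expR (- (qform W w / 2)))%:E)); first last.
- by move=> w; rewrite lee_fin expR_ge0.
- by apply/measurable_EFinP; exact: measurable_expR_qform.
rewrite integral_expR_qform// -EFinM; congr EFin.
rewrite /gauss_pdf /k /Z1 /Z2 det_convolution.
have d1 := det_posdef p1; have d2 := det_posdef p2; have dW := det_posdef pW.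
rewrite !sqrtrM ?mulr_ge0 ?ltW//; field.
by rewrite !gt_eqF ?powR2pi_gt0 ?sqrtr_gt0.
Qed.

End convolution.

(** Detailed balance: when [M] is self-adjoint for the covariance [S], the joint
  density of [X] and [M X + N] is a Gaussian whose quadratic form is symmetric
  in the two variables. *)
Lemma gauss_reversible n (S M C : 'M[R]_n) (x z : 'cV[R]_n) :
  posdef S -> posdef C -> C = S - M *m S *m M^T -> M *m S = S *m M^T ->
  gauss_pdf S x * gauss_pdf C (M *m x - z) =
  gauss_pdf S z * gauss_pdf C (M *m z - x).
Proof.
move=> pS pC CE MS; have uS := posdef_unit pS; have uC := posdef_unit pC.
set K := invmx C.
have {}CE : C = S - M *m (M *m S) by rewrite CE -mulmxA -MS.
have CM : C *m M^T = M *m C.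
  by rewrite CE mulmxBl mulmxBr -!mulmxA -MS.
have KM : M^T *m K = K *m M.
  by rewrite -[LHS](mulKmx uC) (mulmxA C) CM -(mulmxA M) mulmxV// mulmx1.
have SK : invmx S + M^T *m K *m M = K.
  apply: (can_inj (mulKmx uC)); rewrite mulmxV// mulmxDr.
  rewrite !mulmxA CM -(mulmxA M C K) mulmxV// mulmx1.
  by rewrite CE mulmxBl mulmxV// mulmxA mulmxK// subrK.
have q (y t : 'cV[R]_n) : qform (invmx S) y + qform K (M *m y - t) =
    qform K y + qform K t - 2 * (y^T *m (K *m M) *m t) 0 0.
  have sK : K^T = K by case: (posdef_inv pC).
  have -> : qform K y = qform (invmx S) y + qform K (M *m y).
    by rewrite -{1}SK qformD qform_congr.
  rewrite qformDv// qformNv trmx_mul -(mulmxA _ M^T) KM mulmxN.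
  by rewrite [X in 2 * X]mxE; ring.
rewrite /gauss_pdf -/K mulrACA [RHS]mulrACA; congr (_ * _).
rewrite -!expRD -!opprD -!mulrDl !q; congr (expR (- (_ / 2))).
rewrite (addrC (qform K z)); congr (_ - 2 * _).
have sKM : (K *m M)^T = K *m M.
  by rewrite trmx_mul (posdef_inv pC).1 -/K KM.
exact: bilinear_sym.
Qed.

End gauss_integral.

Section integral_density.
Context d (T : measurableType d) (R : realType).
Variables (lam mu : {measure set T -> \bar R}) (g : T -> R).
Hypothesis mg : measurable_fun setT g.
Hypothesis g0 : forall x, 0 <= g x.
Hypothesis muE : forall A, measurable A -> (mu A = \int[lam]_(x in A) (g x)%:E)%E.
Local Open Scope ereal_scope.

Import HBNNSimple.

Let integral_density_indic (A : set T) : measurable A ->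
  mu A = \int[lam]_x ((\1_A x)%:E * (g x)%:E).
Proof.
move=> mA; rewrite muE// integral_mkcond; apply: eq_integral => x _ /=.
rewrite patchE indicE; case: ifPn => _; first by rewrite mul1e.
by rewrite mul0e.
Qed.

Let integral_density_nnsfun (h : {nnsfun T >-> R}) :
  \int[mu]_x (h x)%:E = \int[lam]_x ((h x)%:E * (g x)%:E).
Proof.
have indich r : measurable_fun setT (fun x => (r * \1_(h @^-1` [set r]) x)%:E).
  exact/measurable_EFinP/measurable_funM.
transitivity (\int[mu]_x
   (\sum_(y \in range h) (y * \1_(h @^-1` [set y]) x)%:E)).
  by apply: eq_integral => t _; rewrite /= fimfunE -fsumEFin.
rewrite ge0_integral_fsum//; last by move=> y x _; exact: nnfun_muleindic_ge0.
transitivity (\int[lam]_x (\sum_(y \in range h)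
   (y * \1_(h @^-1` [set y]) x)%:E * (g x)%:E)); last first.
  apply: eq_integral => x _.
  rewrite -ge0_mule_fsuml => [|y]; last exact: nnfun_muleindic_ge0.
  by rewrite fsumEFin// -(fimfunE h).
rewrite ge0_integral_fsum//; last 2 first.
- by move=> r; apply: emeasurable_funM => //; exact/measurable_EFinP.
- move=> y x _; apply: mule_ge0; last by rewrite lee_fin.
  exact: nnfun_muleindic_ge0.
apply: eq_fsbigr => r rh; rewrite integralZl_indic_nnsfun//.
rewrite integral_indic//= setIT integral_density_indic// -ge0_integralZl//.
- by apply: eq_integral => x _; rewrite EFinM muleA.
- apply: emeasurable_funM; last exact/measurable_EFinP.
  exact/measurable_EFinP.
- by move=> x _; rewrite mule_ge0 ?lee_fin.
- by rewrite lee_fin; move: rh; rewrite inE => -[x _ <-]; exact: fun_ge0.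
Qed.

(** Indicators, then simple functions, then monotone convergence. *)
Lemma ge0_integral_density (f : T -> \bar R) :
  measurable_fun setT f -> (forall x, 0 <= f x) ->
  \int[mu]_x f x = \int[lam]_x (f x * (g x)%:E).
Proof.
move=> mf f0; pose h := nnsfun_approx measurableT mf.
have fE x : f x = limn (EFin \o h ^~ x).
  by apply/esym/cvg_lim => //; exact: cvg_nnsfun_approx.
have fgE x : f x * (g x)%:E = limn (fun n => (h n x)%:E * (g x)%:E).
  apply/esym/cvg_lim => //; apply: cvgeZr => //; exact: cvg_nnsfun_approx.
under eq_integral do rewrite fE.
under [RHS]eq_integral do rewrite fgE.
rewrite monotone_convergence//; last 3 first.
- by move=> n; exact/measurable_EFinP.
- by move=> n x _ /=; rewrite lee_fin.
- by move=> x _ a b ab; rewrite lee_fin; exact/lefP/nd_nnsfun_approx.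
rewrite monotone_convergence//.
- by congr (limn _); apply/funext => n; exact: integral_density_nnsfun.
- by move=> n; apply: emeasurable_funM; exact/measurable_EFinP.
- by move=> n x _; rewrite mule_ge0 ?lee_fin.
- move=> x _ a b ab; rewrite lee_wpmul2r ?lee_fin//.
  exact/lefP/nd_nnsfun_approx.
Qed.

Lemma integral_density (f : T -> R) : measurable_fun setT f ->
  \int[mu]_x (f x)%:E = \int[lam]_x (f x * g x)%:E.
Proof.
move=> mf; have meF := (measurable_EFinP _ _).2 mf.
rewrite integralE [RHS]integralE.
rewrite (ge0_integral_density (measurable_funepos meF))//.
rewrite (ge0_integral_density (measurable_funeneg meF))//.
congr (_ - _); apply: eq_integral => x _.
- by rewrite !funeposE /= EFinM maxe_pMl ?lee_fin// mul0e.
- by rewrite !funenegE /= -mulNr EFinM maxe_pMl ?lee_fin// mul0e.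
Qed.

End integral_density.

(** * Mehler operators *)

Section mehler.
Context (R : realType) (n : nat).
Implicit Types (S M C : 'M[R]_n) (x y z : 'cV[R]_n).

Lemma gauss_measureT S : posdef S -> gauss_measure S setT = 1%E.
Proof. exact: integral_gauss_pdf. Qed.

Definition gauss_prob_fun S of posdef S := gauss_measure S.
HB.instance Definition _ S (pS : posdef S) := Measure.on (gauss_prob_fun pS).
HB.instance Definition _ S (pS : posdef S) :=
  @Measure_isProbability.Build _ _ R (gauss_prob_fun pS) (gauss_measureT pS).

(** [gauss_measure S] is a measure for every matrix [S], a probability only for
  a positive definite one; the proof is carried by the name. *)
Definition gauss_prob S (pS : posdef S) : probability 'cV[R]_n R :=
  gauss_prob_fun pS.

Lemma ge0_integral_gauss S (f : 'cV[R]_n -> R) :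
  measurable_fun setT f -> (forall x, 0 <= f x) ->
  (\int[gauss_measure S]_x (f x)%:E =
   \int[lebesgue_cV n]_x (f x * gauss_pdf S x)%:E)%E.
Proof.
move=> mf f0; apply: integral_density => //; first exact: measurable_gauss_pdf.
exact: gauss_pdf_ge0.
Qed.

Lemma integral_gauss S (f : 'cV[R]_n -> R) : measurable_fun setT f ->
  (\int[gauss_measure S]_x (f x)%:E =
   \int[lebesgue_cV n]_x (f x * gauss_pdf S x)%:E)%E.
Proof.
move=> mf; apply: integral_density => //; first exact: measurable_gauss_pdf.
exact: gauss_pdf_ge0.
Qed.

(** The law of [M X + N], given [X], for independent centered Gaussian vectors
  [X] and [N], [X] of covariance [S2] and [M X + N] of covariance [S1]; here
  as a density with respect to the law of [M X + N]. *)
Definition mehler_kernel S1 S2 M x z : R :=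
  gauss_pdf (S1 - M *m S2 *m M^T) (M *m x - z) / gauss_pdf S1 z.

Definition mehler S1 S2 M (f : L2 (gauss_measure S1)) : L2 (gauss_measure S2) :=
  mkL2 (gauss_measure S2)
    (fun x => \int[gauss_measure S1]_z (f z * mehler_kernel S1 S2 M x z)).

(** [S1 - M *m S2 *m M^T] is the covariance of the noise added to [M X]. *)
Definition mehler_dom S1 S2 M :=
  [/\ posdef S1, posdef S2 & posdef (S1 - M *m S2 *m M^T)].

Lemma mehler_kernel_cancel S1 S2 M x z : posdef S1 ->
  mehler_kernel S1 S2 M x z * gauss_pdf S1 z =
  gauss_pdf (S1 - M *m S2 *m M^T) (M *m x - z).
Proof. by move=> p1; rewrite divfK// gt_eqF// gauss_pdf_gt0. Qed.

Lemma mehler_kernel_ge0 S1 S2 M x z : 0 <= mehler_kernel S1 S2 M x z.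
Proof. by rewrite mulr_ge0 ?invr_ge0 ?gauss_pdf_ge0. Qed.

Lemma measurable_mehler_kernel S1 S2 M : posdef S1 ->
  measurable_fun setT (fun p : 'cV[R]_n * 'cV[R]_n =>
    mehler_kernel S1 S2 M p.1 p.2).
Proof.
move=> p1; apply: measurable_funM.
  apply: (measurableT_comp (@measurable_gauss_pdf R n _)).
  apply: measurable_fun_cV_sub => //.
  exact: (measurableT_comp (@measurable_cV_mul R n n M)).
apply: (measurableT_comp (f := fun z => (gauss_pdf S1 z)^-1)) => //.
rewrite /gauss_pdf; under eq_fun do rewrite !invfM -expRN.
apply: measurable_funM => //; apply: measurableT_comp => //.
apply: measurableT_comp => //; apply: measurableT_comp => //.
by apply: measurable_funM => //; exact: measurable_qform.
Qed.

Lemma measurable_mehler_kernel1 S1 S2 M x : posdef S1 ->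
  measurable_fun setT (mehler_kernel S1 S2 M x).
Proof.
by move=> /measurable_mehler_kernel mk;
  exact: (measurableT_comp (mk S2 M) (measurable_pair1 x)).
Qed.

Lemma measurable_mehler_kernel2 S1 S2 M z : posdef S1 ->
  measurable_fun setT (fun x => mehler_kernel S1 S2 M x z).
Proof.
by move=> /measurable_mehler_kernel mk;
  exact: (measurableT_comp (mk S2 M) (measurable_pair2 z)).
Qed.

(** The marginals of the joint law of [X] and [M X + N] are the integral of a
  reflected Gaussian density and a convolution. *)
Lemma bistochastic_mehler S1 S2 M (p1 : posdef S1) (p2 : posdef S2) :
  posdef (S1 - M *m S2 *m M^T) ->
  bistochastic (gauss_prob p2) (gauss_prob p1) (mehler_kernel S1 S2 M).
Proof.
move=> pC; split.
- exact: measurable_mehler_kernel.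
- exact: mehler_kernel_ge0.
- move=> x; rewrite [LHS]ge0_integral_gauss//; last 2 first.
  + exact: measurable_mehler_kernel1.
  + exact: mehler_kernel_ge0.
  under eq_integral do rewrite mehler_kernel_cancel//.
  rewrite (ge0_integral_reflect (M *m x)
    (f := fun z => (gauss_pdf (S1 - M *m S2 *m M^T) z)%:E)).
  + exact: integral_gauss_pdf.
  + by apply/measurable_EFinP; exact: measurable_gauss_pdf.
  + by move=> z; rewrite lee_fin gauss_pdf_ge0.
- move=> z; rewrite [LHS]ge0_integral_gauss//; last 2 first.
  + exact: measurable_mehler_kernel2.
  + by move=> x; exact: mehler_kernel_ge0.
  have := integral_gauss_conv M p2 pC 0 z.
  rewrite subrK mulmx0 sub0r gauss_pdfN => conv.
  rewrite (_ : integral _ _ _ = ((gauss_pdf S1 z)^-1%:E * (gauss_pdf S1 z)%:E)%E).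
    by rewrite -EFinM mulVf// gt_eqF// gauss_pdf_gt0.
  rewrite -conv -ge0_integralZl_fin ?invr_ge0 ?gauss_pdf_ge0//.
  + apply: eq_integral => x _; rewrite -EFinM; congr EFin.
    by rewrite sub0r gauss_pdfN /mehler_kernel; ring.
  + apply: measurable_funM.
      apply: (measurableT_comp (@measurable_gauss_pdf R n _)).
      exact: measurable_cV_sub.
    apply: (measurableT_comp (@measurable_gauss_pdf R n _)).
    by apply: measurable_fun_cV_sub => //; exact: measurable_cV_mul.
  + by move=> x; rewrite mulr_ge0 ?gauss_pdf_ge0.
Qed.

Lemma integral_mehler_kernel S1 S2 M x : mehler_dom S1 S2 M ->
  (\int[gauss_measure S1]_z (mehler_kernel S1 S2 M x z)%:E = 1)%E.
Proof.
by move=> [p1 p2 pC]; have [_ _ k1 _] := bistochastic_mehler p1 p2 pC;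
  exact: k1.
Qed.

Lemma mehler_contract S1 S2 M (f : L2 (gauss_measure S1)) : mehler_dom S1 S2 M ->
  dot (mehler S2 M f) (mehler S2 M f) <= dot f f.
Proof.
by move=> [p1 p2 pC]; exact: (kop_contract (bistochastic_mehler p1 p2 pC)).
Qed.

Lemma mehlerE S1 S2 M (f : L2 (gauss_measure S1)) : mehler_dom S1 S2 M ->
  mehler S2 M f = (fun x =>
    \int[gauss_measure S1]_z (f z * mehler_kernel S1 S2 M x z)) :> (_ -> _).
Proof.
by move=> [p1 p2 pC]; exact: (kopE (bistochastic_mehler p1 p2 pC) f).
Qed.

Lemma integral_gauss_pdf_cV_sub (S : 'M[R]_n) (a : 'cV[R]_n)
    (f : 'cV[R]_n -> R) : measurable_fun setT f ->
  \int[lebesgue_cV n]_z (f z * gauss_pdf S (a - z)) =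
  \int[lebesgue_cV n]_y (f (a - y) * gauss_pdf S y).
Proof.
move=> mf; pose F z := (f z * gauss_pdf S (a - z))%:E.
have mF : measurable_fun setT F.
  apply/measurable_EFinP/measurable_funM => //.
  apply: (measurableT_comp (@measurable_gauss_pdf R n _)).
  exact: measurable_cV_sub.
have E y : F (a - y) = (f (a - y) * gauss_pdf S y)%:E.
  by rewrite /F (_ : a - (a - y) = y)// opprB addrC subrK.
rewrite /Rintegral -[X in fine X = _](integral_reflect a mF).
by congr (fine _); apply: eq_integral => y _; exact: E.
Qed.

(** Integrating over the noise rather than over the end point gives the
  classical form of the Mehler operator. *)
Lemma mehler_formula S1 S2 M (f : L2 (gauss_measure S1)) : mehler_dom S1 S2 M ->
  mehler S2 M f = (fun x => \int[lebesgue_cV n]_y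
    (f (M *m x - y) * gauss_pdf (S1 - M *m S2 *m M^T) y)) :> (_ -> _).
Proof.
move=> dom.
apply: (etrans (mehlerE f dom)).
have [p1 p2 pC] := dom.
apply/funext => x.
rewrite -(integral_gauss_pdf_cV_sub _ _ (L2_measurable f)).
congr (fine _).
rewrite integral_gauss; last first.
  by apply: measurable_funM => //; exact: measurable_mehler_kernel1.
by apply: eq_integral => z _; rewrite -mulrA mehler_kernel_cancel.
Qed.

Lemma mehler_domM S1 S2 S3 M1 M2 :
  mehler_dom S2 S3 M1 -> mehler_dom S1 S2 M2 ->
  [/\ mehler_dom S1 S3 (M2 *m M1) & S1 - (M2 *m M1) *m S3 *m (M2 *m M1)^T =
    (S1 - M2 *m S2 *m M2^T) + M2 *m (S2 - M1 *m S3 *m M1^T) *m M2^T].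
Proof.
move=> [p2 p3 pC1] [p1 _ pC2].
have E : S1 - (M2 *m M1) *m S3 *m (M2 *m M1)^T =
    (S1 - M2 *m S2 *m M2^T) + M2 *m (S2 - M1 *m S3 *m M1^T) *m M2^T.
  rewrite mulmxBr mulmxBl trmx_mul !mulmxA.
  by rewrite addrA subrK.
by split => //; split => //; rewrite E; exact: posdef_convolution.
Qed.

(** Chapman-Kolmogorov: the noises of two successive transitions convolve. *)
Lemma mehler_kernel_comp S1 S2 S3 M1 M2 x z :
  mehler_dom S2 S3 M1 -> mehler_dom S1 S2 M2 ->
  (\int[gauss_measure S2]_y
     (mehler_kernel S2 S3 M1 x y * mehler_kernel S1 S2 M2 y z)%:E =
   (mehler_kernel S1 S3 (M2 *m M1) x z)%:E)%E.
Proof.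
move=> d1 d2; have [[p1 p3 pC] CE] := mehler_domM d1 d2.
have [p2 _ pC1] := d1; have [_ _ pC2] := d2.
rewrite [LHS]ge0_integral_gauss; last 2 first.
- by apply: measurable_funM; [exact: measurable_mehler_kernel1|
    exact: measurable_mehler_kernel2].
- by move=> y; rewrite mulr_ge0 ?mehler_kernel_ge0.
have := integral_gauss_conv M2 pC1 pC2 (M1 *m x) z.
rewrite mulmxA -CE => conv.
rewrite [X in _ = X%:E]/mehler_kernel mulrC EFinM -conv.
rewrite -ge0_integralZl_fin ?invr_ge0 ?gauss_pdf_ge0//.
- apply: eq_integral => y _; rewrite -EFinM; congr EFin.
  by rewrite mulrAC mehler_kernel_cancel// /mehler_kernel; ring.
- apply: measurable_funM.
    apply: (measurableT_comp (@measurable_gauss_pdf R n _)).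
    exact: measurable_cV_sub.
  apply: (measurableT_comp (@measurable_gauss_pdf R n _)).
  by apply: measurable_fun_cV_sub => //; exact: measurable_cV_mul.
- by move=> y; rewrite mulr_ge0 ?gauss_pdf_ge0.
Qed.

Lemma mehler_comp S1 S2 S3 M1 M2 (f : L2 (gauss_measure S1)) :
  mehler_dom S2 S3 M1 -> mehler_dom S1 S2 M2 ->
  mehler S3 M1 (mehler S2 M2 f) = mehler S3 (M2 *m M1) f
    %[ae gauss_measure S3].
Proof.
move=> d1 d2; have [[p1 p3 pC] CE] := mehler_domM d1 d2.
have [p2 _ pC1] := d1; have [_ _ pC2] := d2.
apply: (kop_comp (bistochastic_mehler p2 p3 pC1) (bistochastic_mehler p1 p2 pC2)
  (bistochastic_mehler p1 p3 pC)) => x z.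
exact: mehler_kernel_comp.
Qed.

Lemma mehler_kernel_sym S M x z : mehler_dom S S M -> M *m S = S *m M^T ->
  mehler_kernel S S M x z = mehler_kernel S S M z x.
Proof.
move=> [p1 _ pC] MS; have gx := gauss_pdf_gt0 x p1; have gz := gauss_pdf_gt0 z p1.
have := gauss_reversible x z p1 pC erefl MS; rewrite /mehler_kernel => E.
apply: (mulfI (lt0r_neq0 gx)); rewrite mulrA E.
by field; rewrite !gt_eqF.
Qed.

(** Detailed balance makes the kernel symmetric. *)
Lemma mehler_sym S M (f g : L2 (gauss_measure S)) :
  mehler_dom S S M -> M *m S = S *m M^T ->
  dot (mehler S M f) g = dot f (mehler S M g).
Proof.
move=> dom MS; have [p1 _ pC] := dom.
have ksym : (fun y x => mehler_kernel S S M x y) = mehler_kernel S S M.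
  by apply/funext => y; apply/funext => x; exact: mehler_kernel_sym.
have := @kop_adjoint _ _ _ _ _ (gauss_prob p1) (gauss_prob p1)
  (mehler_kernel S S M) f g (bistochastic_mehler p1 p1 pC).
by rewrite ksym.
Qed.

Lemma mehler_cst S1 S2 M (a : R) (f : L2 (gauss_measure S1)) :
  mehler_dom S1 S2 M -> f = cst a :> (_ -> _) ->
  mehler S2 M f = cst a :> (_ -> _).
Proof.
move=> dom fa; apply: (etrans (mehlerE f dom)).
have [p1 p2 pC] := dom; apply/funext => x; rewrite /= fa /cst.
rewrite /Rintegral; under eq_integral do rewrite EFinM.
rewrite integralZl//; last first.
  apply/integrableP; split.
    by apply/measurable_EFinP; exact: measurable_mehler_kernel1.
  under eq_integral do rewrite /= ger0_norm ?mehler_kernel_ge0//.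
  by rewrite integral_mehler_kernel// ltry.
by rewrite integral_mehler_kernel// mule1.
Qed.

End mehler.

(** * Density of simple functions *)

Section L2_induction.
Context d (T : measurableType d) (R : realType).
Variable mu : {measure set T -> \bar R}.
Hypothesis mu1 : mu setT = 1%E.

Definition ind (A : set T) : L2 mu := mkL2 mu (\1_A : T -> R).

Lemma indE (A : set T) : measurable A -> ind A = \1_A :> (T -> R).
Proof.
move=> mA; apply: mkL2E; apply: Lfun2P; first exact: measurable_indic.
apply: (@le_lt_trans _ _ (\int[mu]_x (cst 1 x))%E); last first.
  by rewrite integral_cst// mul1e mu1 ltry.
apply: ge0_le_integral => //.
- by apply/measurable_EFinP; apply: measurable_funX; exact: measurable_indic.
- by move=> x _; rewrite lee_fin indicE; case: (_ \in _); rewrite ?expr1n ?expr0n.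
Qed.

Lemma indTE : ind setT = cst 1 :> (T -> R).
Proof. by rewrite indE//; apply/funext => x; rewrite indicT. Qed.

Lemma dot_indl (A : set T) (f : L2 mu) : measurable A ->
  (dot (ind A) f)%:E = (\int[mu]_(x in A) (f x)%:E)%E.
Proof.
move=> mA; rewrite EFin_dot indE// [RHS]integral_mkcond.
apply: eq_integral => x _; rewrite patchE indicE.
by case: ifPn => _; rewrite ?mul1r ?mul0r.
Qed.

Lemma L2_sumE (I : Type) (s : seq I) (F : I -> L2 mu) x :
  (\sum_(i <- s) F i) x = \sum_(i <- s) F i x.
Proof.
elim: s => [|i s IH]; first by rewrite !big_nil.
by rewrite !big_cons -IH.
Qed.

Import HBNNSimple.

(** Density of simple functions, as a principle of induction: the positive and
  negative parts of a function are limits of increasing simple functions. *)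
Lemma L2_ind (V : L2 mu -> Prop) :
  (forall A, measurable A -> V (ind A)) ->
  (forall a f g, V f -> V g -> V (a *: f + g)) ->
  (forall f, (forall e, 0 < e -> exists2 g, V g & nrm (f - g) <= e) -> V f) ->
  forall f, V f.
Proof.
move=> Vind Vlin Vcl.
have V0 : V 0.
  have := Vlin (-1) _ _ (Vind _ measurableT) (Vind _ measurableT).
  by rewrite scaleN1r addNr.
have Vsum (I : Type) (s : seq I) (F : I -> L2 mu) (c : I -> R) :
    (forall i, V (F i)) -> V (\sum_(i <- s) c i *: F i).
  move=> VF; elim: s => [|i s IH]; first by rewrite big_nil.
  by rewrite big_cons; exact: Vlin.
have Vnn (g : T -> R) (gL : g \in Lfun mu 2) : (forall x, 0 <= g x) -> V (mkL2 mu g).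
  move=> g0; apply: Vcl => e e0.
  set G := mkL2 mu g; have GE : G = g :> (T -> R) := mkL2E gL.
  have mg : measurable_fun setT (EFin \o g).
    by apply/measurable_EFinP; rewrite -GE; exact: L2_measurable.
  pose h := nnsfun_approx measurableT mg.
  have hg k x : h k x <= g x.
    rewrite -lee_fin nnsfun_approxE.
    by apply: (@le_approx _ _ _ _ (EFin \o g)) => // y _; rewrite lee_fin.
  have hL k : (h k : T -> R) \in Lfun mu 2.
    apply: (@mkL2_dot _ _ _ mu _ G) => //.
    rewrite EFin_dot; apply: ge0_le_integral => //.
    - by move=> x _; rewrite lee_fin sqr_ge0.
    - by apply/measurable_EFinP; exact: measurable_funX.
    - by apply/measurable_EFinP; apply: measurable_funM; exact: L2_measurable.
    - move=> x _; rewrite lee_fin GE -expr2.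
      by rewrite ler_pXn2r ?nnegrE ?fun_ge0.
  pose H k := mkL2 mu (h k).
  have HE k : H k = h k :> (T -> R) := mkL2E (hL k).
  have VH k : V (H k).
    have -> : H k = \sum_(y <- finmap.enum_fset (fset_set (range (h k))))
        y *: ind ((h k) @^-1` [set y]).
      apply/LfuneqP => x; rewrite HE L2_sumE fimfunE fsbig_finite//=.
      by apply: eq_bigr => y _; rewrite -[RHS]/(y * _) indE.
    by apply: Vsum => y; exact: Vind.
  have cvgH : (\int[mu]_x (h k x ^+ 2)%:E @[k --> \oo] -->
               \int[mu]_x (g x ^+ 2)%:E)%E.
    have gl x : ((g x ^+ 2)%:E = limn (fun k => (h k x ^+ 2)%:E))%E.
      apply/esym/cvg_lim => //.
      have : (EFin \o h ^~ x) k @[k --> \oo] --> (g x)%:E.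
        by apply: (cvg_nnsfun_approx measurableT mg) => // y _; rewrite lee_fin.
      move=> /fine_cvgP[_ hc]; apply: cvg_EFin; first exact: nearW.
      under eq_fun do rewrite /= expr2; rewrite expr2; exact: cvgM.
    under eq_integral do rewrite gl.
    apply: cvg_monotone_convergence => //.
    - by move=> k; apply/measurable_EFinP; exact: measurable_funX.
    - by move=> k x _; rewrite lee_fin sqr_ge0.
    - move=> x _ a b ab; rewrite lee_fin ler_pXn2r ?nnegrE ?fun_ge0//.
      exact/lefP/nd_nnsfun_approx.
  have {}cvgH : dot (H k) (H k) @[k --> \oo] --> dot G G.
    move: cvgH; rewrite (_ : integral _ _ _ = (dot G G)%:E); last first.
      by rewrite EFin_dot GE; apply: eq_integral => x _; rewrite expr2.
    move=> /fine_cvgP[_ cvgh].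
    have -> : (fun k => dot (H k) (H k)) =
        fine \o (fun k => \int[mu]_x (h k x ^+ 2)%:E)%E.
      apply/funext => k /=; rewrite /dot /Rintegral; congr (fine _).
      by apply: eq_integral => x _; rewrite HE expr2.
    exact: cvgh.
  have e20 : 0 < e ^+ 2 by rewrite exprn_gt0.
  have /cvgrPdist_le/(_ _ e20)[k _ /(_ k (leqnn k))/= kP] := cvgH.
  exists (H k); first exact: VH.
  rewrite (nrm_le _ (ltW e0)); apply: le_trans kP.
  have GH : dot (H k) (H k) <= dot G (H k).
    rewrite -subr_ge0 -dotBl; apply: Rintegral_ge0 => x _.
    rewrite -[(G - H k) x]/(G x - H k x) GE HE mulr_ge0 ?fun_ge0//.
    by rewrite subr_ge0.
  rewrite !dotE (dotC (H k)); have := ler_norm (dot G G - dot (H k) (H k)).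
  by lra.
move=> f.
have maxL (h : L2 mu) : (fun x => Num.max (h x) 0) \in Lfun mu 2.
  apply: (@mkL2_dot _ _ _ mu _ h); first exact: measurable_maxr.
  rewrite EFin_dot; apply: ge0_le_integral => //.
  - by move=> x _; rewrite lee_fin sqr_ge0.
  - by apply/measurable_EFinP; apply: measurable_funX; exact: measurable_maxr.
  - by apply/measurable_EFinP; exact: measurable_funM.
  - move=> x _; rewrite lee_fin -expr2 maxEle.
    by case: ifP => _; rewrite ?expr0n/= ?sqr_ge0.
have -> : f = (-1) *: mkL2 mu (fun x => Num.max ((- f) x) 0)
    + mkL2 mu (fun x => Num.max (f x) 0).
  apply/LfuneqP => x; rewrite scaleN1r -[RHS]/(- mkL2 _ _ x + mkL2 _ _ x).
  rewrite (mkL2E (maxL (- f))) (mkL2E (maxL f)) (_ : (- f) x = - f x)// !maxEle.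
  by move: (f x : R) => y; case: (leP (- y) 0); case: (leP y 0); lra.
by apply: Vlin; apply: Vnn => [|x]; rewrite ?maxL// le_max lexx orbT.
Qed.

End L2_induction.

(** * The number semigroup: continuity at the origin *)

Section gauss_tail.
Context (R : realType) (n : nat).
Variable T : 'M[R]_n.
Hypothesis pT : posdef T.

Lemma gauss_pdf_halve (y : 'cV[R]_n) : gauss_pdf T y =
  Num.sqrt (2 ^+ n) * expR (- (qform (invmx T) y / 4)) * gauss_pdf (2 *: T) y.
Proof.
have d0 := det_posdef pT.
have Tu := posdef_unit pT.
have T2u := posdef_unit (posdefZ (ltr0n R 2) pT).
rewrite /gauss_pdf detZ (invmxZ T2u) qformZ sqrtrM ?exprn_ge0//.
have s2 : Num.sqrt (2 ^+ n : R) != 0 by rewrite gt_eqF// sqrtr_gt0 exprn_gt0.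
have -> : expR (- (qform (invmx T) y / 2)) =
    expR (- (qform (invmx T) y / 4)) * expR (- (2^-1 * qform (invmx T) y / 2)).
  by rewrite -expRD; congr expR; field.
move: s2; move: (Num.sqrt (2 ^+ n)) => a a0.
have b0 : Num.sqrt (\det T) != 0 by rewrite gt_eqF// sqrtr_gt0.
have c0 : (2 * pi) `^ (n%:R / 2) != 0 :> R by rewrite gt_eqF// powR2pi_gt0.
move: b0 c0; move: (Num.sqrt _) (_ `^ _) => b c b0 c0.
by field; rewrite a0 b0 c0.
Qed.

(** Cauchy-Schwarz for the inverse form, between [y] and [T *m delta_mx i 0]. *)
Lemma entry_le_qform_inv (y : 'cV[R]_n) i :
  y i 0 ^+ 2 <= T i i * qform (invmx T) y.
Proof.
have Tu := posdef_unit pT.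
have := cauchy_schwarz_qform (T *m delta_mx i 0) y (posdef_inv pT).
have sT := pT.1.
have E (z : 'cV[R]_n) : ((T *m (delta_mx i 0 : 'cV[R]_n))^T *m invmx T *m z) 0 0 = z i 0 :> R.
  rewrite trmx_mul sT -(mulmxA _ T) mulmxV// mulmx1 trmx_delta.
  transitivity ((row i z) 0 0); last by rewrite mxE.
  by rewrite rowE.
by rewrite E /qform E -colE mxE.
Qed.

Lemma diag_posdef_gt0 i : 0 < T i i.
Proof.
have := pT.2 (delta_mx i 0); rewrite /qform (_ : (_ *m _ *m _) 0 0 = T i i); last first.
  by rewrite -mulmxA -colE trmx_delta -rowE !mxE.
apply; apply/eqP => /matrixP/(_ i 0)/eqP.
by rewrite !mxE !eqxx/= oner_eq0.
Qed.

(** Splitting the exponent in two halves, one half is bounded by its value on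
  the half-space, the other is a Gaussian density of twice the covariance. *)
Lemma gauss_pdf_tail (y : 'cV[R]_n) i (eta : R) : 0 <= eta -> eta <= y i 0 ->
  gauss_pdf T y <= Num.sqrt (2 ^+ n) * expR (- (eta ^+ 2 / (4 * T i i)))
    * gauss_pdf (2 *: T) y.
Proof.
move=> e0 ey; rewrite gauss_pdf_halve ler_wpM2r ?gauss_pdf_ge0//.
rewrite ler_wpM2l ?sqrtr_ge0// ler_expR lerN2.
have Ti := diag_posdef_gt0 i.
rewrite ler_pdivrMr ?mulr_gt0//.
have -> : qform (invmx T) y / 4 * (4 * T i i) = T i i * qform (invmx T) y.
  by field.
by apply: le_trans (entry_le_qform_inv y i); rewrite ler_pXn2r// nnegrE (le_trans e0).
Qed.

End gauss_tail.

Section number_semigroup.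
Context (R : realType) (n : nat).
Variable S : 'M[R]_n.
Hypothesis pS : posdef S.
Local Notation gamma := (gauss_measure S).
Let g1 := gauss_measureT pS.
Local Notation ind := (ind gamma).

(** The semigroup of the number operator: the Ornstein-Uhlenbeck semigroup
  with identity drift and the given invariant covariance. *)
Definition numsg (t : R) : L2 gamma -> L2 gamma := mehler S (expR (- t))%:M.

Lemma numsg_cov (r : R) : S - r%:M *m S *m (r%:M)^T = (1 - r ^+ 2) *: S.
Proof.
by rewrite tr_scalar_mx mul_scalar_mx mul_mx_scalar scalerA scalerBl scale1r expr2.
Qed.

Lemma expRN_lt1 (t : R) : 0 < t -> expR (- t) < 1.
Proof. by move=> t0; rewrite -expR0 ltr_expR oppr_lt0. Qed.

Lemma sqr_expRN_lt1 (t : R) : 0 < t -> expR (- t) ^+ 2 < 1.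
Proof. by move=> t0; rewrite expr_lt1 ?expR_ge0// expRN_lt1. Qed.

Lemma numsg_dom t : 0 < t -> mehler_dom S S (expR (- t))%:M.
Proof.
move=> t0; split => //; rewrite numsg_cov; apply: posdefZ => //.
by rewrite subr_gt0 sqr_expRN_lt1.
Qed.

Lemma numsg_contract t f : 0 < t -> dot (numsg t f) (numsg t f) <= dot f f.
Proof. by move=> t0; apply: mehler_contract; exact: numsg_dom. Qed.

Lemma numsg_comm (r : R) : r%:M *m S = S *m (r%:M)^T.
Proof. by rewrite tr_scalar_mx mul_scalar_mx mul_mx_scalar. Qed.

Lemma numsg_dot s t f g : 0 < s -> 0 < t ->
  dot (numsg s f) (numsg t g) = dot f (numsg (s + t) g).
Proof.
move=> s0 t0; apply: (etrans (mehler_sym _ _ (numsg_dom s0) (numsg_comm _))).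
have := mehler_comp g (numsg_dom s0) (numsg_dom t0).
rewrite -scalar_mxM -expRD -opprD (addrC t); exact: dot_aer.
Qed.

Lemma numsg_sym t f g : 0 < t -> dot (numsg t f) g = dot f (numsg t g).
Proof. exact: sgr_sym numsg_dot _ _ _. Qed.

Lemma mehler_ge0 S1 S2 M (f : L2 (gauss_measure S1)) x : mehler_dom S1 S2 M ->
  (forall y : 'cV[R]_n, 0 <= f y) -> 0 <= mehler S2 M f x.
Proof.
move=> dom f0; rewrite (mehlerE f dom); apply: Rintegral_ge0 => y _.
by rewrite mulr_ge0 ?mehler_kernel_ge0.
Qed.

Lemma numsg_form_le t (f f' g g' : L2 gamma) : 0 < t ->
  (forall x, 0 <= f x) -> (forall x, f x <= f' x) ->
  (forall x, 0 <= g x) -> (forall x, g x <= g' x) ->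
  dot f (numsg t g) <= dot f' (numsg t g').
Proof.
move=> t0 f0 ff' gp gg'.
apply: (@le_trans _ _ (dot f (numsg t g'))).
  rewrite -!numsg_sym// -subr_ge0 -dotBr; apply: Rintegral_ge0 => x _.
  rewrite mulr_ge0//; first exact: mehler_ge0 (numsg_dom t0) _.
  by rewrite -[(g' - g) x]/(g' x - g x) subr_ge0.
rewrite -subr_ge0 -dotBl; apply: Rintegral_ge0 => x _.
rewrite mulr_ge0//; first by rewrite -[(f' - f) x]/(f' x - f x) subr_ge0.
by apply: mehler_ge0 (numsg_dom t0) _ => y; exact: le_trans (gg' y).
Qed.

Lemma ind_ge0 A x : measurable A -> 0 <= ind A x.
Proof. by move=> mA; rewrite (indE g1 mA). Qed.

Lemma ind_le A A' x : measurable A -> measurable A' -> A `<=` A' ->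
  ind A x <= ind A' x.
Proof.
move=> mA mA' AA'; rewrite (indE g1 mA) (indE g1 mA') !indicE ler_nat.
case: (boolP (x \in A)) => // /set_mem/AA' Ax.
by rewrite mem_set.
Qed.

Lemma indC A : measurable A -> ind (~` A) = ind setT - ind A.
Proof.
move=> mA; apply/LfuneqP => x; rewrite -[RHS]/(ind setT x - ind A x).
rewrite (indE g1 mA) (indE g1 (measurableC mA)) (indE g1 measurableT).
by rewrite !indicE in_setT in_setC; case: (x \in A); rewrite ?subrr ?subr0.
Qed.

Lemma indU_le A B x : measurable A -> measurable B ->
  ind (A `|` B) x <= (ind A + ind B) x.
Proof.
move=> mA mB; rewrite -[leRHS]/(ind A x + ind B x).
rewrite (indE g1 mA) (indE g1 mB) (indE g1 (measurableU _ _ mA mB)) !indicE in_setU.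
by rewrite -natrD ler_nat; case: (x \in A) => //=; rewrite ltnS.
Qed.

Lemma dot_indT A : measurable A -> (dot (ind A) (ind setT))%:E = gamma A.
Proof.
move=> mA; rewrite (dot_indl g1)// (eq_integral (cst 1%E)).
  by rewrite integral_cst// mul1e.
by move=> x _; rewrite (indE g1 measurableT) indicE in_setT.
Qed.

Lemma numsg_indT t : 0 < t -> numsg t (ind setT) = ind setT.
Proof.
move=> t0; apply/LfuneqP => x; have iT : ind setT = cst 1 :> (_ -> _) := indTE g1.
by rewrite iT; have -> := mehler_cst (numsg_dom t0) iT.
Qed.

(** The probability that the stationary process leaves [A] in time [t]. *)
Definition exit_prob t A := dot (ind A) (numsg t (ind (~` A))).

Lemma exit_probE t A : 0 < t -> measurable A ->
  exit_prob t A = dot (ind A) (ind setT) - dot (ind A) (numsg t (ind A)).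
Proof.
move=> t0 mA; rewrite /exit_prob indC// -numsg_sym// dotBr !numsg_sym//.
by rewrite numsg_indT.
Qed.

Lemma exit_prob_mono s t A : 0 < s -> s <= t -> measurable A ->
  exit_prob s A <= exit_prob t A.
Proof.
move=> s0 st mA; have t0 := lt_le_trans s0 st.
rewrite (exit_probE s0 mA) (exit_probE t0 mA) lerD2l lerN2.
exact: (sgr_form_mono numsg_dot numsg_contract (ind A) s0 st).
Qed.

Lemma exit_probC t A : 0 < t -> measurable A ->
  exit_prob t (~` A) = exit_prob t A.
Proof. by move=> t0 mA; rewrite /exit_prob setCK dotC numsg_sym. Qed.

Lemma exit_probU t A B : 0 < t -> measurable A -> measurable B ->
  exit_prob t (A `|` B) <= exit_prob t A + exit_prob t B.
Proof.
move=> t0 mA mB; have mAB := measurableU _ _ mA mB; have mC := measurableC mAB.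
apply: (@le_trans _ _ (dot (ind A + ind B) (numsg t (ind (~` (A `|` B)))))).
  apply: numsg_form_le => // x; try exact: ind_ge0.
  exact: indU_le.
rewrite dotDl; apply: lerD; apply: numsg_form_le => // x; try exact: ind_ge0.
- by apply: ind_le => //; [exact: measurableC|rewrite setCU => y []].
- by apply: ind_le => //; [exact: measurableC|rewrite setCU => y []].
Qed.

Lemma exit_prob_inner t A A' : 0 < t -> measurable A -> measurable A' ->
  A' `<=` A -> exit_prob t A <= dot (ind A') (numsg t (ind (~` A))) +
    (dot (ind A) (ind setT) - dot (ind A') (ind setT)).
Proof.
move=> t0 mA mA' sA; rewrite /exit_prob -lerBlDl -!dotBl -(numsg_indT t0).
apply: numsg_form_le => // x; try exact: ind_ge0 (measurableC mA).
  rewrite -[leRHS]/(ind A x - ind A' x) subr_ge0; exact: ind_le.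
by apply: ind_le => //; exact: measurableC.
Qed.

Lemma inner_approx (F : nat -> set 'cV[R]_n) (e : R) : 0 < e ->
  (forall k, measurable (F k)) -> nondecreasing_seq F ->
  exists k, dot (ind (\bigcup_k F k)) (ind setT) - dot (ind (F k)) (ind setT) <= e.
Proof.
move=> e0 mF ndF; have mU : measurable (\bigcup_k F k) by exact: bigcupT_measurable.
have cv : (dot (ind (F k)) (ind setT))%:E @[k --> \oo] -->
    (dot (ind (\bigcup_k F k)) (ind setT))%:E.
  rewrite (dot_indT mU).
  rewrite (_ : (fun k => _) = gamma \o F); last first.
    by apply/funext => k; rewrite (dot_indT (mF k)).
  exact: nondecreasing_cvg_mu mF mU ndF.
move: cv => /fine_cvgP[_ /cvgrPdist_le/(_ _ e0)][k _ /(_ k (leqnn k))/= H].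
by exists k; exact: le_trans (ler_norm _) H.
Qed.

(** The sets that the stationary process seldom leaves in a short time.  They
  form a sigma-algebra, which reduces continuity at the origin to half-spaces. *)
Definition small_exit A := measurable A /\
  forall e, 0 < e -> exists2 t, 0 < t & exit_prob t A <= e.

Lemma small_exitU A B : small_exit A -> small_exit B -> small_exit (A `|` B).
Proof.
move=> [mA gA] [mB gB]; split=> [|e e0]; first exact: measurableU.
have e20 : 0 < e / 2 by rewrite divr_gt0.
have [s s0 sA] := gA _ e20; have [t t0 tB] := gB _ e20.
have m0 : 0 < Num.min s t by rewrite lt_min s0 t0.
exists (Num.min s t) => //; apply: (le_trans (exit_probU m0 mA mB)).
rewrite [leRHS]splitr; apply: lerD.
- by apply: le_trans sA; apply: exit_prob_mono => //; rewrite ge_min lexx.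
- by apply: le_trans tB; apply: exit_prob_mono => //; rewrite ge_min lexx orbT.
Qed.

Lemma small_exitC A : small_exit A -> small_exit (~` A).
Proof.
move=> [mA gA]; split=> [|e e0]; first exact: measurableC.
have [t t0 tA] := gA _ e0; exists t; first by [].
by rewrite (exit_probC t0 mA).
Qed.

Lemma small_exit0 : small_exit set0.
Proof.
split=> // e e0; exists 1 => //.
have i0 : ind set0 = 0 *: ind set0.
  apply/LfuneqP => x; rewrite -[RHS]/(0 * ind set0 x) mul0r.
  by rewrite (indE g1 measurable0) indicE in_set0.
by rewrite /exit_prob i0 dotZl mul0r ltW.
Qed.

(** Approximation from inside by finite unions; the monotone limit costs no
  uniformity in time, since starting in the difference has small probability. *)
Lemma small_exit_bigcup (F : nat -> set 'cV[R]_n) :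
  (forall k, small_exit (F k)) -> small_exit (\bigcup_k F k).
Proof.
move=> gF; have mF k := (gF k).1.
have mU : measurable (\bigcup_k F k) by exact: bigcupT_measurable.
split=> // e e0; have e20 : 0 < e / 2 by rewrite divr_gt0.
pose G k := \big[setU/set0]_(i < k.+1) F i.
have gG k : small_exit (G k).
  apply: (big_ind small_exit); [exact: small_exit0|exact: small_exitU|].
  by move=> i _; exact: gF.
have UG : \bigcup_k G k = \bigcup_k F k by exact: bigcup_bigsetU_bigcup.
have ndG : nondecreasing_seq G.
  by move=> a b ab; apply/subsetPset; apply: subset_bigsetU.
have [k kP] := inner_approx e20 (fun k => (gG k).1) ndG.
have [t t0 tG] := (gG k).2 _ e20; exists t => //.
have sG : G k `<=` \bigcup_k F k by rewrite -UG; exact: bigcup_sup.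
rewrite UG in kP.
apply: (le_trans (exit_prob_inner t0 mU (gG k).1 sG)).
rewrite [leRHS]splitr; apply: lerD kP; apply: le_trans tG.
apply: numsg_form_le => // x; try exact: ind_ge0 (measurableC mU).
- exact: ind_ge0 (gG k).1.
- apply: ind_le; [exact: measurableC|exact: measurableC (gG k).1|].
  exact: subsetC.
Qed.

End number_semigroup.

Section number_semigroup_continuity.
Context (R : realType) (n : nat).
Variable S : 'M[R]_n.
Hypothesis pS : posdef S.
Local Notation gamma := (gauss_measure S).
Let g1 := gauss_measureT pS.
Local Notation ind := (ind gamma).
Local Notation half i a := [set x : 'cV[R]_n | a < x i 0].

Lemma measurable_half i a : measurable (half i a).
Proof.
have := @measurable_mx_entry R n 1 i 0 measurableT `]a, +oo[%classic
  (measurable_itv _).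
rewrite setTI; congr measurable; apply/seteqP; split => x /=;
  by rewrite in_itv/= andbT.
Qed.

(** From well inside a half-space, the motion leaves it in a short time only if
  the Gaussian increment is large. *)
Lemma numsg_half_bound i a b (eta t : R) (x : 'cV[R]_n) : 0 < t -> 0 <= eta ->
  b < x i 0 -> a + eta <= expR (- t) * b ->
  numsg t (ind (~` half i a)) x <= Num.sqrt (2 ^+ n) *
    expR (- (eta ^+ 2 / (4 * ((1 - expR (- t) ^+ 2) * S i i)))).
Proof.
move=> t0 e0 bx ab; have dom := numsg_dom pS t0.
have mC := measurableC (measurable_half i a).
have EN : numsg t (ind (~` half i a)) x = _ :=
  congr1 (fun F => F x) (mehler_formula (ind (~` half i a)) dom).
rewrite {}EN (indE g1 mC) numsg_cov.
have pC : posdef ((1 - expR (- t) ^+ 2) *: S) by case: dom; rewrite numsg_cov.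
have p2C : posdef (2 *: ((1 - expR (- t) ^+ 2) *: S)) by exact: posdefZ.
set C := _ *: S in pC p2C *.
set K := Num.sqrt _ * _.
have K0 : 0 <= K by rewrite mulr_ge0 ?sqrtr_ge0 ?expR_ge0.
have CiiE : C i i = (1 - expR (- t) ^+ 2) * S i i by rewrite mxE.
pose M : 'M[R]_n := (expR (- t))%:M.
have m1 : measurable_fun setT (fun y : 'cV[R]_n =>
    (\1_(~` half i a) (M *m x - y) : R) * gauss_pdf C y).
  apply: measurable_funM; last exact: measurable_gauss_pdf.
  apply: (measurableT_comp (measurable_indic mC)).
  exact: measurable_cV_sub.
have le : (\int[lebesgue_cV n]_y
    ((\1_(~` half i a) (M *m x - y) : R) * gauss_pdf C y)%:E <= K%:E)%E.
  have mg2 := @measurable_gauss_pdf R n (2 *: C).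
  apply: (@le_trans _ _ (\int[lebesgue_cV n]_y
      (K%:E * (gauss_pdf (2 *: C) y)%:E))%E); last first.
    rewrite (ge0_integralZl_fin _ K0 mg2 (gauss_pdf_ge0 (2 *: C))).
    by rewrite (integral_gauss_pdf p2C) mule1.
  apply: ge0_le_integral => //.
  - by move=> y _; rewrite lee_fin mulr_ge0 ?gauss_pdf_ge0.
  - exact/measurable_EFinP.
  - by apply/measurable_EFinP; exact: measurable_funM.
  - move=> y _; rewrite -EFinM lee_fin indicE.
    case: (boolP (_ \in _)) => [/set_mem/= /negP|_]; last first.
      by rewrite mul0r mulr_ge0 ?gauss_pdf_ge0.
    rewrite -leNgt mul1r /M mul_scalar_mx !mxE => yi.
    rewrite /K -CiiE; apply: gauss_pdf_tail => //.
    have : expR (- t) * b < expR (- t) * x i 0 by rewrite ltr_pM2l ?expR_gt0.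
    lra.
rewrite /Rintegral -lee_fin fineK//.
rewrite ge0_fin_numE ?(le_lt_trans le) ?ltry//.
by apply: integral_ge0 => y _; rewrite lee_fin mulr_ge0 ?gauss_pdf_ge0.
Qed.

Lemma expRN_le_inv (x : R) : 0 < x -> expR (- x) <= x^-1.
Proof.
move=> x0; rewrite expRN lef_pV2 ?posrE ?expR_gt0//.
by have := expR_ge1Dx x; lra.
Qed.

(** Starting at distance [del] inside the half-space, leaving it takes a noise
  of order [del], which has small probability for a short time; starting
  closer to the boundary is itself unlikely. *)
Lemma small_exit_half i a : small_exit S (half i a).
Proof.
have mH := measurable_half i a; split=> // e e0.
pose F k : set 'cV[R]_n := half i (a + k.+1%:R^-1).
have UF : \bigcup_k F k = half i a.
  apply/seteqP; split => x /=.
    by move=> [k _]; apply: lt_trans; rewrite ltrDl invr_gt0.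
  move=> ax; have [k kP] := natr_le_exp2 (x i 0 - a)^-1.
  exists (2 ^ k)%N => //; rewrite /F/= -ltrBrDl.
  rewrite -[ltRHS]invrK ltf_pV2 ?posrE ?invr_gt0 ?subr_gt0//.
  by rewrite (le_lt_trans kP)// ltr_nat.
have ndF : nondecreasing_seq F.
  move=> k l kl; apply/subsetPset => x; rewrite /F/=; apply: le_lt_trans.
  by rewrite lerD2l lef_pV2 ?posrE// ler_nat.
have mF k : measurable (F k) by exact: measurable_half.
have e20 : 0 < e / 2 by rewrite divr_gt0.
have [k] := inner_approx pS e20 mF ndF; rewrite UF => kP.
pose del : R := k.+1%:R^-1.
have d0 : 0 < del by rewrite invr_gt0.
pose b := a + del; pose s := Num.sqrt (2 ^+ n : R).
have s0 : 0 <= s by exact: sqrtr_ge0.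
have Sii := diag_posdef_gt0 pS i.
(* short enough for the drift to cost half of the margin, and for the tail
   bound, linear in time, to be small *)
pose c := (s + 1) * (32 * S i i) / del ^+ 2.
have c0 : 0 < c by rewrite divr_gt0 ?exprn_gt0 ?mulr_gt0//; lra.
pose t := Num.min (del / 2 / (`|b| + 1)) (e / 2 / c).
have b1 : 0 < `|b| + 1 by have := normr_ge0 b; lra.
have t1 : 0 < del / 2 / (`|b| + 1) by apply: divr_gt0 => //; apply: divr_gt0.
have t2 : 0 < e / 2 / c by exact: divr_gt0.
have t0 : 0 < t by rewrite /t lt_min t1 t2.

have tb : t * (`|b| + 1) <= del / 2.
  by rewrite -ler_pdivlMr// /t ge_min lexx.
have tc : t * c <= e / 2 by rewrite -ler_pdivlMr// /t ge_min lexx orbT.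
have sub : F k `<=` half i a by rewrite -UF; exact: bigcup_sup.
exists t => //; apply: (le_trans (exit_prob_inner pS t0 mH (mF k) sub)).
rewrite [leRHS]splitr; apply: lerD kP.
have r1 : 1 - t <= expR (- t) by exact: expR_ge1Dx.
have ab : a + del / 2 <= expR (- t) * b.
  have bb : b <= `|b| := ler_norm b.
  have rb : 0 <= (1 - expR (- t)) by have := expRN_lt1 t0; lra.
  have : (1 - expR (- t)) * b <= t * (`|b| + 1).
    apply: (@le_trans _ _ ((1 - expR (- t)) * (`|b| + 1))).
      by rewrite ler_wpM2l//; lra.
    by rewrite ler_wpM2r ?(ltW b1)//; lra.
  by rewrite /b in tb *; lra.
pose q := (1 - expR (- t) ^+ 2) * S i i.
have q0 : 0 < q by rewrite mulr_gt0// subr_gt0 sqr_expRN_lt1.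
have q1 : q <= 2 * t * S i i.
  rewrite ler_wpM2r ?(ltW Sii)//.
  have := expRN_lt1 t0; have := expR_ge0 (- t); nra.
have bound x : F k x -> numsg t (ind (~` half i a)) x <= e / 2.
  move=> Fx; apply: (le_trans (numsg_half_bound t0 _ Fx ab)); first by lra.
  rewrite -/s -/q; apply: le_trans tc.
  have x0 : 0 < (del / 2) ^+ 2 / (4 * q).
    by apply: divr_gt0; [apply: exprn_gt0; exact: divr_gt0|exact: mulr_gt0].
  apply: (@le_trans _ _ (s * ((del / 2) ^+ 2 / (4 * q))^-1)).
    by rewrite ler_wpM2l// expRN_le_inv.
  rewrite (_ : s * _ = s * (16 * q) / del ^+ 2); last by field; rewrite ?gt_eqF.
  rewrite (_ : t * c = t * ((s + 1) * (32 * S i i)) / del ^+ 2); last first.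
    by rewrite /c mulrA.
  rewrite ler_wpM2r ?invr_ge0 ?exprn_ge0 ?(ltW d0)//.
  apply: (@le_trans _ _ ((s + 1) * (16 * q))).
    by apply: ler_wpM2r; [apply: mulr_ge0 => //; exact: ltW|rewrite lerDl].
  rewrite [leRHS]mulrCA ler_wpM2l//; first by rewrite addr_ge0.
  by rewrite (_ : t * _ = 16 * (2 * t * S i i)); [rewrite ler_pM2l|ring].
rewrite -lee_fin (dot_indl g1 _ (mF k)).
apply: (@le_trans _ _ (\int[gamma]_(x in F k) (cst (e / 2)%:E x))%E).
  apply: ge0_le_integral => //.
  - move=> x _; rewrite lee_fin; apply: mehler_ge0; first exact: numsg_dom.
    by move=> y; apply: ind_ge0 => //; exact: measurableC.
  - apply/measurable_EFinP; apply: measurable_funTS; exact: L2_measurable.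
rewrite integral_cst// -[leRHS]mule1 lee_wpmul2l ?lee_fin ?(ltW e20)//.
by rewrite -g1; apply: le_measure; rewrite ?inE.
Qed.

Lemma sigma_algebra_small_exit (T : Type) (f : 'cV[R]_n -> T) :
  sigma_algebra setT [set A : set T | small_exit S (f @^-1` A)].
Proof.
split => /=.
- by rewrite preimage_set0; exact: small_exit0.
- by move=> A gA; rewrite setTD preimage_setC; exact: small_exitC.
- by move=> F gF; rewrite preimage_bigcup; exact: small_exit_bigcup.
Qed.

Lemma small_exit_measurable (A : set 'cV[R]_n) : measurable A -> small_exit S A.
Proof.
have cyl i (B : set R) : measurable B -> small_exit S [set x | B (x i 0)].
  move=> mB; have : (@ocitv R).-sigma.-measurable B by [].
  rewrite RGenOInfty.measurableE; move: B {mB}.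
  apply: (smallest_sub (sigma_algebra_small_exit (fun x : 'cV[R]_n => x i 0))).
  move=> _ [a ->] /=; have := small_exit_half i a.
  congr (small_exit S); apply/seteqP; split => x /=; by rewrite in_itv/= andbT.
apply: (smallest_sub (sigma_algebra_small_exit id)) => _ [i [j [B mB ->]]] /=.
by rewrite (ord1 j); exact: cyl.
Qed.

(** Weak continuity at the origin passes from indicators to their linear
  combinations through strong continuity, and to limits because the operators
  are contractions. *)
Lemma numsg_form_cvg0 (f : L2 gamma) (e : R) : 0 < e ->
  exists2 t, 0 < t & dot f f - e <= dot f (numsg t f).
Proof.
pose V (h : L2 gamma) := forall r, 0 < r ->
  exists2 t0, 0 < t0 & forall t, 0 < t -> t <= t0 -> nrm (numsg t h - h) <= r.
have dN := @numsg_dot _ _ _ pS; have cN := @numsg_contract _ _ _ pS.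
suff Vf : V f.
  move=> e0; pose r := e / (nrm f + 1).
  have f1 : 0 < nrm f + 1 by have := nrm_ge0 f; lra.
  have [t0 t00 /(_ t0 t00 (lexx _)) le] := Vf r (divr_gt0 e0 f1).
  exists t0 => //.
  have := dot_le_nrm f (- (numsg t0 f - f)).
  rewrite nrmN opprB dotBr.
  have : nrm f * nrm (numsg t0 f - f) <= e.
    apply: (@le_trans _ _ ((nrm f + 1) * r)); last by rewrite mulrC divfK ?gt_eqF.
    by apply: ler_pM; rewrite ?nrm_ge0// lerDl.
  lra.
move: f; apply: (L2_ind g1).
- move=> A mA r r0.
  have r20 : 0 < r ^+ 2 by exact: exprn_gt0.
  have [t0 t00 le] := (small_exit_measurable mA).2 _ r20.
  exists t0 => // t tp tt0; rewrite (nrm_le _ (ltW r0)).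
  apply: le_trans le; apply: (@le_trans _ _ (exit_prob S t A)); last first.
    exact: exit_prob_mono.
  rewrite (exit_probE pS tp mA).
  have iA : dot (ind A) (ind setT) = dot (ind A) (ind A).
    apply: EFin_inj; rewrite !(dot_indl g1)//; apply: eq_integral => x xA.
    by rewrite (indE g1 mA) (indE g1 measurableT) !indicE in_setT xA.
  rewrite iA; set h := ind A.
  have := sgr_contract_compl dN cN h tp.
  by rewrite -[h - _]opprB dotNl dotNr opprK.
- move=> a f g Vf Vg r r0.
  pose rf := r / 2 / (`|a| + 1).
  have a1 : 0 < `|a| + 1 by have := normr_ge0 a; lra.
  have r20 : 0 < r / 2 by exact: divr_gt0.
  have [s s0 sf] := Vf rf (divr_gt0 r20 a1).
  have [t t0 tg] := Vg _ r20.
  exists (Num.min s t); first by rewrite lt_min s0 t0.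
  move=> u u0; rewrite le_min => /andP[us ut].
  have E : numsg u (a *: f + g) - (a *: f + g) =
      a *: (numsg u f - f) + (numsg u g - g) %[ae gamma].
    apply: ae_dotP => h; rewrite !(dotBl, dotDl, dotZl).
    have H1 k : dot (numsg u k) h = dot k (numsg u h) := numsg_sym pS k h u0.
    by rewrite (H1 (a *: f + g)) (H1 f) (H1 g) dotDl dotZl; ring.
  rewrite (nrm_ae E); apply: (le_trans (nrmD _ _)).
  rewrite nrmZ [leRHS]splitr.
  apply: lerD; last by apply: tg.
  apply: (@le_trans _ _ ((`|a| + 1) * rf)); last by rewrite mulrC divfK ?gt_eqF.
  apply: ler_pM; [exact: normr_ge0|exact: nrm_ge0|by rewrite lerDl|by apply: sf].
- move=> f cl r r0; have r30 : 0 < r / 3 by exact: divr_gt0.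
  have [g Vg fg] := cl _ r30; have [t0 t00 tg] := Vg _ r30.
  exists t0 => // t tp tt0.
  have E : numsg t f - f = numsg t (f - g) + (numsg t g - g) - (f - g)
      %[ae gamma].
    apply: ae_dotP => h; rewrite !(dotBl, dotDl).
    have H1 k : dot (numsg t k) h = dot k (numsg t h) := numsg_sym pS k h tp.
    by rewrite (H1 f) (H1 (f - g)) (H1 g) dotBl; ring.
  rewrite (nrm_ae E); apply: (le_trans (nrmD _ _)); rewrite nrmN.
  have := nrmD (numsg t (f - g)) (numsg t g - g).
  have : nrm (numsg t (f - g)) <= nrm (f - g).
    by apply: ler_wsqrtr; exact: cN.
  have := tg t tp tt0.
  move: (nrm _) (nrm _) (nrm _) (nrm _) fg => x y z w; lra.
Qed.

End number_semigroup_continuity.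

Section number_semigroup_range.
Context (R : realType) (n : nat).
Variable S : 'M[R]_n.
Hypothesis pS : posdef S.
Local Notation gamma := (gauss_measure S).

Lemma numsg_injective t (f : L2 gamma) : 0 < t ->
  numsg t f = 0 %[ae gamma] -> f = 0 %[ae gamma].
Proof.
exact: (sgr_injective (@numsg_dot _ _ _ pS) (@numsg_contract _ _ _ pS)
  (numsg_form_cvg0 pS)).
Qed.

Lemma numsg_dense t (g : L2 gamma) (e : R) : 0 < t -> 0 < e ->
  exists f, dot (numsg t f - g) (numsg t f - g) <= e.
Proof.
exact: (sgr_dense (@numsg_dot _ _ _ pS) (@numsg_contract _ _ _ pS)
  (numsg_form_cvg0 pS)).
Qed.

End number_semigroup_range.

(** * The number semigroup: spectral gap *)

Section number_semigroup_gap.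
Context (R : realType) (n : nat).
Variable S : 'M[R]_n.
Hypothesis pS : posdef S.
Local Notation gamma := (gauss_measure S).
Let g1 := gauss_measureT pS.
Local Notation one := (ind gamma setT).

Lemma gauss_pdfZ (C : 'M[R]_n) (a : R) (x : 'cV[R]_n) : posdef C -> a != 0 ->
  gauss_pdf C (a *: x) = (`|a| ^+ n)^-1 * gauss_pdf ((a ^+ 2)^-1 *: C) x.
Proof.
move=> pC a0; have a2 : 0 < a ^+ 2 by rewrite exprn_even_gt0.
have pC' : posdef ((a ^+ 2)^-1 *: C) by apply: posdefZ => //; rewrite invr_gt0.
rewrite /gauss_pdf (invmxZ (posdef_unit pC')) invrK qformZ qformZv detZ.
rewrite sqrtrM ?exprn_ge0 ?invr_ge0 ?(ltW a2)//.
have -> : Num.sqrt ((a ^+ 2)^-1 ^+ n) = (`|a| ^+ n)^-1.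
  rewrite -[a ^+ 2]real_normK ?num_real// exprVn -exprM mulnC exprM.
  by rewrite sqrtrV ?sqr_ge0// sqrtr_sqr normrX normr_id.
have an : `|a| ^+ n != 0 by rewrite expf_neq0// normr_eq0.
rewrite invfM invrK; move: an; move: (`|a| ^+ n) => b b0.
move: (_ `^ _)^-1 (Num.sqrt _)^-1 (expR _) => p q e.
by field.
Qed.

Lemma measurable_mehler_diag (r : R) :
  measurable_fun setT (fun x => mehler_kernel S S r%:M x x).
Proof.
have mker := measurable_mehler_kernel S r%:M pS.
apply: (measurableT_comp mker (g := fun x : 'cV[R]_n => (x, x))).
exact: measurable_fun_pair.
Qed.

(** The trace of the Mehler kernel, which is the square of the Hilbert-Schmidt
  norm of the operator of parameter [Num.sqrt r]. *)
Lemma integral_mehler_diag (r : R) : 0 <= r < 1 ->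
  (\int[gamma]_x (mehler_kernel S S (r%:M) x x)%:E = ((1 - r) ^+ n)^-1%:E)%E.
Proof.
move=> /andP[r0 r1]; have r2 : r ^+ 2 < 1 by rewrite expr_lt1.
have r20 : 0 < 1 - r ^+ 2 by rewrite subr_gt0.
have pC : posdef (S - r%:M *m S *m r%:M^T).
  by rewrite numsg_cov; exact: posdefZ.
set C := S - _ in pC *.
have a0 : r - 1 != 0 by rewrite subr_eq0 lt_eqF.
have a2 : 0 < ((r - 1) ^+ 2)^-1 by rewrite invr_gt0 exprn_even_gt0.
have b0 : 0 <= ((1 - r) ^+ n)^-1 by rewrite invr_ge0 exprn_ge0// subr_ge0 ltW.
have mk := measurable_mehler_diag r.
rewrite ge0_integral_gauss//; last by move=> x; exact: mehler_kernel_ge0.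
transitivity (\int[lebesgue_cV n]_x (((1 - r) ^+ n)^-1%:E *
    (gauss_pdf (((r - 1) ^+ 2)^-1 *: C) x)%:E))%E.
  apply: eq_integral => x _; rewrite mehler_kernel_cancel// -/C -EFinM; congr EFin.
  rewrite mul_scalar_mx -[X in _ *: _ - X]scale1r -scalerBl gauss_pdfZ//.
  by rewrite ler0_norm ?opprB// subr_le0 ltW.
rewrite (ge0_integralZl_fin _ b0 (measurable_gauss_pdf _) (gauss_pdf_ge0 _)).
by rewrite integral_gauss_pdf ?mule1//; exact: posdefZ.
Qed.

(** Bernoulli's inequality for [1 - x]. *)
Lemma one_subX_ge (x : R) m : 0 <= x <= 1 -> 1 - m%:R * x <= (1 - x) ^+ m.
Proof.
move=> /andP[x0 x1]; elim: m => [|m IH]; first by rewrite mul0r subr0 expr0.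
rewrite exprS -natr1.
apply: (@le_trans _ _ ((1 - x) * (1 - m%:R * x))); last first.
  by rewrite ler_wpM2l// subr_ge0.
rewrite -subr_ge0 (_ : _ - _ = m%:R * x ^+ 2); last by ring.
by rewrite mulr_ge0 ?sqr_ge0.
Qed.

Lemma dot_oneone : dot one one = 1.
Proof. by apply: EFin_inj; rewrite dot_indT. Qed.

(** Cauchy-Schwarz against the kernel minus one, by the mean-zero condition. *)
Lemma numsg_pointwise (g : L2 gamma) t x : 0 < t -> dot g one = 0 ->
  numsg t g x ^+ 2 <=
  dot g g * (mehler_kernel S S (expR (- t) ^+ 2)%:M x x - 1).
Proof.
move=> t0 g0; have dom := numsg_dom pS t0.
set M : 'M[R]_n := (expR (- t))%:M.
have MM : M *m M = (expR (- t) ^+ 2)%:M by rewrite -scalar_mxM expr2.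
have k2 : (\int[gamma]_z (mehler_kernel S S M x z ^+ 2)%:E =
    (mehler_kernel S S (expR (- t) ^+ 2)%:M x x)%:E)%E.
  rewrite -MM -(mehler_kernel_comp x x dom dom); apply: eq_integral => z _.
  rewrite expr2; congr (_ * _)%:E.
  exact: (mehler_kernel_sym _ _ dom (numsg_comm _ _)).
have mk := measurable_mehler_kernel1 S M x pS.
have kL : mehler_kernel S S M x \in Lfun gamma 2 by rewrite Lfun2P// k2 ltry.
pose k := mkL2 gamma (mehler_kernel S S M x).
have kE : k = mehler_kernel S S M x :> (_ -> _) := mkL2E kL.
have kk : dot k k = mehler_kernel S S (expR (- t) ^+ 2)%:M x x.
  apply: EFin_inj; rewrite EFin_dot -k2 kE; apply: eq_integral => z _.
  by rewrite expr2.
have k1 : dot k one = 1.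
  apply: EFin_inj; rewrite EFin_dot -(integral_mehler_kernel x dom) kE (indTE g1).
  by apply: eq_integral => z _; rewrite mulr1.
have -> : numsg t g x = dot g (k - one).
  rewrite dotBr g0 subr0.
  apply: (etrans (congr1 (fun F => F x) (mehlerE g dom))).
  by apply: eq_Rintegral => z _; rewrite kE.
apply: (le_trans (dot_cauchy_schwarz _ _)).
rewrite ler_wpM2l ?dot_ge0// !dotE (dotC one) kk k1 dot_oneone; lra.
Qed.

Lemma numsg_hilbert_schmidt (g : L2 gamma) t : 0 < t -> dot g one = 0 ->
  dot (numsg t g) (numsg t g) <=
  dot g g * (((1 - expR (- t) ^+ 2) ^+ n)^-1 - 1).
Proof.
move=> t0 g0; set r := expR (- t) ^+ 2.
have r1 : r < 1 := sqr_expRN_lt1 t0.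
have r0 : 0 <= r by rewrite sqr_ge0.
have mk := measurable_mehler_diag r.
have tr := integral_mehler_diag (_ : 0 <= r < 1).
rewrite r0 r1 in tr; have {}tr := tr isT.
have gg0 := dot_ge0 g.
have le : (\int[gamma]_x (numsg t g x * numsg t g x + dot g g * 1)%:E <=
    \int[gamma]_x (dot g g * mehler_kernel S S r%:M x x)%:E)%E.
  apply: ge0_le_integral => //.
  - by move=> x _; rewrite lee_fin addr_ge0 ?mulr1// -expr2 sqr_ge0.
  - apply/measurable_EFinP; apply: measurable_funD => //.
    by apply: measurable_funM; exact: L2_measurable.
  - by apply/measurable_EFinP; apply: measurable_funM.
  - move=> x _; rewrite lee_fin -expr2.
    by have := numsg_pointwise x t0 g0; rewrite -/r; lra.
have E1 : (\int[gamma]_x (numsg t g x * numsg t g x + dot g g * 1)%:E =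
    (dot (numsg t g) (numsg t g) + dot g g)%:E)%E.
  under eq_integral do rewrite EFinD.
  rewrite ge0_integralD//.
  - rewrite -EFin_dot EFinD; congr (_ + _)%E.
    rewrite (eq_integral (cst (dot g g)%:E)); last by move=> x _; rewrite mulr1.
    by rewrite integral_cst// -[RHS]mule1; congr (_ * _)%E; exact: g1.
  - by move=> x _; rewrite lee_fin -expr2 sqr_ge0.
  - by apply/measurable_EFinP; apply: measurable_funM; exact: L2_measurable.
  - by move=> x _; rewrite lee_fin mulr1.
have E2 : (\int[gamma]_x (dot g g * mehler_kernel S S r%:M x x)%:E =
    (dot g g * ((1 - r) ^+ n)^-1)%:E)%E.
  under eq_integral do rewrite EFinM.
  rewrite (ge0_integralZl_fin _ gg0 mk); first by rewrite tr.
  by move=> x; exact: mehler_kernel_ge0.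
by move: le; rewrite E1 E2 lee_fin; lra.
Qed.

(** The spectral gap: the Hilbert-Schmidt norm decays at the right exponential
  rate, and log-convexity removes the constant. *)
Lemma numsg_gap (g : L2 gamma) t : 0 < t -> dot g one = 0 ->
  dot (numsg t g) (numsg t g) <= expR (- t) ^+ 2 * dot g g.
Proof.
move=> t0 g0.
apply: (@sgr_decay _ _ _ _ _ (@numsg_dot _ _ _ pS) (@numsg_contract _ _ _ pS) g
  (Num.sqrt (2 * n%:R) * dot g g) (n%:R + 1)) => // {t0} {}t tn.
have n0 : 0 <= n%:R :> R by [].
have t0 : 0 < t by lra.
set r := expR (- t).
have r0 : 0 <= r := expR_ge0 _.
have nr : n%:R * r ^+ 2 <= 2^-1.
  have : r ^+ 2 <= (2 * t)^-1.
    by rewrite /r -expRM_natl mulrN; apply: expRN_le_inv; rewrite mulr_gt0.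
  move=> rt; apply: (@le_trans _ _ (n%:R * (2 * t)^-1)); first by rewrite ler_wpM2l.
  rewrite invfM mulrCA ger_pMr// ler_pdivrMr// mul1r; lra.
have rr1 : r ^+ 2 < 1 := sqr_expRN_lt1 t0.
have inv : ((1 - r ^+ 2) ^+ n)^-1 - 1 <= 2 * n%:R * r ^+ 2.
  have le1 : 1 - n%:R * r ^+ 2 <= (1 - r ^+ 2) ^+ n.
    by apply: one_subX_ge; rewrite sqr_ge0 ltW.
  set y := n%:R * r ^+ 2 in nr le1 *.
  have y0 : 0 <= y by rewrite mulr_ge0 ?sqr_ge0.
  have p0 : 0 < 1 - y by lra.
  have : ((1 - r ^+ 2) ^+ n)^-1 <= (1 - y)^-1.
    by rewrite lef_pV2 ?posrE// (lt_le_trans p0).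
  have : (1 - y)^-1 <= 1 + 2 * y.
    by rewrite -[leLHS]mul1r ler_pdivrMr//; nra.
  by rewrite -mulrA -/y; lra.
apply: (le_trans (dot_le_nrm _ _)).
have H : nrm (numsg t g) <= Num.sqrt (2 * n%:R) * r * nrm g.
  have s0 : 0 <= Num.sqrt (2 * n%:R) * r * nrm g.
    by rewrite !mulr_ge0 ?sqrtr_ge0 ?nrm_ge0.
  rewrite (nrm_le _ s0) !exprMn sqr_sqrtr ?mulr_ge0// sqr_nrm mulrC.
  apply: (le_trans (numsg_hilbert_schmidt t0 g0)).
  by rewrite ler_wpM2l ?dot_ge0.
apply: (@le_trans _ _ (nrm g * (Num.sqrt (2 * n%:R) * r * nrm g))).
  by rewrite ler_wpM2l ?nrm_ge0.
by rewrite -sqr_nrm le_eqVlt; apply/orP; left; apply/eqP; ring.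
Qed.

End number_semigroup_gap.

(** * Mehler operators of invertible matrices *)

Section mehler_range.
Context (R : realType) (n : nat).
Implicit Types (S A M : 'M[R]_n).

Lemma sqr_entries_le A (x : 'cV[R]_n) : posdef A ->
  \sum_i x i 0 ^+ 2 <= \tr (invmx A) * qform A x.
Proof.
move=> pA; rewrite /mxtrace mulr_suml; apply: ler_sum => i _.
have := entry_le_qform_inv (posdef_inv pA) x i.
by rewrite invmxK.
Qed.

Lemma qform_le_entries S (x : 'cV[R]_n) :
  qform S x <= (\sum_i \sum_j `|S j i|) * \sum_i x i 0 ^+ 2.
Proof.
set q := \sum_i x i 0 ^+ 2.
have xq i : `|x i 0| ^+ 2 <= q.
  rewrite real_normK ?num_real// /q (bigD1 i)//= lerDl sumr_ge0// => j _.
  exact: sqr_ge0.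
rewrite /qform mxE mulr_suml; apply: ler_sum => i _.
rewrite mxE !mulr_suml; apply: ler_sum => j _.
rewrite mxE; apply: (le_trans (ler_norm _)).
rewrite !normrM (mulrC `|x j 0|) -mulrA ler_wpM2l//.
have := xq i; have := xq j; have := sqr_ge0 (`|x i 0| - `|x j 0|).
nra.
Qed.

Lemma qform_dominated S A : posdef A ->
  exists2 K, 0 < K & forall x, qform S x <= K * qform A x.
Proof.
move=> pA; pose s := \sum_i \sum_j `|S j i|; pose a := \tr (invmx A).
have s0 : 0 <= s by rewrite sumr_ge0// => i _; rewrite sumr_ge0.
have a0 : 0 <= a.
  by apply: sumr_ge0 => i _; exact/ltW/diag_posdef_gt0/posdef_inv.
exists (s * a + 1); first by rewrite ltr_wpDl ?mulr_ge0.
move=> x; apply: (le_trans (qform_le_entries S x)).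
apply: (@le_trans _ _ (s * (a * qform A x))).
  by rewrite ler_wpM2l// sqr_entries_le.
by rewrite mulrDl mul1r mulrA lerDl posdef_ge0.
Qed.

(** A small enough dilation of [invmx M] is the matrix of a transition in the
  opposite direction; composed with the transition of [M], in either order, it
  gives the number semigroup, which is injective and has dense range. *)
Lemma mehler_dom_back S1 S2 M : mehler_dom S1 S2 M -> M \in unitmx ->
  exists2 t, 0 < t & mehler_dom S2 S1 (expR (- t) *: invmx M).
Proof.
move=> [p1 p2 _] Mu.
have [K K0 KP] := qform_dominated (invmx M *m S1 *m (invmx M)^T) p2.
exists (`|ln K| + 1); first by have := normr_ge0 (ln K); lra.
set t := _ + 1; split=> //; split.
  rewrite linearB/= p2.1; congr (_ - _).
  by rewrite !trmx_mul trmxK p1.1 mulmxA.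
move=> x x0; rewrite linearZ/= -!scalemxAl -scalemxAr scalerA qformB qformZ subr_gt0.
have q0 := p2.2 _ x0.
have e1 : expR (- t) * expR (- t) * K < 1.
  rewrite -[K in _ * K]lnK ?posrE// -!expRD -expR0 ltr_expR /t.
  by have := ler_norm (ln K); have := normr_ge0 (ln K); lra.
apply: (@le_lt_trans _ _ (expR (- t) * expR (- t) * (K * qform S2 x))).
  by rewrite ler_wpM2l ?mulr_ge0 ?expR_ge0// KP.
by rewrite mulrA -[ltRHS]mul1r ltr_pM2r.
Qed.

Lemma mehler_injective S1 S2 M (f : L2 (gauss_measure S1)) :
  mehler_dom S1 S2 M -> M \in unitmx ->
  mehler S2 M f = 0 %[ae gauss_measure S2] -> f = 0 %[ae gauss_measure S1].
Proof.
move=> dom Mu Mf0; have [t t0 dom'] := mehler_dom_back dom Mu.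
have [p1 p2 _] := dom.
have comp := mehler_comp f dom' dom.
rewrite -scalemxAr mulmxV// scalemx1 in comp.
apply: (numsg_injective p1 t0); apply: dot_eq0.
rewrite -[numsg t f]/(mehler S1 (expR (- t))%:M f).
set h := mehler S1 (expR (- t))%:M f in comp *.
have hu := etrans (dot_ae _ comp) (dot_aer h comp).
rewrite -hu; apply/eqP; rewrite eq_le dot_ge0 andbT.
apply: (le_trans (mehler_contract _ dom')).
by rewrite (dot_ae0 Mf0).
Qed.

Lemma mehler_dense S1 S2 M (g : L2 (gauss_measure S2)) (e : R) :
  mehler_dom S1 S2 M -> M \in unitmx -> 0 < e ->
  exists f : L2 (gauss_measure S1), nrm (mehler S2 M f - g) <= e.
Proof.
move=> dom Mu e0; have [t t0 dom'] := mehler_dom_back dom Mu.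
have [p1 p2 _] := dom.
have e20 : 0 < e ^+ 2 by exact: exprn_gt0.
have [h hP] := numsg_dense p2 g t0 e20.
exists (mehler S1 (expR (- t) *: invmx M) h).
have comp := mehler_comp h dom dom'.
rewrite -scalemxAl mulVmx// scalemx1 in comp.
rewrite (nrm_le _ (ltW e0)); apply: le_trans hP.
rewrite -[numsg t h]/(mehler S2 (expR (- t))%:M h).
set u := mehler S2 M _ in comp *; set v := mehler S2 _ _ in comp *.
clearbody u v.
have E k : dot (u - g) k = dot (v - g) k.
  by rewrite (dotBl u g k) (dotBl v g k) (dot_ae k comp).
by rewrite (E (u - g)) (dotC (v - g)) (E (v - g)).
Qed.

End mehler_range.

(** * Exponentials with distinct rates *)

Section exponential_integrals.
Context (R : realType).
Local Notation leb := (@lebesgue_measure R).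

Lemma measurable_expRNM (m : R) (D : set R) :
  measurable_fun D (fun s : R => expR (- s * m)).
Proof.
apply: measurable_funTS; apply: measurableT_comp => //.
by apply: measurable_funM => //; exact: measurableT_comp.
Qed.

Lemma integral_expRNM_fin (m t : R) : 0 < m -> 0 < t ->
  (\int[leb]_(s in `[0%R, t]) (expR (- s * m))%:E
   = ((1 - expR (- t * m)) / m)%:E)%E.
Proof.
move=> m0 t0; have m1 : m != 0 by rewrite gt_eqF.
have := exponential_prob_itv0c m t0; rewrite /exponential_prob.
have -> : (\int[leb]_(s in `[0%R, t]) (exponential_pdf m s)%:E =
    \int[leb]_(s in `[0%R, t]) (m%:E * (expR (- s * m))%:E))%E.
  apply: eq_integral => s; rewrite inE/= in_itv/= => /andP[s0 _].
  by rewrite exponential_pdfE// -EFinM; congr (_ * expR _)%:E; ring.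
rewrite ge0_integralZl//.
- move=> H; apply: (@eq_trans _ _ ((m^-1)%:E * (1 - (expR (- m * t))%:E)))%E.
    by rewrite -H muleA -EFinM mulVf// mul1e.
  by rewrite -EFinB -EFinM; congr EFin; rewrite mulrC !mulNr (mulrC m).
- by apply/measurable_EFinP; exact: measurable_expRNM.
- by rewrite lee_fin ltW.
Qed.

Lemma integral_expRNM_oo (m : R) : 0 < m ->
  (\int[leb]_(s in `[0%R, +oo[) (expR (- s * m))%:E = (m^-1)%:E)%E.
Proof.
move=> m0; have m1 : m != 0 by rewrite gt_eqF.
have := integral_exponential_pdf m0.
have -> : (\int[leb]_s (exponential_pdf m s)%:E =
    \int[leb]_(s in `[0%R, +oo[) (m%:E * (expR (- s * m))%:E))%E.
  rewrite [RHS]integral_mkcond; apply: eq_integral => s _ /=.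
  rewrite /exponential_pdf !patchE; case: ifPn => // _.
  by rewrite -EFinM; congr (_ * expR _)%:E; ring.
rewrite ge0_integralZl//.
- move=> H; apply: (@eq_trans _ _ ((m^-1)%:E * 1))%E; last by rewrite mule1.
  by rewrite -H muleA -EFinM mulVf// mul1e.
- by apply/measurable_EFinP; exact: measurable_expRNM.
- by rewrite lee_fin ltW.
Qed.

Lemma Rintegral_lincomb d (T : measurableType d) (mu : {measure set T -> \bar R})
    (D : set T) (I : Type) (r : seq I) (c : I -> R) (f : I -> T -> R) :
  measurable D -> (forall i, mu.-integrable D (EFin \o f i)) ->
  mu.-integrable D (EFin \o (fun s => \sum_(i <- r) c i * f i s)) /\
  \int[mu]_(s in D) (\sum_(i <- r) c i * f i s) =
  \sum_(i <- r) c i * \int[mu]_(s in D) f i s.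
Proof.
move=> mD fi; elim: r => [|i r [IHi IH]].
  have E0 : (fun s => \sum_(i <- [::]) c i * f i s) = cst 0.
    by apply/funext => s; rewrite big_nil.
  rewrite E0 big_nil; split; first exact: integrable0.
  by rewrite Rintegral_cst// mul0r.
have ci : mu.-integrable D (EFin \o (fun s => c i * f i s)).
  exact: (integrableZl mD (c i) (fi i)).
have E : (fun s => \sum_(j <- i :: r) c j * f j s) =
    (fun s => c i * f i s + \sum_(j <- r) c j * f j s).
  by apply/funext => s; rewrite big_cons.
rewrite {}E; split; first exact: (integrableD mD ci IHi).
by rewrite RintegralD// IH RintegralZl// big_cons.
Qed.

(** Exponentials with distinct rates are linearly independent: on an arithmetic
  progression they are geometric sequences, and a polynomial vanishing at all
  the ratios but one isolates a single rate. *)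
Lemma exp_independent (I : finType) (w mu : I -> R) (t : R) : 0 < t ->
  (forall s, 0 <= s <= t -> \sum_i w i * (1 - expR (- s * mu i)) = 0) ->
  forall m, m != 0 -> \sum_(i | mu i == m) w i = 0.
Proof.
move=> t0 H m m0; pose N := #|I|.+1; pose h := t / N%:R.
have N0 : 0 < N%:R :> R by rewrite ltr0n.
have h0 : 0 < h by rewrite divr_gt0.
pose z i := expR (- (h * mu i)); pose zm := expR (- (h * m)).
have zE i : (z i == zm) = (mu i == m).
  apply/eqP/eqP => [/expR_inj/oppr_inj/(mulfI (lt0r_neq0 h0))//|im].
  by rewrite /z im.
have zm1 : zm != 1.
  rewrite -expR0; apply: contra m0 => /eqP/expR_inj/eqP.
  by rewrite oppr_eq0 mulf_eq0 (gt_eqF h0).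
pose rs := 1 :: [seq z i | i <- [seq i <- enum I | mu i != m]].
pose P : {poly R} := \prod_(x <- rs) ('X - x%:P).
have sP : (size P <= N.+1)%N.
  rewrite size_prod_XsubC /= size_map size_filter !ltnS.
  by rewrite (leq_trans (count_size _ _))// -cardE.
have P1 : P.[1] = 0.
  by apply/eqP; rewrite -[_ == _]/(root P 1) root_prod_XsubC mem_head.
have Pz i : mu i != m -> P.[z i] = 0.
  move=> im; apply/eqP; rewrite -[_ == _]/(root P (z i)) root_prod_XsubC in_cons.
  by rewrite map_f ?orbT// mem_filter im mem_enum.
have Pm : P.[zm] != 0.
  rewrite -[_ == 0]/(root P zm) root_prod_XsubC in_cons (negbTE zm1)/=.
  apply/mapP => -[k]; rewrite mem_filter => /andP[km _] /esym/eqP.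
  by rewrite zE (negbTE km).
have : \sum_i w i * (P.[1] - P.[z i]) = 0.
  transitivity (\sum_i \sum_(k < size P) P`_k * (w i * (1 - z i ^+ k))).
    apply: eq_bigr => i _; rewrite !horner_coef -sumrB mulr_sumr.
    by apply: eq_bigr => k _; rewrite expr1n; ring.
  rewrite exchange_big/= big1// => k _; rewrite -mulr_sumr.
  rewrite (_ : \sum_i _ = 0) ?mulr0//.
  rewrite -[RHS](H (k%:R * h)); last first.
    rewrite mulr_ge0 ?(ltW h0)//= /h mulrCA ger_pMr// ler_pdivrMr// mul1r ler_nat.
    by rewrite -ltnS (leq_trans (ltn_ord k)).
  apply: eq_bigr => i _; congr (_ * (_ - _)).
  by rewrite /z -expRM_natl; congr expR; ring.
rewrite (bigID (fun i => mu i == m))/= [X in _ + X]big1 ?addr0; last first.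
  by move=> i im; rewrite P1 Pz// subrr mulr0.
under eq_bigr => i im do rewrite P1 sub0r (eqP (etrans (zE i) im)).
rewrite -mulr_suml => /eqP; rewrite mulf_eq0 oppr_eq0 (negbTE Pm) orbF.
by move=> /eqP.
Qed.

End exponential_integrals.

(** * Covariances of a diagonalizable drift *)

Section matrix_exponential.
Context (R : realType) (n : nat).
Implicit Types (A V : 'M[R]_n) (d : 'rV[R]_n).

Lemma cvg_mx_entries (u : nat -> 'M[R]_n) (L : 'M[R]_n) :
  (forall i j, (fun k => u k i j) @ \oo --> L i j) -> u @ \oo --> L.
Proof.
move=> uL; apply/cvgrPdist_le => e e0.
have : \forall k \near \oo, forall p : 'I_n * 'I_n,
    `|L p.1 p.2 - u k p.1 p.2| <= e.
  apply: filter_forall => -[i j] /=.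
  by have /cvgrPdist_le/(_ e e0) := uL i j.
apply: filterS => k H.
rewrite [X in X <= _]mx_normrE; apply/bigmax_leP; split; first exact: ltW.
by move=> p _; rewrite !mxE; exact: H.
Qed.

Lemma cvg_sumr (I : Type) (r : seq I) (u : I -> nat -> R) (l : I -> R) :
  (forall i, u i @ \oo --> l i) ->
  (fun k => \sum_(i <- r) u i k) @ \oo --> \sum_(i <- r) l i.
Proof.
move=> ul; elim: r => [|i r IH].
  rewrite big_nil (_ : (fun k => _) = cst 0); first exact: cvg_cst.
  by apply/funext => k; rewrite big_nil.
rewrite big_cons (_ : (fun k => _) =
  (fun k => u i k + \sum_(j <- r) u j k)); first exact: cvgD.
by apply/funext => k; rewrite big_cons.
Qed.

(** The matrices that are diagonal in the basis in which the drift is. *)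
Definition diag_conj V d : 'M[R]_n := invmx V *m diag_mx d *m V.

Lemma diag_conjE V d i j :
  diag_conj V d i j = \sum_k invmx V i k * d 0 k * V k j.
Proof.
rewrite mxE; apply: eq_bigr => k _; congr (_ * _).
rewrite mxE (bigD1 k)//= big1 ?addr0 => [|l lk].
  by rewrite mxE eqxx mulr1n.
by rewrite mxE (negbTE lk) mulr0n mulr0.
Qed.

Lemma diag_conjM V d d' : V \in unitmx ->
  diag_conj V d *m diag_conj V d' = diag_conj V (\row_k (d 0 k * d' 0 k)).
Proof.
move=> Vu; rewrite /diag_conj !mulmxA mulmxK// -(mulmxA (invmx V) (diag_mx d)).
congr (_ *m _ *m _); apply/matrixP => i j; rewrite mul_diag_mx !mxE.
by case: eqP => [->|]; rewrite ?mulr1n// !mulr0n mulr0.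
Qed.

Lemma diag_conjX V d k : V \in unitmx ->
  (diag_conj V d) ^+ k = diag_conj V (\row_i (d 0 i ^+ k)).
Proof.
move=> Vu; elim: k => [|k IH].
  rewrite expr0 -[LHS]/(1%:M) -(mulVmx Vu) /diag_conj; congr (_ *m _).
  rewrite -[LHS]mulmx1; congr (_ *m _).
  by apply/matrixP => i j; rewrite !mxE expr0.
rewrite exprS IH -[LHS]/(_ *m _) diag_conjM//; congr diag_conj.
by apply/rowP => i; rewrite !mxE exprS.
Qed.

Lemma expmx_diag_conj V d : V \in unitmx ->
  expmx (diag_conj V d) = diag_conj V (\row_i expR (d 0 i)).
Proof.
move=> Vu; apply: cvg_lim; first exact: norm_hausdorff.
apply: cvg_mx_entries => i j; rewrite diag_conjE.
rewrite (_ : (fun k => _) = (fun N => \sum_l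
  (invmx V i l * series (exp_coeff (d 0 l)) N * V l j))).
  apply: cvg_sumr => l; rewrite mxE; apply: cvgM; last exact: cvg_cst.
  apply: cvgM; first exact: cvg_cst.
  exact: is_cvg_series_exp_coeff.
apply/funext => N; rewrite /series /= summxE.
transitivity (\sum_(0 <= k < N) \sum_l
    invmx V i l * exp_coeff (d 0 l) k * V l j).
  apply: eq_bigr => k _; rewrite diag_conjX// [LHS]mxE diag_conjE mulr_sumr.
  by apply: eq_bigr => l _; rewrite mxE exp_coeffE; ring.
rewrite exchange_big/=; apply: eq_bigr => l _.
by rewrite mulr_sumr mulr_suml.
Qed.

End matrix_exponential.

Section diagonalizable_drift.
Context (R : realType) (n : nat).
Variables (Q V : 'M[R]_n) (lam : 'rV[R]_n).
Hypothesis Vu : V \in unitmx.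
Hypothesis lam0 : forall i, 0 < lam 0 i.
Hypothesis psdQ : positive_semidefinite Q.
Let B := diag_conj V lam.
Let W := invmx V.
Let Qh := V *m Q *m V^T.
Let mu (p : 'I_n * 'I_n) : R := lam 0 p.1 + lam 0 p.2.

Let mu0 p : 0 < mu p. Proof. by rewrite addr_gt0. Qed.

(** The exponential of [- t] times the drift. *)
Definition flow (t : R) : 'M[R]_n := diag_conj V (\row_i expR (- t * lam 0 i)).

Lemma scale_diag_conj (U : 'M[R]_n) a d :
  a *: diag_conj U d = diag_conj U (a *: d).
Proof.
apply/matrixP => i j; rewrite mxE !diag_conjE mulr_sumr.
by apply: eq_bigr => k _; rewrite !mxE; ring.
Qed.

Lemma expmx_drift t : expmx ((- t) *: B) = flow t.
Proof.
have -> : (- t) *: B = diag_conj V ((- t) *: lam).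
  exact: scale_diag_conj.
by rewrite expmx_diag_conj//; congr diag_conj; apply/rowP => i; rewrite !mxE.
Qed.

Lemma tr_diag_conj d : (diag_conj V d)^T = diag_conj (invmx V^T) d.
Proof.
by rewrite /diag_conj !trmx_mul tr_diag_mx trmx_inv invmxK mulmxA.
Qed.

Lemma expmx_drift_tr t : expmx ((- t) *: B^T) = (flow t)^T.
Proof.
have Vtu : invmx V^T \in unitmx by rewrite unitmx_inv unitmx_tr.
have -> : (- t) *: B^T = diag_conj (invmx V^T) ((- t) *: lam).
  by rewrite /B tr_diag_conj scale_diag_conj.
rewrite expmx_diag_conj// /flow tr_diag_conj; congr diag_conj.
by apply/rowP => i; rewrite !mxE.
Qed.

(** In the eigenbasis of the drift, the covariances are the Hadamard products of
  the matrix of [Q] with a function of the sums of two eigenvalues. *)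
Definition cov_of (k : R -> R) : 'M[R]_n :=
  W *m (\matrix_(a, b) (Qh a b * k (lam 0 a + lam 0 b))) *m W^T.

Lemma cov_ofE k i j : cov_of k i j =
  \sum_p (W i p.1 * W j p.2 * Qh p.1 p.2) * k (mu p).
Proof.
rewrite mxE -(pair_bigA _ (fun a b =>
  W i a * W j b * Qh a b * k (lam 0 a + lam 0 b)))/= exchange_big/=.
apply: eq_bigr => b _; rewrite mxE mulr_suml; apply: eq_bigr => a _.
by rewrite !mxE; ring.
Qed.

Lemma qform_cov_of k x : qform (cov_of k) x =
  \sum_p ((W^T *m x) p.1 0 * (W^T *m x) p.2 0 * Qh p.1 p.2) * k (mu p).
Proof.
rewrite /cov_of -{1}(trmxK W) qform_congr qform_pairE.
by apply: eq_bigr => p _; rewrite [X in _ * X]mxE mulrA.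
Qed.

Lemma flow_cov_of t k :
  flow t *m cov_of k *m (flow t)^T = cov_of (fun m => expR (- t * m) * k m).
Proof.
rewrite /flow /cov_of tr_diag_conj /diag_conj -/W invmxK trmx_inv.
rewrite -trmx_inv -/W !mulmxA.
rewrite -(mulmxA _ V W) mulmxV// mulmx1.
rewrite -(mulmxA _ W^T V^T) -trmx_mul mulmxV// trmx1 mulmx1.
congr (_ *m _); rewrite -!mulmxA; congr (_ *m _).
rewrite mulmxA; apply/matrixP => a b.
rewrite mul_mx_diag mul_diag_mx !mxE.
by rewrite (_ : - t * (_ + _) = - t * lam 0 a + - t * lam 0 b) ?expRD; ring.
Qed.

Lemma cov_integrandE s : cov_mx_integrand Q B s = cov_of (fun m => expR (- s * m)).
Proof.
rewrite /cov_mx_integrand expmx_drift expmx_drift_tr.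
have -> : Q = cov_of (fun=> 1).
  rewrite /cov_of (_ : \matrix_(a, b) _ = Qh); last first.
    by apply/matrixP => a b; rewrite mxE mulr1.
  by rewrite /Qh !mulmxA mulVmx// mul1mx -mulmxA -trmx_mul mulVmx// trmx1 mulmx1.
rewrite flow_cov_of; congr cov_of.
by apply/funext => m; rewrite mulr1.
Qed.

Section covariance_integral.
Variables (D : set R) (k : R -> R).
Hypothesis mD : measurable D.
Hypothesis kE : forall m, 0 < m ->
  (\int[@lebesgue_measure R]_(s in D) (expR (- s * m))%:E = (k m)%:E)%E.

Let iD m : 0 < m ->
  (@lebesgue_measure R).-integrable D (EFin \o (fun s => expR (- s * m))).
Proof.
move=> m0; apply/integrableP; split.
  by apply/measurable_EFinP; exact: measurable_expRNM.
under eq_integral do rewrite /= ger0_norm ?expR_ge0//.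
by rewrite kE// ltry.
Qed.

Lemma integral_lincomb_exp (c : 'I_n * 'I_n -> R) :
  (\int[@lebesgue_measure R]_(s in D) (\sum_p c p * expR (- s * mu p))%:E =
   (\sum_p c p * k (mu p))%:E)%E.
Proof.
have [ii EE] := @Rintegral_lincomb _ _ _ (@lebesgue_measure R) D _ (index_enum _)
  c (fun p s => expR (- s * mu p)) mD (fun p => iD (mu0 p)).
rewrite -[LHS]fineK ?integrable_fin_num//; congr EFin.
rewrite [LHS]EE; apply: eq_bigr => p _; congr (_ * _).
by rewrite /Rintegral kE.
Qed.

Lemma cov_integral i j : \int[@lebesgue_measure R]_(s in D)
  cov_mx_integrand Q B s i j = cov_of k i j.
Proof.
rewrite cov_ofE /Rintegral; apply: EFin_inj; rewrite -integral_lincomb_exp.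
rewrite fineK.
  by apply: eq_integral => s _; rewrite cov_integrandE cov_ofE.
rewrite (_ : integral _ _ _ = (\sum_p (W i p.1 * W j p.2 * Qh p.1 p.2) * k (mu p))%:E)//.
rewrite -integral_lincomb_exp.
by apply: eq_integral => s _; rewrite cov_integrandE cov_ofE.
Qed.

Lemma qform_cov_integral x : (qform (cov_of k) x)%:E =
  (\int[@lebesgue_measure R]_(s in D) (qform (cov_mx_integrand Q B s) x)%:E)%E.
Proof.
rewrite qform_cov_of -integral_lincomb_exp; apply: eq_integral => s _.
by rewrite cov_integrandE qform_cov_of.
Qed.

End covariance_integral.

Definition fin_rate (t m : R) := (1 - expR (- t * m)) / m.

Lemma cov_mxE t : 0 < t -> cov_mx Q B t = cov_of (fin_rate t).
Proof.
move=> t0; apply/matrixP => i j; rewrite mxE.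
by apply: cov_integral => // m m0; exact: integral_expRNM_fin.
Qed.

Lemma cov_mx_ooE : cov_mx_oo Q B = cov_of (@GRing.inv R).
Proof.
apply/matrixP => i j; rewrite mxE.
by apply: cov_integral => // m m0; exact: integral_expRNM_oo.
Qed.

(** The stationary covariance is the flow of itself plus the noise accumulated
  up to time [t]. *)
Lemma cov_mx_flow t : 0 < t ->
  cov_mx Q B t = cov_mx_oo Q B - flow t *m cov_mx_oo Q B *m (flow t)^T.
Proof.
move=> t0; rewrite cov_mxE// cov_mx_ooE flow_cov_of.
rewrite /cov_of -mulmxBl -mulmxBr; congr (_ *m _ *m _).
by apply/matrixP => a b; rewrite !mxE /fin_rate; ring.
Qed.

Lemma sym_cov_of k : (cov_of k)^T = cov_of k.
Proof.
rewrite /cov_of !trmx_mul trmxK mulmxA; congr (_ *m _ *m _).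
have sQ a b : Qh b a = Qh a b.
  have {2}-> : Qh = Qh^T by rewrite /Qh !trmx_mul trmxK psdQ.1 mulmxA.
  by rewrite [RHS]mxE.
by apply/matrixP => a b; rewrite [LHS]mxE [LHS]mxE [RHS]mxE sQ addrC.
Qed.

Lemma qform_integrand_ge0 s x : 0 <= qform (cov_mx_integrand Q B s) x.
Proof.
rewrite /cov_mx_integrand expmx_drift expmx_drift_tr.
rewrite -{1}(trmxK (flow s)) qform_congr; exact: psdQ.2.
Qed.

Lemma measurable_qform_integrand x D :
  measurable_fun D (fun s => qform (cov_mx_integrand Q B s) x).
Proof.
rewrite (_ : (fun s => _) = fun s => \sum_p ((W^T *m x) p.1 0 *
    (W^T *m x) p.2 0 * Qh p.1 p.2) * expR (- s * mu p)); last first.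
  by apply/funext => s; rewrite cov_integrandE qform_cov_of.
apply: measurable_funTS; apply: measurable_sum => p.
by apply: measurable_funM => //; exact: measurable_expRNM.
Qed.

Lemma qform_cov_mono (D D' : set R) (k k' : R -> R) x :
  measurable D -> measurable D' -> D `<=` D' ->
  (forall m, 0 < m ->
    (\int[@lebesgue_measure R]_(s in D) (expR (- s * m))%:E = (k m)%:E)%E) ->
  (forall m, 0 < m ->
    (\int[@lebesgue_measure R]_(s in D') (expR (- s * m))%:E = (k' m)%:E)%E) ->
  0 <= qform (cov_of k) x <= qform (cov_of k') x.
Proof.
move=> mD mD' DD' kE k'E; rewrite -!lee_fin.
rewrite (qform_cov_integral mD kE) (qform_cov_integral mD' k'E).
apply/andP; split.
  by apply: integral_ge0 => s _; rewrite lee_fin qform_integrand_ge0.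
apply: ge0_subset_integral => //.
  by apply/measurable_EFinP; exact: measurable_qform_integrand.
by move=> s _; rewrite lee_fin qform_integrand_ge0.
Qed.

(** Otherwise the form would be negative at a suitable point of the line through
  [A *m z] directed by [z]. *)
Lemma psd_ker (A : 'M[R]_n) z : positive_semidefinite A -> qform A z = 0 ->
  A *m z = 0.
Proof.
move=> [sA pA] z0; apply/eqP/negPn/negP => Az.
have q1 : 0 < qform 1%:M (A *m z) by exact: (posdef1 R n).2.
have bE : ((A *m z)^T *m A *m z) 0 0 = qform 1%:M (A *m z).
  by rewrite /qform mulmx1 mulmxA.
set b := qform 1%:M _ in q1 bE; set q := qform A (A *m z).
have q0 : 0 <= q := pA _.
(* the coefficient makes the value of the form [- q - 2] *)
have := pA (A *m z + (- ((q + 1) / b)) *: z).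
rewrite qformDv// qformZv z0 mulr0 addr0 -scalemxAr mxE bE -/q.
rewrite (_ : _ + _ = - q - 2); last by field; rewrite gt_eqF.
lra.
Qed.

Lemma diag_conj_tr_eigen l (y : 'cV[R]_n) :
  (forall a, y a 0 != 0 -> lam 0 a = l) -> B^T *m (V^T *m y) = l *: (V^T *m y).
Proof.
move=> yl; rewrite /B tr_diag_conj /diag_conj invmxK.
rewrite -!mulmxA mulKmx ?unitmx_tr//.
rewrite scalemxAr; congr (_ *m _); apply/colP => a.
rewrite mul_diag_mx !mxE; have [->|/yl ->//] := eqVneq (y a 0) 0.
by rewrite !mulr0.
Qed.

(** If the form of the covariance vanishes at [x], it vanishes at all earlier
  times, where it is a combination of exponentials.  By their linear
  independence, the component of [x] of smallest rate is in the kernel of [Q];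
  being an eigenvector of [B^T], it spans an invariant line, which
  hypoellipticity forbids. *)
Lemma posdef_cov_of t : hypoelliptic Q B -> 0 < t -> posdef (cov_of (fin_rate t)).
Proof.
move=> hypo t0; split=> [|x x0]; first exact: sym_cov_of.
have kE s : 0 < s -> forall m, 0 < m ->
  (\int[@lebesgue_measure R]_(r in `[0%R, s]) (expR (- r * m))%:E
   = (fin_rate s m)%:E)%E.
  by move=> s0 m m0; exact: integral_expRNM_fin.
have ge0 s : 0 < s -> s <= t -> 0 <= qform (cov_of (fin_rate s)) x
    <= qform (cov_of (fin_rate t)) x.
  move=> s0 st; apply: qform_cov_mono (kE s s0) (kE t t0) => //.
  exact: subset_itvl.
rewrite lt_neqAle; have /andP[-> _] := ge0 t t0 (lexx _); rewrite andbT.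
apply/negP => /eqP/esym F0; have [y yE] : exists y, y = W^T *m x by eexists.
have y0 : y != 0 by rewrite yE; apply: unitmx_mulr_neq0; rewrite ?unitmx_tr ?unitmx_inv.
have [a0 ya0 a0min] : exists2 a0, y a0 0 != 0 &
    forall a, y a 0 != 0 -> lam 0 a0 <= lam 0 a.
  have [a ya] : exists a, y a 0 != 0.
    apply: contrapT => /forallNP H; case/eqP: y0; apply/colP => a.
    by rewrite [RHS]mxE; apply/eqP/negPn/negP; exact: H.
  case: (@arg_minP _ _ _ a (fun a => y a 0 != 0) (fun a => lam 0 a)) => // b.
  by move=> yb bmin; exists b.
set l := lam 0 a0 in a0min.
pose w p := (y p.1 0 * y p.2 0 * Qh p.1 p.2) / mu p.
have ind : \sum_(p | mu p == l *+ 2) w p = 0.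
  apply: (@exp_independent _ _ w mu t t0); last first.
    by rewrite mulrn_eq0/= gt_eqF// /l lam0.
  move=> s /andP[s0 st]; have [->|sn0] := eqVneq s 0.
    by apply: big1 => p _; rewrite oppr0 mul0r expR0 subrr mulr0.
  have sp : 0 < s by rewrite lt_neqAle eq_sym sn0.
  have := ge0 s sp st; rewrite F0 -eq_le => /eqP/esym.
  rewrite qform_cov_of => H; rewrite -[RHS]H; apply: eq_bigr => p _.
  rewrite /w /fin_rate mulNr -yE; ring.
pose z : 'cV[R]_n := \col_a (if lam 0 a == l then y a 0 else 0).
have zE a : z a 0 = if lam 0 a == l then y a 0 else 0 by rewrite mxE.
have Qz : qform Qh z = 0.
  have -> : qform Qh z = (l *+ 2) * \sum_(p | mu p == l *+ 2) w p.
    rewrite qform_pairE mulr_sumr [RHS]big_mkcond; apply: eq_bigr => -[a b] _ /=.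
    rewrite !zE /w /=.
    have [ya|ya] := eqVneq (y a 0) 0.
      by rewrite ya !(mul0r, mulr0, if_same).
    have [yb|yb] := eqVneq (y b 0) 0.
      by rewrite yb !(mul0r, mulr0, if_same).
    have la := a0min _ ya; have lb := a0min _ yb.
    case: eqP => [ea|/eqP na]; case: eqP => [eb|/eqP nb];
      rewrite ?mul0r ?mulr0 ?mul0r.
    - rewrite /mu /= ea eb -mulr2n eqxx.
      by field; rewrite gt_eqF// lam0.
    - rewrite ifF//; apply/negP => /eqP; rewrite /mu/= ea mulr2n => /addrI.
      exact/eqP.
    - rewrite ifF//; apply/negP => /eqP; rewrite /mu/= eb mulr2n => /addIr.
      exact/eqP.
    - rewrite ifF//; apply/negP => /eqP; rewrite /mu/= mulr2n.
      have : l < lam 0 a by rewrite lt_neqAle eq_sym na.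
      by lra.
  by rewrite ind mulr0.
have z0 : z != 0.
  by apply/eqP => /colP/(_ a0); rewrite !mxE eqxx; exact/eqP.
pose v := V^T *m z.
have v0 : v != 0 by apply: unitmx_mulr_neq0; rewrite ?unitmx_tr.
have Qv : Q *m v = 0.
  apply: psd_ker => //; rewrite /v -qform_congr trmxK; exact: Qz.
have Bv : B^T *m v = l *: v.
  by apply: diag_conj_tr_eigen => a; rewrite zE; case: (lam 0 a =P l) => // _ /eqP.
have v1 : <[v]>%VS = 0%VS.
  apply: hypo => u /vlineP[c ->]; first by rewrite -scalemxAr Qv scaler0.
  by rewrite -scalemxAr Bv scalerA rpredZ// memv_line.
by have := memv_line v; rewrite v1 memv0 (negbTE v0).
Qed.

Lemma posdef_cov_mx t : hypoelliptic Q B -> 0 < t -> posdef (cov_mx Q B t).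
Proof. by move=> hypo t0; rewrite cov_mxE//; exact: posdef_cov_of. Qed.

Lemma posdef_cov_mx_oo : hypoelliptic Q B -> posdef (cov_mx_oo Q B).
Proof.
move=> hypo; rewrite cov_mx_ooE; split=> [|x x0]; first exact: sym_cov_of.
have [_ p1] := posdef_cov_of hypo ltr01.
apply: (lt_le_trans (p1 _ x0)).
have kE m : 0 < m -> (\int[@lebesgue_measure R]_(r in `[0%R, 1%R])
    (expR (- r * m))%:E = (fin_rate 1 m)%:E)%E.
  by move=> m0; exact: integral_expRNM_fin.
suff /andP[] : 0 <= qform (cov_of (fin_rate 1)) x
    <= qform (cov_of (@GRing.inv R)) x by [].
apply: qform_cov_mono kE (@integral_expRNM_oo R) => //.
exact: subset_itvl.
Qed.

End diagonalizable_drift.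

(** * Operator norm and condition number *)

Section operator_norm.
Context (R : realType) (n : nat).
Implicit Types (M S : 'M[R]_n) (x y : 'cV[R]_n).

Lemma sqr_enorm x : enorm x ^+ 2 = qform 1%:M x.
Proof.
by rewrite qform1 sqr_sqrtr// sumr_ge0// => i _; exact: sqr_ge0.
Qed.

Lemma enorm_ge0 x : 0 <= enorm x. Proof. exact: sqrtr_ge0. Qed.

Lemma qform1_mulmx M x : qform 1%:M (M *m x) = qform (M^T *m M) x.
Proof. by rewrite -qform_congr mulmx1. Qed.

Lemma has_ubound_opnorm M :
  has_ubound [set enorm (M *m x) | x in [set x | enorm x <= 1]].
Proof.
exists (Num.sqrt (\sum_i \sum_j `|(M^T *m M) j i|)) => _ [x x1 <-].
rewrite ler_sqrt; last by do 2!(apply: sumr_ge0 => ? _).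
rewrite -qform1 qform1_mulmx; apply: (le_trans (qform_le_entries _ _)).
rewrite -[leRHS]mulr1 ler_wpM2l//; first by do 2!(apply: sumr_ge0 => ? _).
by rewrite -qform1 -sqr_enorm -(expr1n _ 2) ler_pXn2r// nnegrE ?enorm_ge0.
Qed.

Lemma enorm0 : enorm (0 : 'cV[R]_n) = 0.
Proof.
by rewrite /enorm big1 ?sqrtr0// => i _; rewrite mxE expr0n.
Qed.

Lemma enormZ (a : R) x : enorm (a *: x) = `|a| * enorm x.
Proof.
rewrite /enorm -sqrtr_sqr -sqrtrM ?sqr_ge0//; congr Num.sqrt.
by rewrite mulr_sumr; apply: eq_bigr => i _; rewrite mxE exprMn.
Qed.

Lemma opnorm_ge0 M : 0 <= opnorm M.
Proof.
have E : enorm (M *m 0) = 0 by rewrite mulmx0 enorm0.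
rewrite -E; apply: ub_le_sup; first exact: has_ubound_opnorm.
by exists 0; rewrite //= enorm0.
Qed.

Lemma enorm_mulmx_le M x : enorm (M *m x) <= opnorm M * enorm x.
Proof.
have [->|xn0] := eqVneq x 0; first by rewrite mulmx0 enorm0 mulr0.
have x0 : 0 < enorm x.
  rewrite lt_neqAle enorm_ge0 andbT eq_sym; apply/eqP => x0.
  by have := (posdef1 R n).2 _ xn0; rewrite -sqr_enorm x0 expr0n ltxx.
rewrite -ler_pdivrMr//.
have -> : enorm (M *m x) / enorm x = enorm (M *m ((enorm x)^-1 *: x)).
  by rewrite -scalemxAr enormZ ger0_norm ?invr_ge0 ?enorm_ge0// mulrC.
apply: ub_le_sup; first exact: has_ubound_opnorm.
exists ((enorm x)^-1 *: x) => //=.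
by rewrite enormZ ger0_norm ?invr_ge0 ?enorm_ge0// mulVf// gt_eqF.
Qed.

Lemma qform_le_opnorm S x : qform S x <= opnorm S * qform 1%:M x.
Proof.
have := cauchy_schwarz_qform x (S *m x) (posdef1 R n).
rewrite mulmx1 mulmxA -!sqr_enorm -exprMn => CS.
have /(le_trans (ler_norm _)) : `|qform S x| <= enorm x * enorm (S *m x).
  rewrite -(@ler_pXn2r _ 2)// ?nnegrE ?mulr_ge0 ?enorm_ge0//.
  by rewrite real_normK ?num_real.
move=> /le_trans; apply.
by rewrite expr2 mulrCA ler_wpM2l ?enorm_ge0// enorm_mulmx_le.
Qed.

(** Cauchy-Schwarz for the form [S], between [x] and [invmx S *m x]. *)
Lemma qform1_le_opnorm_inv S x : posdef S ->
  qform 1%:M x <= opnorm (invmx S) * qform S x.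
Proof.
move=> pS; have [->|x0] := eqVneq x 0; first by rewrite !qform0 mulr0.
have q0 : 0 < qform 1%:M x := (posdef1 R n).2 _ x0.
have := cauchy_schwarz_qform x (invmx S *m x) pS.
have Su := posdef_unit pS.
rewrite -mulmxA mulKVmx// -[x in (x^T *m x) 0 0]mul1mx.
rewrite mul1mx -[(x^T *m x) 0 0](_ : qform 1%:M x = _); last first.
  by rewrite /qform mulmx1.
have -> : qform S (invmx S *m x) = qform (invmx S) x.
  by rewrite /qform trmx_mul trmx_inv pS.1 -!mulmxA mulKVmx.
have := qform_le_opnorm (invmx S) x; have := pS.2 _ x0.
set a := opnorm _; set u := qform S x; set v := qform (invmx S) x.
move=> u0 va CS; rewrite -(ler_pM2r q0) -expr2; apply: (le_trans CS).
by rewrite (mulrC a) -mulrA ler_wpM2l// ltW.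
Qed.

(** Both norms bound the form [S], one from above and one from below. *)
Lemma condition_number_ge1 S : (0 < n)%N -> posdef S -> 1 <= condition_number S.
Proof.
move=> n0 pS; pose x : 'cV[R]_n := delta_mx (Ordinal n0) 0.
have x0 : x != 0.
  apply/eqP => /matrixP/(_ (Ordinal n0) 0)/eqP.
  by rewrite !mxE !eqxx/= oner_eq0.
have q0 : 0 < qform 1%:M x := (posdef1 R n).2 _ x0.
rewrite -(ler_pM2r q0) mul1r /condition_number (mulrC (opnorm S)) -mulrA.
apply: (le_trans (qform1_le_opnorm_inv _ pS)).
by rewrite ler_wpM2l ?opnorm_ge0// qform_le_opnorm.
Qed.

(** The form [S] is squeezed between equal multiples of the identity form. *)
Lemma condition_number1 S : posdef S -> condition_number S = 1 ->
  S = (opnorm S)%:M.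
Proof.
move=> pS k1; set b := opnorm S; have bE : b * opnorm (invmx S) = 1 := k1.
have b0 : 0 <= b := opnorm_ge0 _.
have q0 x : qform (S - b%:M) x = 0.
  have := qform_le_opnorm S x; have := qform1_le_opnorm_inv x pS.
  move=> /(ler_wpM2l b0); rewrite mulrA bE mul1r => h1 h2.
  apply/eqP; rewrite qformB -scalemx1 qformZ subr_eq0 eq_le.
  by rewrite h2 h1.
have sD : (S - b%:M)^T = S - b%:M by rewrite linearB/= tr_scalar_mx pS.1.
apply/eqP; rewrite -subr_eq0; apply/eqP/matrixP => i j; rewrite [RHS]mxE.
have := qformDv (delta_mx i 0) (delta_mx j 0) sD; rewrite !q0 !add0r addr0.
have -> : ((delta_mx i 0 : 'cV[R]_n)^T *m (S - b%:M) *m (delta_mx j 0 : 'cV[R]_n)) 0 0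
    = (S - b%:M) i j :> R.
  by rewrite trmx_delta -rowE -colE !mxE.
lra.
Qed.

Lemma condition_number_gt0 S : 0 < condition_number S ->
  0 < opnorm S /\ 0 < opnorm (invmx S).
Proof.
move=> k0; rewrite !lt_neqAle !opnorm_ge0 !andbT !(eq_sym 0).
by split; apply/eqP => z0; move: k0;
  rewrite /condition_number z0 ?mul0r ?mulr0 ltxx.
Qed.

End operator_norm.

(** * Isotropic covariances *)

Section isotropic_covariance.
Context (R : realType) (n : nat).
Variables (V : 'M[R]_n) (lam : 'rV[R]_n).
Hypothesis Vu : V \in unitmx.
Implicit Types (S Q : 'M[R]_n) (d m : 'rV[R]_n).

Let Wtu : (invmx V)^T \in unitmx. Proof. by rewrite unitmx_tr unitmx_inv. Qed.

Definition diag_cov d : 'M[R]_n := invmx V *m diag_mx d *m (invmx V)^T.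

(** Covariances that are scalar in the eigenbasis of the drift: the flow is
  self-adjoint for them. *)
Definition iso_cov (c : R) : 'M[R]_n := diag_cov (const_mx c).

Lemma diag_conj_cst (r : R) : diag_conj V (const_mx r) = r%:M.
Proof.
by rewrite /diag_conj diag_const_mx mul_mx_scalar -scalemxAl mulVmx// scalemx1.
Qed.

Lemma flowD s t : flow V lam s *m flow V lam t = flow V lam (s + t).
Proof.
rewrite /flow diag_conjM//; congr diag_conj; apply/rowP => i.
by rewrite !mxE -expRD opprD mulrDl.
Qed.

Lemma unitmx_diag_conj d : (forall i, d 0 i != 0) -> diag_conj V d \in unitmx.
Proof.
move=> d0; have E : diag_conj V d *m diag_conj V (\row_i (d 0 i)^-1) = 1%:M.
  rewrite diag_conjM// -diag_conj_cst; congr diag_conj; apply/rowP => i.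
  by rewrite !mxE mulfV.
by have [] := mulmx1_unit E.
Qed.

Lemma unitmx_flow t : flow V lam t \in unitmx.
Proof.
by apply: unitmx_diag_conj => i; rewrite mxE gt_eqF// expR_gt0.
Qed.

Lemma qform_diag_mx d (x : 'cV[R]_n) :
  qform (diag_mx d) x = \sum_i d 0 i * x i 0 ^+ 2.
Proof.
rewrite /qform mxE; apply: eq_bigr => i _.
by rewrite mul_mx_diag !mxE; ring.
Qed.

Lemma posdef_diag_mx d : (forall i, 0 < d 0 i) -> posdef (diag_mx d).
Proof.
move=> d0; split=> [|x x0]; first by rewrite tr_diag_mx.
have [i xi] : exists i, x i 0 != 0.
  apply: contrapT => /forallNP H; case/eqP: x0; apply/colP => i.
  by rewrite [RHS]mxE; apply/eqP/negPn/negP; exact: H.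
rewrite qform_diag_mx (bigD1 i)//= ltr_pwDl//.
  by rewrite mulr_gt0// exprn_even_gt0.
by apply: sumr_ge0 => j _; rewrite mulr_ge0 ?sqr_ge0// ltW.
Qed.

Lemma posdef_diag_cov d : (forall i, 0 < d 0 i) -> posdef (diag_cov d).
Proof.
by move=> d0; rewrite /diag_cov -{1}(trmxK (invmx V)); apply: posdef_congr => //;
  exact: posdef_diag_mx.
Qed.

Lemma diag_conj_cov m d : diag_conj V m *m diag_cov d =
  diag_cov (\row_i (m 0 i * d 0 i)).
Proof.
rewrite /diag_conj /diag_cov !mulmxA mulmxK// -(mulmxA _ (diag_mx m)).
congr (_ *m _ *m _); apply/matrixP => i j; rewrite mul_mx_diag !mxE.
by case: eqP => [->|]; rewrite ?mulr1n// !mulr0n mul0r.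
Qed.

Lemma tr_diag_cov d : (diag_cov d)^T = diag_cov d.
Proof. by rewrite /diag_cov !trmx_mul trmxK tr_diag_mx mulmxA. Qed.

Lemma diag_conj_cov_comm m d :
  diag_conj V m *m diag_cov d = diag_cov d *m (diag_conj V m)^T.
Proof.
by rewrite -{2}tr_diag_cov -trmx_mul diag_conj_cov tr_diag_cov.
Qed.

Lemma diag_conj_cov_congr m d :
  diag_conj V m *m diag_cov d *m (diag_conj V m)^T =
  diag_cov (\row_i (m 0 i ^+ 2 * d 0 i)).
Proof.
rewrite diag_conj_cov -diag_conj_cov_comm diag_conj_cov; congr diag_cov.
by apply/rowP => i; rewrite !mxE; ring.
Qed.

Lemma diag_covB d d' : diag_cov d - diag_cov d' = diag_cov (d - d').
Proof. by rewrite /diag_cov -mulmxBl -mulmxBr -linearB. Qed.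

(** The noise then has the covariance of diagonal [c * (1 - m 0 i ^+ 2)]. *)
Lemma iso_cov_dom c m : 0 < c -> (forall i, `|m 0 i| < 1) ->
  mehler_dom (iso_cov c) (iso_cov c) (diag_conj V m).
Proof.
move=> c0 m1; have pI : posdef (iso_cov c).
  by apply: posdef_diag_cov => i; rewrite mxE.
split=> //; rewrite diag_conj_cov_congr diag_covB.
apply: posdef_diag_cov => i; rewrite !mxE subr_gt0 -{2}(mul1r c) ltr_pM2r//.
by rewrite -real_normK ?num_real// expr_lt1.
Qed.

(** The Lyapunov equation is diagonal in the eigenbasis. *)
Lemma cov_mx_oo_diag_cov d : (forall i, 0 < lam 0 i) ->
  cov_mx_oo (diag_cov d) (diag_conj V lam) =
  diag_cov (\row_i (d 0 i / (lam 0 i *+ 2))).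
Proof.
move=> lam0; rewrite cov_mx_ooE//; congr (_ *m _ *m _).
apply/matrixP => a b.
have -> : V *m diag_cov d *m V^T = diag_mx d.
  rewrite /diag_cov !mulmxA mulmxV// mul1mx -mulmxA -trmx_mul mulmxV//.
  by rewrite trmx1 mulmx1.
rewrite !mxE; case: eqP => [->|_]; first by rewrite !mulr1n mulr2n.
by rewrite !mulr0n mul0r.
Qed.

Variable S : 'M[R]_n.
Hypothesis pS : posdef S.
Let U := V *m S *m V^T.

Let pU : posdef U. Proof. exact: posdef_congr_tr. Qed.

Let SE : S = invmx V *m U *m (invmx V)^T.
Proof.
by rewrite /U !mulmxA mulVmx// mul1mx -mulmxA -trmx_mul mulVmx// trmx1 mulmx1.
Qed.

(** In the eigenbasis the noise has covariance [c%:M - U], and the norm of [U]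
  bounds the form [U] from above. *)
Lemma iso_cov_above c : opnorm U < c -> mehler_dom (iso_cov c) S 1%:M.
Proof.
move=> Uc; have c0 : 0 < c by apply: le_lt_trans Uc; exact: opnorm_ge0.
split=> //; first by apply: posdef_diag_cov => i; rewrite mxE.
rewrite mul1mx trmx1 mulmx1 SE -mulmxBl -mulmxBr -{1}(trmxK (invmx V)).
apply: posdef_congr => //; split=> [|x x0].
  by rewrite linearB/= tr_diag_mx pU.1.
rewrite qformB diag_const_mx -scalemx1 qformZ subr_gt0.
apply: (le_lt_trans (qform_le_opnorm U x)).
by rewrite ltr_pM2r//; exact: (posdef1 R n).2.
Qed.

(** In the eigenbasis the noise has covariance [U] minus a diagonal matrix below
  [r ^+ 2 * c], and the inverse of the norm of [invmx U] bounds the form [U]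
  from below. *)
Lemma iso_cov_below c r m : 0 < c -> (forall i, `|m 0 i| <= r) ->
  r ^+ 2 * c * opnorm (invmx U) < 1 -> mehler_dom S (iso_cov c) (diag_conj V m).
Proof.
move=> c0 mr small; split=> //; first by apply: posdef_diag_cov => i; rewrite mxE.
rewrite diag_conj_cov_congr SE -mulmxBl -mulmxBr -{1}(trmxK (invmx V)).
apply: posdef_congr => //; split=> [|x x0].
  by rewrite linearB/= tr_diag_mx pU.1.
rewrite qformB subr_gt0; set d : 'rV[R]_n := \row_i _.
have le_r : qform (diag_mx d) x <= r ^+ 2 * c * qform 1%:M x.
  rewrite qform_diag_mx qform1 mulr_sumr; apply: ler_sum => i _.
  rewrite !mxE ler_wpM2r ?sqr_ge0// ler_wpM2r ?(ltW c0)//.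
  rewrite -(real_normK (num_real (m 0 i))) ler_pXn2r ?nnegrE//.
  exact: le_trans (mr i).
apply: (le_lt_trans le_r).
have := qform1_le_opnorm_inv x pU; have := pU.2 _ x0.
have rc : 0 <= r ^+ 2 * c by rewrite mulr_ge0 ?sqr_ge0// ltW.
move=> q0 /(ler_wpM2l rc)/le_lt_trans; apply.
by rewrite mulrA -[ltRHS]mul1r ltr_pM2r.
Qed.

Lemma iso_cov_condition_number1 : condition_number U = 1 ->
  S = iso_cov (opnorm U).
Proof.
by move=> /(condition_number1 pU) UE; rewrite SE {1}UE /iso_cov /diag_cov diag_const_mx.
Qed.

End isotropic_covariance.

(** * Mehler operators and the Ornstein-Uhlenbeck formula *)

(** Linearity and compatibility with null sets are read off an adjoint: they
  hold although the values of the operator are only specified by integrals that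
  converge almost everywhere. *)
Section adjointable.
Context d d' (T : measurableType d) (T' : measurableType d') (R : realType).
Variables (mu : {measure set T -> \bar R}) (nu : {measure set T' -> \bar R}).
Variable L : L2 mu -> L2 nu.
Hypothesis adjL : forall h, exists h', forall f, dot (L f) h = dot f h'.

Lemma adjoint_linear (a : R) (f g : L2 mu) :
  L (a *: f + g) = a *: L f + L g %[ae nu].
Proof.
apply: (@ae_dotP _ _ _ _ (L (a *: f + g)) (a *: L f + L g)) => h.
by have [h' hE] := adjL h; rewrite dotDl dotZl !hE dotDl dotZl.
Qed.

Lemma adjoint_ae (f g : L2 mu) : f = g %[ae mu] -> L f = L g %[ae nu].
Proof.
move=> fg; apply: (@ae_dotP _ _ _ _ (L f) (L g)) => h.
by have [h' hE] := adjL h; rewrite !hE; exact: dot_ae.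
Qed.

End adjointable.

Lemma nrm_mono d d' (T : measurableType d) (T' : measurableType d')
    (R : realType) (mu : {measure set T -> \bar R})
    (nu : {measure set T' -> \bar R}) (f : L2 mu) (g : L2 nu) :
  dot f f <= dot g g -> nrm f <= nrm g.
Proof. by move=> fg; rewrite nrm_le ?nrm_ge0// sqr_nrm. Qed.

(** Simple functions being dense, two linear contractions that agree on
  indicators are equal. *)
Section contractions.
Context d (T : measurableType d) (R : realType).
Variable mu : {measure set T -> \bar R}.
Hypothesis mu1 : mu setT = 1%E.
Variables P G : L2 mu -> L2 mu.
Hypothesis Plin : forall a f g, P (a *: f + g) = a *: P f + P g %[ae mu].
Hypothesis Glin : forall a f g, G (a *: f + g) = a *: G f + G g %[ae mu].
Hypothesis Pcon : forall f, nrm (P f) <= nrm f.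
Hypothesis Gcon : forall f, nrm (G f) <= nrm f.
Hypothesis PG : forall A, measurable A -> P (ind mu A) = G (ind mu A) %[ae mu].

Let lin_sub (F : L2 mu -> L2 mu) f g :
  (forall a f g, F (a *: f + g) = a *: F f + F g %[ae mu]) ->
  forall h, dot (F (f - g)) h = dot (F f) h - dot (F g) h.
Proof.
move=> Flin h; have -> : f - g = (-1) *: g + f by rewrite scaleN1r addrC.
by rewrite (dot_ae h (Flin _ _ _)) !dotE mulN1r addrC.
Qed.

Lemma contraction_eq f : P f = G f %[ae mu].
Proof.
move: f; apply: (L2_ind mu1) => // [a f g Pf Pg|f fapp].
  apply: (@ae_dotP _ _ _ _ (P (a *: f + g)) (G (a *: f + g))) => h.
  rewrite (dot_ae h (Plin _ _ _)) (dot_ae h (Glin _ _ _)) !dotE.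
  by rewrite (dot_ae h Pf) (dot_ae h Pg).
apply: (@ae_dotP _ _ _ _ (P f) (G f)) => h; apply/eqP; rewrite -subr_eq0.
rewrite -normr_le0; apply/ler_addgt0Pl => e e0; rewrite addr0.
pose r := e / (2 * (nrm h + 1)).
have h1 : 0 < nrm h + 1 by rewrite ltr_wpDl ?nrm_ge0.
have r0 : 0 < r by rewrite divr_gt0// mulr_gt0.
have [g Pg fg] := fapp r r0.
have -> : dot (P f) h - dot (G f) h = dot (P (f - g)) h - dot (G (f - g)) h.
  by rewrite !lin_sub// (dot_ae h Pg); ring.
have bnd F : (forall f, nrm (F f) <= nrm f) -> `|dot (F (f - g)) h| <= e / 2.
  move=> Fcon; have le_e : nrm (F (f - g)) * nrm h <= e / 2.
    apply: (@le_trans _ _ (r * (nrm h + 1))).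
      rewrite ler_pM ?nrm_ge0 ?lerDl//; exact: le_trans (Fcon _) fg.
    by rewrite /r le_eqVlt; apply/orP; left; apply/eqP; field; rewrite gt_eqF.
  rewrite ler_norml (le_trans (dot_le_nrm _ _) le_e) andbT lerNl.
  by rewrite -dotNl (le_trans (dot_le_nrm _ _))// nrmN.
apply: (le_trans (ler_normB _ _)).
by apply: (le_trans (lerD (bnd _ Pcon) (bnd _ Gcon))); rewrite -splitr.
Qed.

End contractions.

Lemma contraction_quasi_affinity d d' (T : measurableType d)
    (T' : measurableType d') (R : realType) (mu : {measure set T -> \bar R})
    (nu : {measure set T' -> \bar R}) (L : L2 mu -> L2 nu) :
  (forall a f g, L (a *: f + g) = a *: L f + L g %[ae nu]) ->
  (forall f, nrm (L f) <= nrm f) ->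
  (forall f, L f = 0 %[ae nu] -> f = 0 %[ae mu]) ->
  (forall g e, 0 < e -> exists f, nrm (L f - g) <= e) ->
  quasi_affinity L.
Proof.
move=> Llin Lcon Linj Ldense; split=> //; first split=> //.
  by exists 1 => f; rewrite mul1e !L2_normE lee_fin; exact: Lcon.
move=> g e e0; have e20 : 0 < e / 2 by rewrite divr_gt0.
have [f fg] := Ldense g _ e20.
exists f; rewrite L2_normE lte_fin; apply: (le_lt_trans fg).
by rewrite ltr_pdivrMr// ltr_pMr// ltr1n.
Qed.

Lemma contraction_semigroupP d (T : measurableType d) (R : realType)
    (mu : {measure set T -> \bar R}) (P : R -> L2 mu -> L2 mu) :
  (forall t, 0 < t -> forall a f g,
    P t (a *: f + g) = a *: P t f + P t g %[ae mu]) ->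
  (forall t, 0 < t -> forall f, nrm (P t f) <= nrm f) ->
  P 0 = id ->
  (forall s t, 0 < s -> 0 < t -> forall f,
    P (s + t) f = P s (P t f) %[ae mu]) ->
  (forall f e, 0 < e -> exists2 t0, 0 < t0 &
    forall t, 0 < t -> t <= t0 -> nrm (P t f - f) <= e) ->
  contraction_semigroup P.
Proof.
move=> Plin Pcon P0 PD Pc; split.
- move=> t; rewrite le_eqVlt => /predU1P[<-|t0] a f g; last exact: Plin.
  by rewrite P0; exact: ae_eq_refl.
- move=> t; rewrite le_eqVlt => /predU1P[<-|t0] f; first by rewrite P0.
  by rewrite !L2_normE lee_fin; exact: Pcon.
- by move=> f; rewrite P0; exact: ae_eq_refl.
- move=> s t; rewrite le_eqVlt => /predU1P[<-|s0] t0 f.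
    by rewrite add0r P0; exact: ae_eq_refl.
  move: t0; rewrite le_eqVlt => /predU1P[<-|t0].
    by rewrite addr0 P0; exact: ae_eq_refl.
  exact: PD.
- move=> f; under eq_fun do rewrite L2_normE.
  apply: cvg_EFin; first exact: nearW.
  apply/cvgrPdist_le => e e0; have [t0 t00 tP] := Pc f e e0.
  near=> t; rewrite /= sub0r normrN ger0_norm; last exact: nrm_ge0.
  by apply: tP; [near: t; exact: nbhs_right_gt|near: t; exact: nbhs_right_le].
Unshelve. all: by end_near. Qed.

Section mehler_operators.
Context (R : realType) (n : nat).
Implicit Types (S M : 'M[R]_n).

Lemma mehler_adjoint S1 S2 M (h : L2 (gauss_measure S2)) : mehler_dom S1 S2 M ->
  exists h' : L2 (gauss_measure S1), forall f, dot (mehler S2 M f) h = dot f h'.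
Proof.
move=> [p1 p2 pC]; eexists => f.
exact: (@kop_adjoint _ _ _ _ _ (gauss_prob p2) (gauss_prob p1)
  (mehler_kernel S1 S2 M) f h (bistochastic_mehler p1 p2 pC)).
Qed.

Lemma mehler_linear S1 S2 M (a : R) (f g : L2 (gauss_measure S1)) :
  mehler_dom S1 S2 M ->
  mehler S2 M (a *: f + g) = a *: mehler S2 M f + mehler S2 M g
    %[ae gauss_measure S2].
Proof. by move=> dom; apply: adjoint_linear => h; exact: mehler_adjoint. Qed.

Lemma mehler_ae S1 S2 M (f g : L2 (gauss_measure S1)) : mehler_dom S1 S2 M ->
  f = g %[ae gauss_measure S1] ->
  mehler S2 M f = mehler S2 M g %[ae gauss_measure S2].
Proof. by move=> dom; apply: adjoint_ae => h; exact: mehler_adjoint. Qed.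

Lemma mehler_nrm S1 S2 M (f : L2 (gauss_measure S1)) : mehler_dom S1 S2 M ->
  nrm (mehler S2 M f) <= nrm f.
Proof. by move=> dom; apply: nrm_mono; exact: mehler_contract. Qed.

Lemma mehler_quasi_affinity S1 S2 M : mehler_dom S1 S2 M -> M \in unitmx ->
  @quasi_affinity _ _ _ _ R (gauss_measure S1) (gauss_measure S2) (mehler S2 M).
Proof.
move=> dom Mu; apply: contraction_quasi_affinity.
- by move=> a f g; exact: mehler_linear.
- by move=> f; exact: mehler_nrm.
- by move=> f; exact: mehler_injective.
- by move=> g e e0; exact: mehler_dense.
Qed.

End mehler_operators.

Section OU_operators.
Context (R : realType) (n : nat).
Variables (V : 'M[R]_n) (lam : 'rV[R]_n).
Hypothesis Vu : V \in unitmx.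
Hypothesis lam0 : forall i, 0 < lam 0 i.
Local Notation flow := (flow V lam).
Local Notation B := (diag_conj V lam).

(** The transition at time zero has no noise, hence no kernel. *)
Definition ousg (S : 'M[R]_n) (t : R) :
    L2 (gauss_measure S) -> L2 (gauss_measure S) :=
  if 0 < t then mehler S (flow t) else id.

Lemma flow_dom Q t : positive_semidefinite Q -> hypoelliptic Q B -> 0 < t ->
  mehler_dom (cov_mx_oo Q B) (cov_mx_oo Q B) (flow t).
Proof.
move=> psdQ hypo t0; split; try exact: posdef_cov_mx_oo.
by rewrite -cov_mx_flow//; exact: posdef_cov_mx.
Qed.

Lemma mehler_OU_formula Q t (f : L2 (invariant_measure Q B)) :
  positive_semidefinite Q -> hypoelliptic Q B -> 0 < t ->
  mehler (cov_mx_oo Q B) (flow t) f = OU_formula Q B t f :> (_ -> _).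
Proof.
move=> psdQ hypo t0; apply: (etrans (mehler_formula f (flow_dom psdQ hypo t0))).
rewrite /OU_formula (expmx_drift lam Vu t) (cov_mx_flow Q Vu lam0 t0).
reflexivity.
Qed.

(** The Mehler operator and the given semigroup agree on indicators, hence on
  simple functions, hence everywhere, being both linear contractions. *)
Lemma OU_semigroup_mehler Q
    (P : R -> L2 (invariant_measure Q B) -> L2 (invariant_measure Q B)) t f :
  positive_semidefinite Q -> hypoelliptic Q B -> OU_semigroup P -> 0 < t ->
  P t f = mehler (cov_mx_oo Q B) (flow t) f %[ae invariant_measure Q B].
Proof.
move=> psdQ hypo [[Plin Pcon _ _ _] Pbnd] t0; have tge := ltW t0.
have dom := flow_dom psdQ hypo t0.
have mu1 : invariant_measure Q B setT = 1%E.
  by apply: gauss_measureT; exact: posdef_cov_mx_oo.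
apply: (contraction_eq mu1).
- exact: Plin.
- by move=> a g h; exact: mehler_linear.
- by move=> g; have := Pcon t tge g; rewrite !L2_normE lee_fin.
- by move=> g; exact: mehler_nrm.
move=> A mA; rewrite (mehler_OU_formula _ psdQ hypo t0); apply: Pbnd => //.
exists 1 => x; rewrite indE// indicE.
by case: (_ \in _); rewrite ?normr1 ?normr0.
Qed.

End OU_operators.

(** * The self-adjoint semigroup of an isotropic covariance *)

Lemma mehler_comp_eq (R : realType) (n : nat) (S1 S2 S3 M1 M2 M : 'M[R]_n)
    (f : L2 (gauss_measure S1)) : M2 *m M1 = M ->
  mehler_dom S2 S3 M1 -> mehler_dom S1 S2 M2 ->
  mehler S3 M1 (mehler S2 M2 f) = mehler S3 M f %[ae gauss_measure S3].
Proof. by move=> <-; exact: mehler_comp. Qed.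

Section isotropic_semigroup.
Context (R : realType) (n : nat).
Variables (V : 'M[R]_n) (lam : 'rV[R]_n).
Hypothesis Vu : V \in unitmx.
Hypothesis lam0 : forall i, 0 < lam 0 i.
Variables (c : R) (S : 'M[R]_n).
Hypothesis c0 : 0 < c.
Hypothesis SE : S = iso_cov V c.
Local Notation flow := (flow V lam).
Implicit Types (f g : L2 (gauss_measure S)).

Lemma iso_dom (m : 'rV[R]_n) : (forall i, `|m 0 i| < 1) -> mehler_dom S S (diag_conj V m).
Proof. by rewrite SE; exact: iso_cov_dom. Qed.

Lemma iso_comm (m : 'rV[R]_n) : diag_conj V m *m S = S *m (diag_conj V m)^T.
Proof. by rewrite SE; exact: diag_conj_cov_comm. Qed.

Lemma iso_flow_dom t : 0 < t -> mehler_dom S S (flow t).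
Proof.
move=> t0; apply: iso_dom => i.
by rewrite mxE ger0_norm ?expR_ge0// mulNr expRN_lt1// mulr_gt0.
Qed.

Lemma iso_flow_sym t f g : 0 < t ->
  dot (mehler S (flow t) f) g = dot f (mehler S (flow t) g).
Proof. by move=> t0; apply: mehler_sym (iso_flow_dom t0) (iso_comm _). Qed.

Lemma iso_flow_dot s t f g : 0 < s -> 0 < t ->
  dot (mehler S (flow s) f) (mehler S (flow t) g) =
  dot f (mehler S (flow (s + t)) g).
Proof.
move=> s0 t0; apply: (etrans (iso_flow_sym f _ s0)); apply: dot_aer.
apply: (mehler_comp_eq g _ (iso_flow_dom s0) (iso_flow_dom t0)).
by rewrite (flowD lam Vu) addrC.
Qed.

Lemma iso_flow_contract t f : 0 < t ->
  dot (mehler S (flow t) f) (mehler S (flow t) f) <= dot f f.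
Proof. by move=> t0; exact: mehler_contract (iso_flow_dom t0). Qed.

(** Run at a speed [L] above all the rates, the number semigroup factors through
  the semigroup of the flow, the other factor being a symmetric contraction. *)
Lemma iso_flow_form_ge t (L : R) f : 0 < t -> (forall i, lam 0 i < L) -> 0 < L ->
  dot f (numsg (L * t) f) <= dot f (mehler S (flow t) f).
Proof.
move=> t0 lamL L0; have t20 : 0 < t / 2 by rewrite divr_gt0.
pose m : 'rV[R]_n := \row_i expR (- ((L - lam 0 i) * t)).
have mdom : mehler_dom S S (diag_conj V m).
  apply: iso_dom => i; rewrite mxE ger0_norm ?expR_ge0// expRN_lt1// mulr_gt0//.
  by rewrite subr_gt0.
have fE : (expR (- (L * t)))%:M =
    (flow (t / 2) *m diag_conj V m) *m flow (t / 2).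
  rewrite -(diag_conj_cst Vu) /flow !diag_conjM//; congr diag_conj.
  apply/rowP => i; rewrite !mxE -!expRD; congr expR.
  by field.
have hdom := iso_flow_dom t20.
pose u := mehler S (flow (t / 2)) f.
have [mhdom _] := mehler_domM mdom hdom.
have e1 := mehler_comp f mdom hdom.
have e2 := mehler_comp_eq f (esym fE) hdom mhdom.
have e3 := mehler_ae hdom e1.
have n1 : dot f (numsg (L * t) f) = dot f (mehler S (flow (t / 2))
    (mehler S (flow (t / 2) *m diag_conj V m) f)).
  exact: (esym (dot_aer f e2)).
have n2 : dot f (mehler S (flow (t / 2))
    (mehler S (flow (t / 2) *m diag_conj V m) f)) =
    dot u (mehler S (diag_conj V m) u).
  apply: (etrans (dot_aer f (ae_eq_sym e3))).
  exact/esym/(iso_flow_sym f _ t20).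
have n3 := iso_flow_dot f f t20 t20.
have tt : t / 2 + t / 2 = t by rewrite -splitr.
rewrite tt -/u in n3.
have := mehler_nrm u mdom.
move: n1 n2 n3; set v := mehler S (diag_conj V m) u.
move: (numsg _ f) (mehler S (flow t) f) (mehler S (flow _) _) u v.
move=> x y z u v -> -> <- uv; apply: (le_trans (dot_le_nrm _ _)).
by rewrite -[leRHS]sqr_nrm expr2 ler_wpM2l ?nrm_ge0.
Qed.

(** Comparison with the number semigroup, which is continuous at the origin. *)
Lemma iso_flow_form_cvg0 f (e : R) : 0 < e ->
  exists2 t, 0 < t & dot f f - e <= dot f (mehler S (flow t) f).
Proof.
move=> e0; have pS : posdef S by have [] := iso_flow_dom ltr01.
have [t t0 te] := numsg_form_cvg0 pS f e0.
pose L := 1 + \sum_i lam 0 i.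
have L0 : 0 < L by rewrite ltr_pwDl// sumr_ge0// => i _; exact: ltW.
have lamL i : lam 0 i < L.
  rewrite /L (bigD1 i)//= addrCA ltrDl ltr_pwDl// sumr_ge0// => j _; exact: ltW.
exists (t / L); first by rewrite divr_gt0.
apply: (le_trans te); have := iso_flow_form_ge f (divr_gt0 t0 L0) lamL L0.
by rewrite mulrC divfK// gt_eqF.
Qed.

Lemma iso_contraction_semigroup : contraction_semigroup (ousg V lam (S := S)).
Proof.
have E t : 0 < t -> ousg V lam (S := S) t = mehler S (flow t) by rewrite /ousg => ->.
apply: contraction_semigroupP.
- move=> t t0 a f g; rewrite (E t t0); exact: mehler_linear (iso_flow_dom t0).
- move=> t t0 f; rewrite (E t t0); exact: mehler_nrm (iso_flow_dom t0).
- by rewrite /ousg ltxx.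
- move=> s t s0 t0 f; rewrite (E _ s0) (E _ t0) (E _ (addr_gt0 s0 t0)).
  apply: ae_eq_sym; apply: (mehler_comp_eq f _ (iso_flow_dom s0) (iso_flow_dom t0)).
  by rewrite (flowD lam Vu) addrC.
- move=> f e e0; have e20 : 0 < e ^+ 2 by rewrite exprn_gt0.
  have [t1 t10 H] := sgr_strong_cvg0 iso_flow_dot iso_flow_contract
    iso_flow_form_cvg0 f e20.
  exists t1 => // t t0 tt1; rewrite (E _ t0) nrm_le; last exact: ltW.
  exact: H.
Qed.

Lemma iso_self_adjoint t : 0 <= t -> self_adjoint (ousg V lam (S := S) t).
Proof.
rewrite le_eqVlt => /predU1P[<-|t0] f g; first by rewrite /ousg ltxx.
by rewrite /ousg t0; exact: iso_flow_sym.
Qed.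

End isotropic_semigroup.

(** * Convergence to equilibrium *)

Lemma le_dot_ae d (T : measurableType d) (R : realType)
    (mu : {measure set T -> \bar R}) (f g : L2 mu) :
  f = g %[ae mu] -> dot f f <= dot g g.
Proof. by move=> fg; rewrite (dot_ae f fg) (dot_aer g fg). Qed.

(** The transposed kernel preserves the constant one. *)
Lemma kop_mean d1 d2 (X : measurableType d1) (Y : measurableType d2)
    (R : realType) (mu : probability X R) (nu : probability Y R)
    (m : X -> Y -> R) (f : L2 nu) : bistochastic mu nu m ->
  dot (kop mu m f) (ind mu setT) = dot f (ind nu setT).
Proof.
move=> bm; rewrite (kop_adjoint f _ bm); congr dot; apply/LfuneqP => y.
rewrite (kopE (bistochastic_swap bm)).
rewrite [RHS](congr1 (fun f => f y) (indE (@probability_setT _ _ _ nu) measurableT)).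
rewrite indicT/= (_ : (fun x => _) = m^~ y); last first.
  apply/funext => x.
  rewrite [X in X * _](congr1 (fun f => f x) (indE (@probability_setT _ _ _ mu) measurableT)).
  by rewrite indicT mul1r.
by have [_ _ _ m1] := bm; rewrite /Rintegral m1.
Qed.

Section spectral_gap.
Context (R : realType) (n : nat).
Variables (V : 'M[R]_n) (lam : 'rV[R]_n).
Hypothesis Vu : V \in unitmx.
Variable S : 'M[R]_n.
Hypothesis pS : posdef S.
Local Notation flow := (flow V lam).
Local Notation U := (V *m S *m V^T).

Lemma mehler_mean S1 S2 M (f : L2 (gauss_measure S1)) : mehler_dom S1 S2 M ->
  dot (mehler S2 M f) (ind (gauss_measure S2) setT) =
  dot f (ind (@gauss_measure R n S1) setT).
Proof.
move=> [p1 p2 pC].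
exact: (@kop_mean _ _ _ _ _ (gauss_prob p2) (gauss_prob p1) _ f
  (bistochastic_mehler p1 p2 pC)).
Qed.

(** The transition of the flow factors through an isotropic law: a transition to
  it, the number semigroup of that law at time [- ln q], and a transition back.
  The factor in the middle contracts functions of mean zero by [q], the other
  two are contractions.  It takes a parameter [c] above the norm of [U] and
  below the inverse of the norm of [invmx U] divided by the square of
  [q^-1 * expR (- (gap * t))]; the bound on [q] leaves room for it, the
  condition number being at least one. *)
Lemma flow_gap (gap t q : R) (f : L2 (gauss_measure S)) : (0 < n)%N ->
  (forall i, gap <= lam 0 i) -> 0 <= t ->
  condition_number U * expR (- (gap * t)) < q -> q < 1 ->
  dot f (ind (gauss_measure S) setT) = 0 ->
  dot (mehler S (flow t) f) (mehler S (flow t) f) <= q ^+ 2 * dot f f.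
Proof.
move=> n0 gaple t0 kq q1 mean0.
have k1 : 1 <= condition_number U.
  by apply: condition_number_ge1 n0 _; exact: posdef_congr_tr.
have E0 : 0 < expR (- (gap * t)) := expR_gt0 _.
have q0 : 0 < q by apply: lt_trans kq; rewrite mulr_gt0// (lt_le_trans ltr01).
pose s := - ln q; have s0 : 0 < s by rewrite oppr_gt0 ln_lt0// q0.
have qE : expR (- s) = q by rewrite opprK lnK// posrE.
pose b := opnorm U; pose a := opnorm (invmx U).
pose r := q^-1 * expR (- (gap * t)).
have r0 : 0 < r by rewrite mulr_gt0// invr_gt0.
have ba : condition_number U = b * a by [].
have [b1 a0] := condition_number_gt0 (lt_le_trans ltr01 k1).
have b0 := ltW b1; rewrite -/b -/a in b0 a0.
have kr : condition_number U * r < 1.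
  by rewrite mulrCA mulrC ltr_pdivrMr// mul1r.
have r1 : r < 1.
  by apply: le_lt_trans kr; rewrite -[leLHS]mul1r ler_wpM2r// ltW.
have r2ba : r ^+ 2 * a * b < 1.
  apply: le_lt_trans kr; rewrite ba expr2.
  rewrite (_ : r * r * a * b = r * (b * a * r)); last by ring.
  rewrite -[leRHS]mul1r ler_wpM2r//; last exact: ltW.
  exact: mulr_ge0 (mulr_ge0 b0 (ltW a0)) (ltW r0).
have ra0 : 0 < r ^+ 2 * a by rewrite mulr_gt0// exprn_gt0.
(* any number strictly between [b] and [(r ^+ 2 * a)^-1] *)
pose c := (b + (r ^+ 2 * a)^-1) / 2.
have bra : b < (r ^+ 2 * a)^-1 by rewrite -[ltRHS]mul1r ltr_pdivlMr// mulrC.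
have bc : b < c by rewrite /c; lra.
have c0 : 0 < c by apply: le_lt_trans bc.
have rca : r ^+ 2 * c * a < 1.
  rewrite mulrAC mulrC -ltr_pdivlMr// mul1r /c; lra.
have d1 := iso_cov_above Vu pS bc.
pose m : 'rV[R]_n := \row_i (q^-1 * expR (- t * lam 0 i)).
have d2 : mehler_dom S (iso_cov V c) (diag_conj V m).
  apply: (iso_cov_below Vu pS c0 _ rca) => i.
  rewrite mxE ger0_norm ?mulr_ge0 ?invr_ge0 ?expR_ge0 ?(ltW q0)//.
  by rewrite /r ler_wpM2l ?invr_ge0 ?(ltW q0)// ler_expR mulNr lerN2 mulrC ler_wpM2l.
have [pI _ _] := d1; have d3 := numsg_dom pI s0.
have [d23 _] := mehler_domM d3 d2.
have ME : diag_conj V m *m (expR (- s))%:M *m 1%:M = flow t.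
  rewrite mulmx1 -(diag_conj_cst Vu) diag_conjM//; congr diag_conj.
  apply/rowP => i; rewrite !mxE qE; field; exact/lt0r_neq0.
have e1 := mehler_comp f d3 d2.
have e2 := mehler_comp_eq f ME d1 d23.
have g0 := etrans (mehler_mean f d2) mean0.
set g := mehler (iso_cov V c) (diag_conj V m) f in e1 g0.
have G := numsg_gap pI s0 g0; rewrite /numsg in G.
have cg := mehler_contract f d2; rewrite -/g in cg.
have cu := mehler_contract (mehler (iso_cov V c) (diag_conj V m *m (expR (- s))%:M) f) d1.
apply: (le_trans (le_dot_ae (ae_eq_sym e2))); apply: (le_trans cu).
apply: (le_trans (le_dot_ae (ae_eq_sym e1))); apply: (le_trans G).
rewrite -qE; exact: (ler_wpM2l (sqr_ge0 _) cg).
Qed.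

End spectral_gap.

(** When [1 <= K] the second hypothesis suffices; otherwise let [q] tend to
  [K]. *)
Lemma le_rate_limit (R : realType) (K x y : R) : 0 <= y -> x <= y ->
  (forall q, K < q -> q < 1 -> x <= q * y) -> x <= K * y.
Proof.
move=> y0 xy H; have [K1|K1] := leP 1 K.
  by apply: (le_trans xy); rewrite -[leLHS]mul1r ler_wpM2r.
rewrite leNgt; apply/negP => Kx.
have yp : 0 < y.
  rewrite lt_neqAle y0 andbT eq_sym; apply/eqP => y1.
  by move: Kx; rewrite y1 mulr0 ltNge -y1 xy.
have Kxy : K < x / y by rewrite ltr_pdivlMr.
have xy1 : x / y <= 1 by rewrite ler_pdivrMr// mul1r.
have E : (K + x / y) / 2 * y = (K * y + x) / 2 by field; rewrite gt_eqF.
have := H ((K + x / y) / 2); rewrite E; move: (x / y) Kxy xy1 => z Kz z1 Hz.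
have Kq : K < (K + z) / 2 by lra.
have q1 : (K + z) / 2 < 1 by lra.
have := Hz Kq q1; move: Kx; move: (K * y) => w; lra.
Qed.

Section OU_convergence.
Context (R : realType) (n : nat).
Variables (Q V : 'M[R]_n) (lam : 'rV[R]_n) (gap : R).
Hypothesis n0 : (0 < n)%N.
Hypothesis Vu : V \in unitmx.
Hypothesis lam0 : forall i, 0 < lam 0 i.
Hypothesis gap_le : forall i, gap <= lam 0 i.
Local Notation B := (diag_conj V lam).
Local Notation S := (cov_mx_oo Q B).
Local Notation rho := (invariant_measure Q B).
Local Notation flow := (flow V lam).
Local Notation kappa := (condition_number (V *m S *m V^T)).
Hypothesis psdQ : positive_semidefinite Q.
Hypothesis hypo : hypoelliptic Q B.
Variable P : R -> L2 rho -> L2 rho.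
Hypothesis ouP : OU_semigroup P.
Local Notation one := (ind rho setT).

Let pS : posdef S. Proof. exact: posdef_cov_mx_oo. Qed.
Let pU : posdef (V *m S *m V^T). Proof. exact: posdef_congr_tr. Qed.
Let rho1 : rho setT = 1%E. Proof. exact: gauss_measureT. Qed.

Lemma OU_semigroup_nrm t f : 0 <= t -> nrm (P t f) <= nrm f.
Proof.
move=> t0; have [[_ Pcon _ _ _] _] := ouP.
by have := Pcon t t0 f; rewrite !L2_normE lee_fin.
Qed.

(** [flow_gap] gives every factor between the claimed one and [1]. *)
Lemma OU_semigroup_decay t f : 0 <= t -> dot f one = 0 ->
  nrm (P t f) <= kappa * expR (- (gap * t)) * nrm f.
Proof.
move=> t0 f0; have Pf := OU_semigroup_nrm f t0.
apply: le_rate_limit (nrm_ge0 _) Pf _ => q kq q1.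
have kge := condition_number_ge1 n0 pU.
have qge : 0 <= q.
  by apply/ltW; apply: le_lt_trans kq; rewrite mulr_ge0 ?expR_ge0// (le_trans ler01).
move: t0; rewrite le_eqVlt => /predU1P[t0|t0].
  by exfalso; move: kq; rewrite -t0 mulr0 oppr0 expR0 mulr1; lra.
have E := OU_semigroup_mehler Vu lam0 f psdQ hypo ouP t0.
have H := flow_gap Vu pS n0 gap_le (ltW t0) kq q1 f0.
rewrite nrm_le; last by rewrite mulr_ge0 ?nrm_ge0.
by rewrite exprMn sqr_nrm; exact: le_trans (le_dot_ae E) H.
Qed.

Lemma dot_one (f : L2 rho) : dot f one = \int[rho]_x f x.
Proof.
rewrite /dot indE//; congr (fine _); apply: eq_integral => x _.
by rewrite indicT mulr1.
Qed.

Lemma OU_semigroup_one t : 0 <= t -> P t one = one %[ae rho].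
Proof.
rewrite le_eqVlt => /predU1P[<-|t0].
  by have [[_ _ P0 _ _] _] := ouP; exact: P0.
apply: ae_eq_trans (OU_semigroup_mehler Vu lam0 one psdQ hypo ouP t0) _.
have oneE : one = cst 1 :> (_ -> _) := indTE rho1.
have E := mehler_cst (flow_dom Vu lam0 psdQ hypo t0) oneE.
by apply: filterE => x _; exact: (congr1 (fun h => h x) (etrans E (esym oneE))).
Qed.

Lemma OU_semigroup_mean_decay t (f : L2 rho) : 0 <= t ->
  nrm (P t f - (\int[rho]_x f x) *: one) <=
  kappa * expR (- (gap * t)) * nrm (f - (\int[rho]_x f x) *: one).
Proof.
move=> t0; rewrite -dot_one; set a := dot f one; set g := f - a *: one.
have oo : dot one one = 1 := dot_oneone pS.
have g0 : dot g one = 0 by rewrite /g !dotE oo mulr1 subrr.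
apply: le_trans (OU_semigroup_decay t0 g0).
rewrite le_eqVlt; apply/orP; left; apply/eqP/nrm_ae.
have [[Plin _ _ _ _] _] := ouP.
have gE : g = (- a) *: one + f by rewrite scaleNr addrC.
apply: (@ae_dotP _ _ _ _ (P t f - a *: one) (P t g)) => h.
rewrite gE (dot_ae h (Plin t t0 (- a) one f)) !dotE.
by rewrite (dot_ae h (OU_semigroup_one t0)); ring.
Qed.

End OU_convergence.

Section eigenbasis.
Context (R : realType) (n : nat).
Implicit Types (B V : 'M[R]_n).

Lemma diag_conj_is_diag B V : V \in unitmx -> is_diag_mx (V *m B *m invmx V) ->
  exists lam, B = diag_conj V lam.
Proof.
move=> Vu; have [D DE] : exists D, D = V *m B *m invmx V by eexists.
rewrite -DE => /is_diag_mxP dD; exists (\row_i D i i).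
have dE : diag_mx (\row_i D i i) = D.
  apply/matrixP => i j; rewrite !mxE; have [->|ij] := eqVneq i j.
    by rewrite mulr1n.
  by rewrite mulr0n dD.
by rewrite /diag_conj dE DE !mulmxA mulVmx// mul1mx mulmxKV.
Qed.

Lemma eigenvalue_diag_conj V (lam : 'rV[R]_n) i : V \in unitmx ->
  eigenvalue (diag_conj V lam) (lam 0 i).
Proof.
move=> Vu; apply/eigenvalueP; exists (row i V).
  rewrite -row_mul /diag_conj !mulmxA mulmxV// mul1mx row_mul row_diag_mx.
  by rewrite -scalemxAl -rowE.
apply/eqP => V0; have := row_mul i V (invmx V).
rewrite mulmxV// V0 mul0mx => /matrixP/(_ 0 i)/eqP.
by rewrite !mxE eqxx oner_eq0.
Qed.

Lemma eigenvalue_spectrum B l : eigenvalue B l -> spectrum B l%:C%C.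
Proof.
move=> /eigenvalueP[v vB v0]; apply/eigenvalueP.
exists (map_mx (real_complex R) v); first by rewrite -map_mxM vB map_mxZ.
by rewrite map_mx_eq0.
Qed.

Lemma hypoelliptic_unitmx Q B : Q \in unitmx -> hypoelliptic Q B.
Proof.
move=> Qu W WQ _; apply/eqP; rewrite -subv0; apply/subvP => x /WQ Qx.
by rewrite memv0 -(mulKmx Qu x) Qx mulmx0.
Qed.

(** The entries of [V *m Q *m V^T] are those of the stationary covariance in the
  eigenbasis times the sums of two rates; off the diagonal they vanish. *)
Lemma posdef_noise_iso_cov Q V (lam : 'rV[R]_n) c : V \in unitmx -> 0 < c ->
  (forall i, 0 < lam 0 i) ->
  cov_mx_oo Q (diag_conj V lam) = iso_cov V c -> posdef Q.
Proof.
move=> Vu c0 lam0; have Wu : invmx V \in unitmx by rewrite unitmx_inv.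
have Wtu : (invmx V)^T \in unitmx by rewrite unitmx_tr.
rewrite cov_mx_ooE// /cov_of /iso_cov /diag_cov.
move=> /(can_inj (mulmxK Wtu))/(can_inj (mulKmx Wu))/matrixP E.
have QE : V *m Q *m V^T = diag_mx (\row_i (2 * c * lam 0 i)).
  apply/matrixP => i j; have := E i j; rewrite !mxE.
  set q := \sum__ _ => /(canRL (mulfVK _)) ->; last by rewrite gt_eqF ?addr_gt0.
  by case: eqP => [->|]; rewrite ?mulr1n ?mulr0n ?mul0r//; ring.
have -> : Q = diag_cov V (\row_i (2 * c * lam 0 i)).
  rewrite /diag_cov -QE !mulmxA mulVmx// mul1mx -mulmxA -trmx_mul mulVmx//.
  by rewrite trmx1 mulmx1.
apply: posdef_diag_cov => // i; by rewrite mxE !mulr_gt0.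
Qed.

End eigenbasis.

(** * Intertwining *)

Section intertwining.
Context (R : realType) (n : nat).
Variables (V : 'M[R]_n) (lam : 'rV[R]_n).
Hypothesis Vu : V \in unitmx.
Local Notation flow := (flow V lam).

(** Both sides are the transition of the product of the two matrices. *)
Lemma mehler_flow_intertwine S1 S2 (M : 'M[R]_n) t (f : L2 (gauss_measure S1)) :
  mehler_dom S1 S2 M -> M *m flow t = flow t *m M ->
  mehler_dom S1 S1 (flow t) -> mehler_dom S2 S2 (flow t) ->
  mehler S2 (flow t) (mehler S2 M f) = mehler S2 M (mehler S1 (flow t) f)
    %[ae gauss_measure S2].
Proof.
move=> dM com d1 d2; apply: ae_eq_trans (mehler_comp_eq f com d2 dM) _.
exact/ae_eq_sym/mehler_comp.
Qed.

End intertwining.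

Section intertwining_isotropic.
Context (R : realType) (n : nat).
Variables (Q V : 'M[R]_n) (lam : 'rV[R]_n) (gap : R).
Hypothesis Vu : V \in unitmx.
Hypothesis lam0 : forall i, 0 < lam 0 i.
Hypothesis gap0 : 0 < gap.
Hypothesis gap_le : forall i, gap <= lam 0 i.
Local Notation B := (diag_conj V lam).
Hypothesis psdQ : positive_semidefinite Q.
Hypothesis hypo : hypoelliptic Q B.
Hypothesis specB : spectrum B `<=` [set z | 0 < complex.Re z].
Local Notation S := (cov_mx_oo Q B).
Local Notation rho := (invariant_measure Q B).
Local Notation flow := (flow V lam).
Local Notation U := (V *m S *m V^T).
Local Notation kappa := (condition_number U).
Variable P : R -> L2 rho -> L2 rho.
Hypothesis ouP : OU_semigroup P.

Let pS : posdef S. Proof. exact: posdef_cov_mx_oo. Qed.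

Definition intertwined_with_nondegenerate : Prop :=
  exists (Q' B' : 'M[R]_n)
      (P' : R -> L2 (invariant_measure Q' B') -> L2 (invariant_measure Q' B'))
      (Lam : L2 (invariant_measure Q' B') -> L2 (invariant_measure Q B))
      (Lam' : L2 (invariant_measure Q B) -> L2 (invariant_measure Q' B')),
    let rho' := invariant_measure Q' B' in
    [/\ OU_pair Q' B' /\ Q' \in unitmx,
        OU_semigroup P' /\ (forall t, 0 <= t -> self_adjoint (P' t)),
        quasi_affinity Lam /\ quasi_affinity Lam',
        forall t, 0 <= t ->
          (forall f, P t (Lam f) = Lam (P' t f) %[ae rho]) /\
          (forall f, P' t (Lam' f) = Lam' (P t f) %[ae rho']) &
        forall f, Lam' (Lam f) = P' (gap^-1 * ln kappa) f %[ae rho']].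

(** The given semigroup is then already self-adjoint and non-degenerate, and
  intertwined with itself by the identity. *)
Lemma intertwined_condition_number1 : kappa = 1 -> intertwined_with_nondegenerate.
Proof.
move=> k1; have SE := iso_cov_condition_number1 Vu pS k1.
have [|c0 _] := @condition_number_gt0 _ _ U; first by rewrite k1.
have pQ := posdef_noise_iso_cov Vu c0 lam0 SE.
have [[_ _ P0 _ _] _] := ouP.
have id_qa : quasi_affinity (idfun : L2 rho -> L2 rho).
  apply: contraction_quasi_affinity => //.
    by move=> *; exact: ae_eq_refl.
  by move=> g e e0; exists g; rewrite subrr -(scale0r g) nrmZ normr0 mul0r ltW.
exists Q, B, P, idfun, idfun; split=> //.
- by split=> //; exact: posdef_unit.
- split=> // t; rewrite le_eqVlt => /predU1P[<-|t0] f g.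
    change (dot (P 0 f) g = dot f (P 0 g)).
    by rewrite (dot_ae g (P0 f)) (dot_aer f (P0 g)).
  have Ef := OU_semigroup_mehler Vu lam0 f psdQ hypo ouP t0.
  have Eg := OU_semigroup_mehler Vu lam0 g psdQ hypo ouP t0.
  apply: (etrans (dot_ae g Ef)); apply: etrans (esym (dot_aer f Eg)).
  exact: (iso_flow_sym Vu lam0 c0 SE).
- by move=> t t0; split=> f; exact: ae_eq_refl.
- by move=> f; rewrite k1 ln1 mulr0; exact: (ae_eq_sym (P0 f)).
Qed.

(** The self-adjoint semigroup has the same drift and the isotropic stationary
  covariance of parameter [c].  For [opnorm U < c] the identity matrix is a
  transition from the one law to the other, for [c < opnorm U * kappa] the flow
  at time [gap^-1 * ln kappa] is a transition back. *)
Lemma intertwined_condition_number_gt1 : 1 < kappa -> intertwined_with_nondegenerate.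
Proof.
move=> k1; have kappa0 : 0 < kappa by apply: lt_trans k1.
pose b := opnorm U; pose a := opnorm (invmx U).
have ba : kappa = b * a by [].
have [b0 a0] : 0 < b /\ 0 < a := condition_number_gt0 kappa0.
have bk : b < b * kappa by rewrite ltr_pMr.
have [c /andP[bc cbk]] : exists c, b < c < b * kappa.
  by exists ((b + b * kappa) / 2); rewrite !midf_lt.
have c0 : 0 < c by apply: lt_trans bc.
pose Q' := diag_cov V (\row_i (2 * c * lam 0 i)).
have pQ' : posdef Q' by apply: posdef_diag_cov => // i; rewrite mxE !mulr_gt0.
have Q'u := posdef_unit pQ'.
have hypo' : hypoelliptic Q' B by exact: hypoelliptic_unitmx.
have psdQ' := posdef_psd pQ'.
have S'E : cov_mx_oo Q' B = iso_cov V c.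
  rewrite /Q' cov_mx_oo_diag_cov//; congr diag_cov; apply/rowP => i.
  by rewrite !mxE; field; exact/lt0r_neq0.
pose tau := gap^-1 * ln kappa.
have tau0 : 0 < tau by rewrite mulr_gt0 ?invr_gt0// ln_gt0.
have dL : mehler_dom (cov_mx_oo Q' B) S 1%:M.
  by rewrite S'E; exact: iso_cov_above.
have dL' : mehler_dom S (cov_mx_oo Q' B) (flow tau).
  rewrite S'E; apply: (@iso_cov_below _ _ _ Vu _ pS c kappa^-1) => //.
    move=> i; rewrite mxE ger0_norm ?expR_ge0//.
    rewrite -[leRHS]lnK ?posrE ?invr_gt0// ler_expR lnV ?posrE//.
    rewrite mulNr lerN2 /tau mulrAC ler_peMl ?ln_ge0 ?(ltW k1)//.
    by rewrite mulrC ler_pdivlMr// mul1r.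
  rewrite exprVn -mulrA mulrC ltr_pdivrMr ?exprn_gt0// mul1r.
  have -> : kappa ^+ 2 = b * kappa * a by rewrite expr2 {1}ba; ring.
  by rewrite ltr_pM2r.
have doms t : 0 < t -> mehler_dom S S (flow t) by exact: flow_dom.
have doms' t : 0 < t -> mehler_dom (cov_mx_oo Q' B) (cov_mx_oo Q' B) (flow t).
  exact: flow_dom.
exists Q', B, (ousg V lam (S := cov_mx_oo Q' B)), (mehler S 1%:M),
  (mehler (cov_mx_oo Q' B) (flow tau)).
have P'E t : 0 < t -> ousg V lam (S := cov_mx_oo Q' B) t = mehler _ (flow t).
  by rewrite /ousg => ->.
have P'0 : ousg V lam (S := cov_mx_oo Q' B) 0 = id by rewrite /ousg ltxx.
have PE t f := OU_semigroup_mehler (t := t) Vu lam0 f psdQ hypo ouP.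
have [[_ _ P0 _ _] _] := ouP.
split.
- by split.
- split; last by move=> t; exact: (iso_self_adjoint Vu lam0 c0 S'E).
  split; first exact: (iso_contraction_semigroup Vu lam0 c0 S'E).
  move=> t t0 f _; rewrite (P'E t t0).
  apply: filterE => x _.
  exact: (congr1 (fun h => h x) (mehler_OU_formula Vu lam0 f psdQ' hypo' t0)).
- by split; apply: mehler_quasi_affinity => //; [exact: unitmx1|exact: unitmx_flow].
- move=> t; rewrite le_eqVlt => /predU1P[<-|t0].
    split=> f; rewrite P'0; first exact: P0.
    exact: (ae_eq_sym (mehler_ae dL' (P0 f))).
  split=> f; rewrite (P'E t t0).
    apply: ae_eq_trans (PE t _ t0) _.
    apply: (mehler_flow_intertwine f dL _ (doms' t t0) (doms t t0)).
    by rewrite mul1mx mulmx1.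
  apply: ae_eq_trans (ae_eq_sym (mehler_ae dL' (PE t f t0))).
  apply: (mehler_flow_intertwine f dL' _ (doms t t0) (doms' t t0)).
  by rewrite !(flowD lam Vu) addrC.
- move=> f; rewrite (P'E _ tau0).
  by apply: (mehler_comp_eq f _ dL' dL); rewrite mul1mx.
Qed.

End intertwining_isotropic.

Theorem theorem3p1 (R : realType) (d : nat) (Q B V : 'M[R]_d) (gamma1 : R)
    (P : R -> L2 (invariant_measure Q B) -> L2 (invariant_measure Q B)) :
  (0 < d)%N ->
  positive_semidefinite Q ->
  hypoelliptic Q B ->
  spectrum B `<=` [set l%:C%C | l in `]0, +oo[] ->
  V \in unitmx ->
  is_diag_mx (V *m B *m invmx V) ->
  eigenvalue B gamma1 ->
  (forall l : R, eigenvalue B l -> gamma1 <= l) ->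
  OU_semigroup P ->
  let kappa := condition_number (V *m cov_mx_oo Q B *m V^T) in
  let rho := invariant_measure Q B in
  (exists (Q' B' : 'M[R]_d)
      (P' : R -> L2 (invariant_measure Q' B') -> L2 (invariant_measure Q' B'))
      (Lam : L2 (invariant_measure Q' B') -> L2 (invariant_measure Q B))
      (Lam' : L2 (invariant_measure Q B) -> L2 (invariant_measure Q' B')),
    let rho' := invariant_measure Q' B' in
    [/\ OU_pair Q' B' /\ Q' \in unitmx,
        OU_semigroup P' /\ (forall t, 0 <= t -> self_adjoint (P' t)),
        quasi_affinity Lam /\ quasi_affinity Lam',
        forall t, 0 <= t ->
          (forall f, P t (Lam f) = Lam (P' t f) %[ae rho]) /\
          (forall f, P' t (Lam' f) = Lam' (P t f) %[ae rho']) &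
        forall f, Lam' (Lam f) = P' (gamma1^-1 * ln kappa) f %[ae rho']]) /\
  (forall (f : L2 rho) (t : R), 0 <= t ->
    let mean := \int[rho]_x f x in
    ('N[rho]_2 [EFin \o (fun x => P t f x - mean)%R] <=
     (kappa * expR (- (gamma1 * t)))%:E *
     'N[rho]_2 [EFin \o (fun x => f x - mean)%R])%E).
Proof.
move=> d0 psdQ hypo spec Vu diagB eigB gap_le ouP kappa rho.
have [lam BE] := diag_conj_is_diag Vu diagB; subst B.
have eig_gt0 l : eigenvalue (diag_conj V lam) l -> 0 < l.
  move=> /eigenvalue_spectrum/spec[r]; rewrite /= in_itv/= andbT => r0.
  by move=> /complexI <-.
have lam0 i : 0 < lam 0 i by apply: eig_gt0; exact: eigenvalue_diag_conj.
have gap0 : 0 < gamma1 := eig_gt0 _ eigB.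
have gapl i : gamma1 <= lam 0 i by apply: gap_le; exact: eigenvalue_diag_conj.
have specB : spectrum (diag_conj V lam) `<=` [set z | 0 < complex.Re z].
  by move=> z /spec[r]; rewrite /= in_itv/= andbT => r0 <-.
have pS := posdef_cov_mx_oo Vu lam0 psdQ hypo.
split.
  have pU : posdef (V *m cov_mx_oo Q (diag_conj V lam) *m V^T).
    exact: posdef_congr_tr.
  have := condition_number_ge1 d0 pU.
  rewrite le_eqVlt => /predU1P[k1|k1].
    exact: (intertwined_condition_number1 gamma1 Vu lam0 psdQ hypo specB ouP (esym k1)).
  exact: (intertwined_condition_number_gt1 Vu lam0 gap0 gapl psdQ hypo specB ouP k1).
move=> f t t0; cbv zeta; set mean := \int[rho]_x f x.
have H := OU_semigroup_mean_decay d0 Vu lam0 gapl psdQ hypo ouP f t0.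
have normE (h : L2 rho) : ('N[rho]_2[EFin \o (fun x => (h x - mean)%R)])%E =
    (nrm (h - mean *: ind rho setT))%:E.
  rewrite -L2_normE; congr (Lnorm _ _ _); apply/funext => x /=; congr EFin.
  rewrite -[RHS]/(h x - mean * ind rho setT x) indE//; last exact: gauss_measureT.
  by rewrite indicT/= mulr1.
rewrite [leLHS](_ : _ = (nrm (P t f - mean *: ind rho setT))%:E); last exact: normE.
rewrite [X in (_ * X)%E](_ : _ = (nrm (f - mean *: ind rho setT))%:E); last exact: normE.
by rewrite -EFinM lee_fin; exact: H.
Qed.
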